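(* Let $\theta\in[0,1[$ be irrational. Let $M$ and $s$ be integers with $1\le s\le M-1$ and let $k_1,\ldots,k_s\in\{1,\ldots,M-1\}$ satisfy $M>k_1>k_2>\cdots>k_s>0$. For $j=1,\ldots,s$ set $$c_j^+=\begin{cases}\dfrac{1}{2(M-k_1+k_2-k_3+\cdots-k_j)}, & j\text{ odd},\\[2mm] \dfrac{1}{2(M-k_1+k_2-k_3+\cdots-k_{j-1})+k_j}, & j\text{ even},\end{cases}$$ $$c_j^-=\begin{cases}\dfrac{1}{2(M-k_1+k_2-k_3+\cdots+k_{j-1})-k_j}, & j\text{ odd},\\[2mm] \dfrac{1}{2(M-k_1+k_2-k_3+\cdots+k_j)}, & j\text{ even}\end{cases}$$ (so that $c_1^-=1/(2M-k_1)$). Assume that for every odd $j\in\{1,\ldots,s\}$ one has $c_j^-<\theta\le c_j^+$ and for every even $j\in\{1,\ldots,s\}$ one has $c_j^-\le\theta<c_j^+$, i.e. $$\theta\in\,]c_1^-,c_1^+]\cap[c_2^-,c_2^+[\,\cap\cdots\cap[c_s^-,c_s^+]\setminus\{c_s^{\pm}\},\qquad \pm=(-1)^s.$$ Then there exists a projection $p\in\mathcal{A}_\theta$ of order $M$ which is invariant under the flip automorphism, $\sigma(p)=p$, and which represents the $K_0$ class $[(M-k_1+k_2-k_3+\cdots+(-1)^sk_s)\theta]$, i.e. $\tau(p)=(M-k_1+k_2-k_3+\cdots+(-1)^sk_s)\theta$.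
   Context: For irrational $\theta\in[0,1[$, $A_\theta$ is the universal $C^*$-algebra generated by two unitaries $U,V$ with $VU=e^{2\pi i\theta}UV$ (the noncommutative 2-torus). $\mathcal{A}_\theta\subset A_\theta$ is the dense $*$-subalgebra of elements $\sum_{(m,n)\in\mathbb{Z}^2}a_{m,n}U^mV^n$ with $\{a_{m,n}\}$ a Schwartz (rapidly decreasing) sequence on $\mathbb{Z}^2$. For $f\in C^\infty(\mathbb{R}/\mathbb{Z})$ with Fourier series $f(x)=\sum_nf_ne^{2\pi inx}$, put $f(V)=\sum_nf_nV^n\in\mathcal{A}_\theta$. A projection is a selfadjoint idempotent. A projection $p\in\mathcal{A}_\theta$ is of order $M$ if it has the form $p=\sum_{n=-M}^{M}U^np_n(V)$ with all $p_n\in C^\infty(\mathbb{R}/\mathbb{Z})$ (complex-valued) and $p_M\neq0$ (not identically zero). The flip automorphism $\sigma\in\mathrm{Aut}\,A_\theta$ is determined by $\sigma(U)=U^{-1}$, $\sigma(V)=V^{-1}$. The canonical trace $\tau$ is $\tau\big(\sum a_{m,n}U^mV^n\big)=a_{0,0}$; on elements $b=\sum_{m\text{ finite}}U^mb_m(V)$ it equals $\int_0^1b_0(x)\,dx$. The $K_0$ class of a projection in $\mathcal{A}_\theta$ is uniquely determined by its trace (a known fact), and for a real number $t$ the symbol $[t]\in K_0(\mathcal{A}_\theta)$ denotes the class represented by a projection $p\in\mathcal{A}_\theta$ with $\tau(p)=t$. Here $]a,b]$ and $[a,b[$ denote half-open intervals. *)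

(* Defs.v *)
From HB Require Import structures.
From mathcomp Require Import all_boot all_order all_algebra.
From mathcomp Require Import complex.
From mathcomp Require Import all_classical all_reals all_analysis.

Set Implicit Arguments.
Unset Strict Implicit.
Unset Printing Implicit Defensive.

Import Order.TTheory GRing.Theory Num.Theory.
Import numFieldNormedType.Exports.

Local Open Scope classical_set_scope.
Local Open Scope ring_scope.
Local Open Scope complex_scope.

(* Unital, with 1 <> 0. *)
Record cstarAlgType (R : realType) := CStarAlgType {
  cstar_carrier : completeNormedModType R[i] ;
  cstar_one : cstar_carrier ;
  cstar_mul : cstar_carrier -> cstar_carrier -> cstar_carrier ;
  cstar_star : cstar_carrier -> cstar_carrier ;
  cstar_mulA : associative cstar_mul ;
  cstar_mul1l : left_id cstar_one cstar_mul ;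
  cstar_mul1r : right_id cstar_one cstar_mul ;
  cstar_mulDl : left_distributive cstar_mul +%R ;
  cstar_mulDr : right_distributive cstar_mul +%R ;
  cstar_one_neq0 : cstar_one != 0 ;
  cstar_scaleAl : forall (a : R[i]) x y,
    a *: cstar_mul x y = cstar_mul (a *: x) y ;
  cstar_scaleAr : forall (a : R[i]) x y,
    a *: cstar_mul x y = cstar_mul x (a *: y) ;
  cstar_starK : involutive cstar_star ;
  cstar_starD : {morph cstar_star : x y / x + y} ;
  cstar_starZ : forall (a : R[i]) x,
    cstar_star (a *: x) = a^* *: cstar_star x ;
  cstar_starM : forall x y,
    cstar_star (cstar_mul x y) = cstar_mul (cstar_star y) (cstar_star x) ;
  cstar_normM : forall x y, `|cstar_mul x y| <= `|x| * `|y| ;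
  cstar_normE : forall x, `|cstar_mul (cstar_star x) x| = `|x| ^+ 2
}.

(* Num.NumDomain already joins norms and products, so no generic structure can
   join normed modules and algebras; both are put on this carrier instead. *)
Definition cstar_sort (R : realType) (A : cstarAlgType R) : Type :=
  cstar_carrier A.
Coercion cstar_sort : cstarAlgType >-> Sortclass.

Section CStarInstances.
Context {R : realType} (A : cstarAlgType R).

HB.instance Definition _ :=
  CompleteNormedModule.copy (cstar_sort A) (cstar_carrier A).
HB.instance Definition _ := GRing.Zmodule_isNzRing.Build (cstar_sort A)
  (@cstar_mulA R A) (@cstar_mul1l R A) (@cstar_mul1r R A)
  (@cstar_mulDl R A) (@cstar_mulDr R A) (@cstar_one_neq0 R A).
HB.instance Definition _ :=
  GRing.Lmodule_isLalgebra.Build R[i] (cstar_sort A) (@cstar_scaleAl R A).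
HB.instance Definition _ :=
  GRing.Lalgebra_isAlgebra.Build R[i] (cstar_sort A) (@cstar_scaleAr R A).

Definition star (x : A) : A := cstar_star x.

End CStarInstances.

Section CStarTheory.
Context {R : realType}.
Implicit Types A B : cstarAlgType R.

Definition unitary A (u : A) : Prop := star u * u = 1 /\ u * star u = 1.

Definition projection A (p : A) : Prop := star p = p /\ p * p = p.

(* Every unital *-homomorphism of C*-algebras is contractive, so the last
   clause is no restriction. *)
Definition star_morphism A B (phi : {lrmorphism A -> B}) : Prop :=
  (forall x, phi (star x) = star (phi x)) /\ (forall x, `|phi x| <= `|x|).

Definition cstar_subalgebra A (S : set A) : Prop :=
  [/\ closed S, S 1,
      forall (a : R[i]) x y, S x -> S y -> S (a *: x + y),
      forall x y, S x -> S y -> S (x * y) &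
      forall x, S x -> S (star x)].

(* Integer powers of a unitary, where u^-1 = u^*. *)
Definition upow A (u : A) (n : int) : A :=
  match n with
  | Posz k => u ^+ k
  | Negz k => star u ^+ k.+1
  end.

End CStarTheory.

(* \sum_{n = -N}^{N} F n *)
Definition symsum (V : nmodType) (N : nat) (F : int -> V) : V :=
  \sum_(i < N.*2.+1) F (i%:Z - N%:Z).

Section FourierSeries.
Context {R : realType}.

(* exp (2 pi i x) *)
Definition cexp (x : R) : R[i] := cos (2 * pi * x) +i* sin (2 * pi * x).

Definition smooth_fun (f : R -> R[i]) : Prop :=
  forall (n : nat) (x : R),
    derivable (derive1n n (fun y => complex.Re (f y))) x 1 /\
    derivable (derive1n n (fun y => complex.Im (f y))) x 1.

Definition smooth_circle (f : R -> R[i]) : Prop :=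
  smooth_fun f /\ forall x, f (x + 1) = f x.

Definition cintegral01 (f : R -> R[i]) : R[i] :=
  (\int[lebesgue_measure]_(x in `[0%R, 1%R]) complex.Re (f x))%R +i*
  (\int[lebesgue_measure]_(x in `[0%R, 1%R]) complex.Im (f x))%R.

Definition fourier_coef (f : R -> R[i]) (n : int) : R[i] :=
  cintegral01 (fun x => f x * cexp (- (n%:~R * x))).

End FourierSeries.

Section NCTorus.
Context {R : realType}.
Implicit Types A B : cstarAlgType R.

Definition torus_relations (theta : R) A (U V : A) : Prop :=
  [/\ unitary U, unitary V & V * U = cexp theta *: (U * V)].

(* A, with its elements U and V, is the universal C*-algebra generated by two
   unitaries subject to V U = exp (2 pi i theta) U V; uniqueness of phi
   follows from the generation clause. *)
Definition is_nctorus (theta : R) A (U V : A) : Prop :=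
  [/\ torus_relations theta U V,
      forall S : set A, cstar_subalgebra S -> S U -> S V -> S = setT &
      forall B (u v : B), torus_relations theta u v ->
        exists phi : {lrmorphism A -> B},
          [/\ star_morphism phi, phi U = u & phi V = v]].

(* f(V) = \sum_n f_n V^n; the limit exists for smooth f. *)
Definition fun_at A (V : A) (f : R -> R[i]) : A :=
  lim ((fun N : nat => symsum N (fun n => fourier_coef f n *: upow V n))
         @ \oo).

Definition schwartz (a : int -> int -> R[i]) : Prop :=
  forall k : nat, exists C : R, forall m n : int,
    (1 + `|m|%:~R + `|n|%:~R) ^+ k * `|a m n| <= C%:C.

(* x = \sum_(m, n) a m n U^m V^n, summed over growing squares; the series
   converges absolutely whenever a is rapidly decreasing. *)
Definition has_expansion A (U V : A) (a : int -> int -> R[i]) (x : A) : Prop :=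
  (fun N : nat => symsum N (fun m => symsum N (fun n =>
     a m n *: (upow U m * upow V n)))) @ \oo --> x.

Definition smooth_elt A (U V : A) (x : A) : Prop :=
  exists2 a, schwartz a & has_expansion U V a x.

Definition of_order A (U V : A) (M : nat) (p : A) : Prop :=
  exists f : int -> R -> R[i],
    [/\ forall n : int, `|n| <= M%:Z -> smooth_circle (f n),
        p = symsum M (fun n => upow U n * fun_at V (f n)) &
        exists x, f M%:Z x != 0].

Definition is_flip A (U V : A) (sigma : {lrmorphism A -> A}) : Prop :=
  [/\ star_morphism sigma, bijective sigma,
      sigma U = upow U (-1) & sigma V = upow V (-1)].

(* Only the values of the trace on the smooth subalgebra are prescribed. *)
Definition is_canonical_trace A (U V : A) (tau : A -> R[i]) : Prop :=
  forall a x, schwartz a -> has_expansion U V a x -> tau x = a 0 0.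

(* p and q have the same class in K_0 of the smooth subalgebra: for some k,
   the idempotents p (+) 1_k and q (+) 1_k are x y and y x, for matrices x and
   y over that subalgebra. *)
Definition K0_eq A (U V : A) (p q : A) : Prop :=
  exists (k : nat) (x y : 'M[A]_(1 + k)),
    [/\ forall i j, smooth_elt U V (x i j) /\ smooth_elt U V (y i j),
        x *m y = block_mx p%:M 0 0 1%:M &
        y *m x = block_mx q%:M 0 0 1%:M].

(* The K_0 class of p is [t]. *)
Definition represents_K0 A (U V : A) (tau : A -> R[i]) (p : A) (t : R) : Prop :=
  exists q : A,
    [/\ smooth_elt U V q, projection q, tau q = t%:C & K0_eq U V p q].

End NCTorus.

(* The sequence k is indexed from 1; the value k 0 is never used. *)

Section Bounds.
Context {R : realType}.
Variables (M : nat) (k : nat -> nat).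

(* M - k_1 + k_2 - ... + (-1)^j k_j *)
Definition altsum (j : nat) : R :=
  M%:R + \sum_(1 <= i < j.+1) (-1) ^+ i * (k i)%:R.

Definition cplus (j : nat) : R :=
  if odd j then 1 / (2 * altsum j)
  else 1 / (2 * altsum j.-1 + (k j)%:R).

Definition cminus (j : nat) : R :=
  if odd j then 1 / (2 * altsum j.-1 - (k j)%:R)
  else 1 / (2 * altsum j).

End Bounds.

(* Main.v *)
Require Import Defs.
From mathcomp Require Import all_boot all_order all_algebra.
From mathcomp Require Import complex.
From mathcomp Require Import all_classical all_reals all_analysis.
From mathcomp Require Import ring lra zify.

Import Order.TTheory GRing.Theory Num.Theory.
Import numFieldNormedType.Exports.

Local Open Scope classical_set_scope.
Local Open Scope ring_scope.
Local Open Scope complex_scope.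

(* The k_j only enter through T = M - k_1 + k_2 - ... + (-1)^s k_s: the
   hypotheses force 0 < T < M and T theta < 1.  On an orbit x + Z theta of the
   circle an element sum_n U^n p_n(V) acts as a band matrix, and the projection
   is a direct sum of 2x2 rank-one blocks and 1x1 blocks 0 or 1.  The blocks
   {x, x + T theta}, for x near -T theta/2, turn the indicator function of the
   arc of length T theta centred at 0 into a smooth function (the Powers-Rieffel
   projection, of trace T theta); additional blocks {x, x + M theta}, with x
   outside that arc and x + M theta inside, and their mirror images under
   x -> -x raise the order to M without changing the trace or the class.  All
   blocks are disjoint, and the family is invariant under the flip. *)

(** * Smooth real functions *)

(** The algebra is given abstractly and f(V) only as a norm limit of Fourier sums, so a large part
    of the work is to show that f |-> f(V) respects products, adjoints and translations. Products
    are the obstacle: multiplicativity is derived from Fourier inversion with an error c/N that is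
    governed by two derivatives. After that, p = p^2 amounts to finitely many identities between
    three 1-periodic real functions f, g, h, the coefficients of 1, U^T and U^M. A symmetric 2x2
    block with diagonal 1/2 + a, 1/2 - a and off-diagonal entry b is a projection of rank one when
    a^2 + b^2 = 1/4. At the ends of the arc the point (a, b) runs through a half circle, which moves
    the diagonal from 0 to 1. At the additional blocks it leaves its starting point and comes back,
    and what one diagonal entry gains the other loses, so the integral of f is unchanged. The
    inequality T theta < 1 leaves room outside the arc. Irrationality makes the rotation by M theta
    nontrivial on the circle, so that some point outside the arc is carried inside. The class is
    represented by p itself. *)

Section RealSmooth.
Context {R : realType}.
Implicit Types f g : R -> R.

(** Derivatives are given by a relation between globally defined functions, so the calculus rules
    carry no separate derivability conditions. *)
Definition isD f f' := forall x : R, is_derive x (1 : R) f (f' x).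

Lemma isD_derive1 f f' : isD f f' -> derive1 f = f'.
Proof.
by move=> h; apply/funext => x; rewrite derive1E; have [_ ->] := h x.
Qed.

Lemma isD_derivable f f' x : isD f f' -> derivable f x 1.
Proof. by move=> /(_ x) []. Qed.

Lemma isD_continuous f f' : isD f f' -> continuous f.
Proof.
move=> h x; apply: differentiable_continuous.
by apply/derivable1_diffP; apply: isD_derivable h.
Qed.

Lemma isD_ext f f' g' : isD f f' -> f' =1 g' -> isD f g'.
Proof. by move=> h e x; rewrite -e. Qed.

Lemma isDD f g f' g' : isD f f' -> isD g g' ->
  isD (fun x => f x + g x) (fun x => f' x + g' x).
Proof. by move=> hf hg x; apply: is_deriveD. Qed.

Lemma isDN f f' : isD f f' -> isD (fun x => - f x) (fun x => - f' x).
Proof. by move=> hf x; apply: is_deriveN. Qed.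

Lemma isDM f g f' g' : isD f f' -> isD g g' ->
  isD (fun x => f x * g x) (fun x => f x * g' x + g x * f' x).
Proof.
move=> hf hg x; have h := is_deriveM (hf x) (hg x).
by apply: is_derive_eq.
Qed.

Lemma isD_cst c : isD (fun=> c) (fun=> 0).
Proof. by move=> x; apply: is_derive_cst. Qed.

Lemma isD_id : isD id (fun=> 1).
Proof. by move=> x; apply: is_derive_id. Qed.

Lemma isD_comp f g f' g' : isD f f' -> isD g g' ->
  isD (fun x => f (g x)) (fun x => f' (g x) * g' x).
Proof. by move=> hf hg x; apply: is_derive1_comp. Qed.

Lemma isDV f f' : (forall x, f x != 0) -> isD f f' ->
  isD (fun x => (f x)^-1) (fun x => - f' x * ((f x)^-1 * (f x)^-1)).
Proof.
move=> f0 hf x.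
have h := is_deriveV (f0 x) (hf x).
by apply: is_derive_eq; rewrite /GRing.scale/=; field; apply: f0.
Qed.

Lemma isD_sin : isD (@sin R) cos.
Proof. by move=> x; apply: is_derive_sin. Qed.

Lemma isD_cos : isD (@cos R) (fun x => - sin x).
Proof. by move=> x; apply: is_derive_cos. Qed.

Lemma isD_lin a b : isD (fun x => a * x + b) (fun=> a).
Proof.
apply: isD_ext (isDD _ _ _ _ (isDM _ _ _ _ (isD_cst a) isD_id) (isD_cst b)) _ => x.
by rewrite mulr1 mulr0 !addr0.
Qed.

Lemma isD_shift f f' a : isD f f' -> isD (fun x => f (x + a)) (fun x => f' (x + a)).
Proof.
move=> hf; have h := isD_comp _ _ _ _ hf (isD_lin 1 a).
rewrite (_ : (fun x => f (x + a)) = fun x => f (1 * x + a)); last first.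
  by apply/funext => x; rewrite mul1r.
by apply: isD_ext h _ => x; rewrite mul1r mulr1.
Qed.

Lemma isD0_cst f x y : isD f (fun=> 0) -> f x = f y.
Proof. by move=> h; apply: is_derive_0_is_cst. Qed.

Lemma isD_MVT f f' a b : isD f f' -> a <= b ->
  exists2 c, c \in `[a, b]%R & f b - f a = f' c * (b - a).
Proof.
move=> h ab; apply: MVT_segment => //.
exact/continuous_subspaceT/(isD_continuous _ _ h).
Qed.

(** A chain of n derivatives serves as witness: closure under products, composition and inverses
    becomes an induction on n without formulas for higher derivatives. *)
Fixpoint Ck n f : Prop :=
  if n is m.+1 then exists2 f', isD f f' & Ck m f' else True.

Definition smooth f := forall n, Ck n f.

Lemma smoothE f : smooth f <-> forall n x, derivable (derive1n n f) x 1.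
Proof.
split=> [h n|h n].
  have {h} := h n.+1; elim: n f => [|n IH] f [f' hf h] x.
    exact: isD_derivable hf.
  by rewrite derive1Sn (isD_derive1 _ _ hf); apply: IH.
elim: n f h => // n IH f h; exists (derive1 f).
  by move=> x; rewrite derive1E; apply/derivableP; exact: (h 0%N).
by apply: IH => m x; rewrite -derive1Sn; apply: h.
Qed.

Lemma Ck_le n f : Ck n.+1 f -> Ck n f.
Proof.
elim: n f => // n IH f [f' hf h]; exists f' => //; exact: IH.
Qed.

Lemma smooth_isD f : smooth f -> exists2 f', isD f f' & smooth f'.
Proof.
move=> h; have [f' hf _] := h 1%N; exists f' => // n.
have [g hg hn] := h n.+1.
by rewrite -(isD_derive1 _ _ hf) (isD_derive1 _ _ hg).
Qed.

Lemma smooth_derive1 f : smooth f -> isD f (derive1 f) /\ smooth (derive1 f).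
Proof. by move=> /smooth_isD[f' hf hs]; rewrite (isD_derive1 _ _ hf). Qed.

Lemma smooth_continuous f : smooth f -> continuous f.
Proof. by move=> /smooth_isD[f' /isD_continuous]. Qed.

Lemma CkD n f g : Ck n f -> Ck n g -> Ck n (fun x => f x + g x).
Proof.
elim: n f g => // n IH f g [f' hf hf'] [g' hg hg'].
by exists (fun x => f' x + g' x); [apply: isDD|apply: IH].
Qed.

Lemma CkM n f g : Ck n f -> Ck n g -> Ck n (fun x => f x * g x).
Proof.
elim: n f g => // n IH f g Hf Hg; have [f' hf hf'] := Hf; have [g' hg hg'] := Hg.
exists (fun x => f x * g' x + g x * f' x); first exact: isDM.
by apply: CkD; apply: IH => //; apply: Ck_le.
Qed.

Lemma Ck_cst n c : Ck n (fun=> c).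
Proof. by elim: n c => // n IH c; exists (fun=> 0) => //; apply: isD_cst. Qed.

Lemma Ck_comp n f g : Ck n f -> Ck n g -> Ck n (fun x => f (g x)).
Proof.
elim: n f g => // n IH f g [f' hf hf'] Hg; have [g' hg hg'] := Hg.
exists (fun x => f' (g x) * g' x); first exact: isD_comp.
by apply: CkM => //; apply: IH => //; apply: Ck_le.
Qed.

Lemma CkV n f : (forall x, f x != 0) -> Ck n f -> Ck n (fun x => (f x)^-1).
Proof.
move=> f0; elim: n => // n IH Hf; have [f' hf hf'] := Hf.
exists (fun x => - f' x * ((f x)^-1 * (f x)^-1)); first exact: isDV.
have {}IH := IH (Ck_le _ _ Hf).
apply: CkM; last exact: CkM.
rewrite (_ : (fun _ => _) = fun x => -1 * f' x); last first.
  by apply/funext => x; rewrite mulN1r.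
by apply: CkM => //; apply: Ck_cst.
Qed.

Lemma smoothD f g : smooth f -> smooth g -> smooth (fun x => f x + g x).
Proof. by move=> hf hg n; apply: CkD. Qed.

Lemma smoothM f g : smooth f -> smooth g -> smooth (fun x => f x * g x).
Proof. by move=> hf hg n; apply: CkM. Qed.

Lemma smooth_cst c : smooth (fun=> c).
Proof. by move=> n; apply: Ck_cst. Qed.

Lemma smoothN f : smooth f -> smooth (fun x => - f x).
Proof.
move=> hf; rewrite (_ : (fun _ => _) = fun x => -1 * f x); last first.
  by apply/funext => x; rewrite mulN1r.
by apply: smoothM => //; apply: smooth_cst.
Qed.

Lemma smoothB f g : smooth f -> smooth g -> smooth (fun x => f x - g x).
Proof. by move=> hf hg; apply: smoothD => //; apply: smoothN. Qed.

Lemma smooth_comp f g : smooth f -> smooth g -> smooth (fun x => f (g x)).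
Proof. by move=> hf hg n; apply: Ck_comp. Qed.

Lemma smoothV f : (forall x, f x != 0) -> smooth f -> smooth (fun x => (f x)^-1).
Proof. by move=> f0 hf n; apply: CkV. Qed.

Lemma smooth_lin a b : smooth (fun x => a * x + b).
Proof.
case=> // n; exists (fun=> a); [exact: isD_lin|exact: Ck_cst].
Qed.

Lemma smooth_shift f a : smooth f -> smooth (fun x => f (x + a)).
Proof.
move=> hf; rewrite (_ : (fun _ => _) = fun x => f (1 * x + a)).
  by apply: smooth_comp => //; apply: smooth_lin.
by apply/funext => x; rewrite mul1r.
Qed.

Lemma smooth_opp f : smooth f -> smooth (fun x => f (- x)).
Proof.
move=> hf; rewrite (_ : (fun _ => _) = fun x => f (- 1 * x + 0)).
  by apply: smooth_comp => //; apply: smooth_lin.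
by apply/funext => x; rewrite mulN1r addr0.
Qed.

Lemma smooth_sincos : smooth (@sin R) /\ smooth (@cos R).
Proof.
suff h n : Ck n (@sin R) /\ Ck n (@cos R) by split=> n; have [] := h n.
elim: n => // n [hs hc]; split; first by exists cos => //; exact: isD_sin.
exists (fun x => -1 * sin x); last by apply: CkM => //; apply: Ck_cst.
by apply: isD_ext isD_cos _ => x; rewrite mulN1r.
Qed.

Lemma smooth_sin : smooth (@sin R). Proof. by have [] := smooth_sincos. Qed.
Lemma smooth_cos : smooth (@cos R). Proof. by have [] := smooth_sincos. Qed.

(** Needed for functions glued from pieces, which have a closed formula only near each point. *)
Lemma smooth_local f :
  (forall a, exists2 w, smooth w & \forall x \near (a : R), f x = w x) -> smooth f.
Proof.
move=> h n; elim: n f h => // n IH f h.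
have dw a w : smooth w -> (\forall x \near (a : R), f x = w x) ->
    is_derive (a : R) (1 : R) f (derive1 w a).
  move=> /smooth_derive1[/(_ a) hw _] e.
  apply: near_eq_is_derive hw.
  by apply: filterS e => x /esym.
exists (derive1 f).
  move=> a; have [w sw e] := h a; have := dw a w sw e => /[dup] h1 [_ e1].
  by rewrite derive1E e1.
apply: IH => a; have [w sw e] := h a.
exists (derive1 w); first by have [] := smooth_derive1 _ sw.
(* The equality with [w] also holds around every point near [a], so the derivatives agree near [a]
   and not only at [a]. *)
have {}e := @nbhs_interior _ _ _ e.
by apply: filterS e => x /(dw x w sw) [_ e1]; rewrite derive1E e1.
Qed.

End RealSmooth.

(** * A smooth staircase *)

Section Bumps.
Context {R : realType}.

Lemma is_derive_quadratic (f : R -> R) (C : R) :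
  (forall h, `|f h| <= C * h ^+ 2) -> is_derive (0 : R) (1 : R) f 0.
Proof.
move=> fC.
have f0 : f 0 = 0.
  by apply/eqP; rewrite -normr_le0 (le_trans (fC 0))// expr0n mulr0.
have C0 : 0 <= C by have := le_trans (normr_ge0 _) (fC 1); rewrite expr1n mulr1.
have lim0 : (fun h : R => h^-1 *: (f (h *: (1 : R) + 0) - f 0)) @ 0^' --> (0 : R).
  apply/cvgrPdist_le => eps eps0; near=> h.
  have h0 : h != 0 by near: h; exact: nbhs_dnbhs_neq.
  rewrite sub0r normrN f0 subr0 addr0 /GRing.scale/= mulr1 normrM normfV.
  apply: (@le_trans _ _ (`|h|^-1 * (C * h ^+ 2))).
    by rewrite ler_wpM2l// invr_ge0.
  have hp : 0 < `|h| by rewrite normr_gt0.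
  rewrite -[h ^+ 2]real_normK ?num_real//.
  have -> : `|h|^-1 * (C * `|h| ^+ 2) = C * `|h| by field; rewrite gt_eqF.
  have hs : `|h| <= eps / (C + 1).
    by near: h; apply: dnbhs0_le; rewrite divr_gt0// ltr_wpDl.
  rewrite (le_trans (ler_wpM2l C0 hs))// mulrCA ler_piMr ?(ltW eps0)//.
  by rewrite ler_pdivrMr ?ltr_wpDl// mul1r lerDl ler01.
apply: DeriveDef; first by apply: cvgP lim0.
exact: cvg_lim lim0.
Unshelve. all: by end_near. Qed.

(** [expR y] is the n-th power of [expR (y / n)], which is at least [y / n]. *)
Lemma pow_mul_expRN_le (y : R) n : (0 < n)%N -> 0 < y ->
  y ^+ n * expR (- y) <= n%:R ^+ n.
Proof.
move=> n0 y0; rewrite expRN ler_pdivrMr ?expR_gt0//.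
have nR : 0 < n%:R :> R by rewrite ltr0n.
have -> : expR y = expR (y / n%:R) ^+ n.
  by rewrite -expRM_natl mulrCA divff ?mulr1// gt_eqF.
rewrite -exprMn; apply: lerXn2r.
- by rewrite nnegrE ltW.
- by rewrite nnegrE mulr_ge0// expR_ge0.
have yE : y = n%:R * (y / n%:R) by field; rewrite gt_eqF.
by rewrite {1}yE ler_pM2l// (le_trans _ (expR_ge1Dx _))// lerDr.
Qed.

(** [flat 0] is the classical function exp(-1/t) extended by 0; the index [k] makes the linear span
    of the family closed under differentiation. *)
Definition flat (k : nat) (t : R) : R :=
  if 0 < t then t^-1 ^+ k * expR (- t^-1) else 0.

(** This is [pow_mul_expRN_le] at [t^-1] with exponent [k.+2]: the two extra powers produce the
    factor [t ^+ 2], which gives derivative 0 at the origin. *)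
Lemma flat_quadratic k t : `|flat k t| <= k.+2%:R ^+ k.+2 * t ^+ 2.
Proof.
rewrite /flat; case: ifPn => t0; last first.
  by rewrite normr0 mulr_ge0 ?sqr_ge0// exprn_ge0.
have tV0 : 0 < t^-1 by rewrite invr_gt0.
rewrite ger0_norm; last by rewrite mulr_ge0 ?expR_ge0// exprn_ge0// ltW.
have h := ler_wpM2r (ltW (exprn_gt0 2 t0)) (pow_mul_expRN_le t^-1 k.+2 isT tV0).
apply: le_trans h.
rewrite le_eqVlt; apply/orP; left; apply/eqP.
by rewrite !exprS; field; rewrite gt_eqF.
Qed.

Lemma flat_isD k :
  isD (flat k) (fun t => flat k.+2 t + - k%:R * flat k.+1 t).
Proof.
have pos (t : R) : 0 < t ->
    is_derive t (1 : R) (fun t => t^-1 ^+ k * expR (- t^-1))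
      (flat k.+2 t + - k%:R * flat k.+1 t).
  move=> t0; rewrite /flat t0.
  have dV : is_derive t (1 : R) (fun t : R => t^-1) (- t^-1 ^+ 2).
    have h := is_deriveV (lt0r_neq0 t0) (is_derive_id t (1 : R)).
    by apply: is_derive_eq; rewrite /GRing.scale/= mulr1 exprVn.
  elim: k => [|k IH].
    have dN : is_derive t (1 : R) (fun t : R => - t^-1) (t^-1 ^+ 2).
      by have h := is_deriveN dV; apply: is_derive_eq; rewrite opprK.
    have h := @is_derive1_comp _ expR (fun t : R => - t^-1) _ _ _ (is_derive_expR (- t^-1)) dN.
    rewrite (_ : (fun _ => _) = expR \o (fun t : R => - t^-1)); last first.
      by apply/funext => x; rewrite /= expr0 mul1r.
    by apply: is_derive_eq; rewrite oppr0 mul0r addr0 mulrC.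
  have h := is_deriveM dV IH.
  rewrite (_ : (fun _ => _) =
      (fun t => t^-1) * (fun t => t^-1 ^+ k * expR (- t^-1))); last first.
    by apply/funext => x; rewrite /= exprS -mulrA.
  apply: is_derive_eq; rewrite /GRing.scale/= -natr1 !exprS; ring.
move=> t; have [t0|t0|t0] := ltgtP t 0.
- apply: (@near_eq_is_derive _ _ _ (fun=> 0)).
    near=> u; rewrite /flat ifF//; apply/negbTE; rewrite -leNgt ltW//.
    by near: u; exact: lt_nbhsl.
  by rewrite /flat !(ltNge _ t) (ltW t0)/= mulr0 addr0; apply: is_derive_cst.
- apply: near_eq_is_derive (pos t t0).
  by near=> u; rewrite /flat ifT//; near: u; exact: lt_nbhsr.
- rewrite t0; apply: is_derive_eq; last first.
    by rewrite /flat ltxx mulr0 addr0.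
  exact: is_derive_quadratic (flat_quadratic k).
Unshelve. all: by end_near. Qed.

Lemma smooth_flat k : smooth (flat k).
Proof.
move=> n; elim: n k => // n IH k.
exists (fun t => flat k.+2 t + - k%:R * flat k.+1 t); first exact: flat_isD.
by apply: CkD => //; apply: CkM => //; apply: Ck_cst.
Qed.

Lemma flat0_gt0 t : 0 < t -> 0 < flat 0 t.
Proof. by move=> t0; rewrite /flat t0 expr0 mul1r expR_gt0. Qed.

Lemma flat_ge0 t : 0 <= flat 0 t.
Proof. by rewrite /flat; case: ifP => // _; rewrite expr0 mul1r expR_ge0. Qed.

Lemma flat_eq0 t : t <= 0 -> flat 0 t = 0.
Proof. by move=> t0; rewrite /flat ltNge t0. Qed.

(** An odd smooth transition from -1/2 to 1/2 on [-e, e], of the form (a - b) / (2 (a + b)), where a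
    vanishes for t <= -e and b for t >= e. *)
Definition halfstep (e t : R) : R :=
  (flat 0 (e + t) - flat 0 (e - t)) * (2 * (flat 0 (e + t) + flat 0 (e - t)))^-1.

Lemma halfstep_den (e : R) (e0 : 0 < e) t : 0 < 2 * (flat 0 (e + t) + flat 0 (e - t)).
Proof.
rewrite mulr_gt0//; have [t0|t0] := leP 0 t.
  by apply: ltr_pwDl (flat_ge0 _); apply: flat0_gt0; lra.
by apply: ltr_wpDl (flat_ge0 _) _; apply: flat0_gt0; lra.
Qed.

Lemma smooth_halfstep (e : R) (e0 : 0 < e) : smooth (halfstep e).
Proof.
have h1 : smooth (fun t => flat 0 (e + t)).
  rewrite (_ : (fun _ => _) = fun t => flat 0 (t + e)).
    by apply: smooth_shift; apply: smooth_flat.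
  by apply/funext => t; rewrite addrC.
have h2 : smooth (fun t => flat 0 (e - t)).
  exact: smooth_opp h1.
apply: smoothM; first exact: smoothB.
apply: smoothV; first by move=> t; rewrite gt_eqF// halfstep_den.
by apply: smoothM; [exact: smooth_cst|exact: smoothD].
Qed.

Lemma halfstepN (e t : R) : halfstep e (- t) = - halfstep e t.
Proof.
rewrite /halfstep opprK -mulNr opprB.
by congr (_ / (2 * _)); exact: addrC.
Qed.

Lemma halfstep_ge (e : R) (e0 : 0 < e) t : e <= t -> halfstep e t = 1 / 2.
Proof.
move=> et; have := halfstep_den e e0 t; rewrite /halfstep [flat 0 (e - t)]flat_eq0; last lra.
by rewrite addr0 subr0 => h; field; move: h; rewrite pmulr_rgt0// => /gt_eqF->.
Qed.

(* Glues the integer translates of [w], a step from [a] to [a + c] within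
   ]-e, e[, into one staircase (periodic when c = 0). *)
Definition glue (c : R) (w : R -> R) (x : R) : R :=
  let n := (Num.floor (x + 1 / 2))%:~R in c * n + w (x - n).

(** The formula is valid beyond the rounding cell [-1/2, 1/2]: past a half-integer the nearest
    integer changes by one, but [w] is already constant there and its two constant values differ by
    [c]. *)
Lemma glueE (e c a : R) (w : R -> R) (e12 : 0 < e < 1 / 2)
    (w_ge : forall t, e <= t -> w t = a + c) (w_le : forall t, t <= - e -> w t = a) (n : int) u : - (1 - e) <= u <= 1 - e ->
  glue c w (n%:~R + u) = c * n%:~R + w u.
Proof.
move=> /andP[u1 u2]; rewrite /glue.
have fl (m : int) : m%:~R <= u + 1 / 2 < m%:~R + 1 ->
    (Num.floor (n%:~R + u + 1 / 2))%:~R = n%:~R + m%:~R :> R.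
  move=> /andP[m1 m2]; rewrite -intrD; congr (_%:~R).
  by apply: floor_def; rewrite !intrD; apply/andP; split; lra.
have [h|h] := leP (1 / 2) u.
  rewrite (fl 1); last by rewrite [1%:~R]mulr1z; apply/andP; split; lra.
  by rewrite [1%:~R]mulr1z w_le ?w_ge; [ring|lra|lra].
have [h'|h'] := leP (- (1 / 2)) u.
  rewrite (fl 0); last by rewrite mulr0z; apply/andP; split; lra.
  by rewrite mulr0z addr0; congr (_ + w _); ring.
rewrite (fl (-1)); last by rewrite [(-1)%:~R]mulrN1z; apply/andP; split; lra.
by rewrite [(-1)%:~R]mulrN1z w_ge ?w_le; [ring|lra|lra].
Qed.

Lemma round_decomp (x : R) : exists (n : int) u, x = n%:~R + u /\ - (1 / 2) <= u <= 1 / 2.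
Proof.
exists (Num.floor (x + 1 / 2)), (x - (Num.floor (x + 1 / 2))%:~R).
split; first by ring.
by have := floor_itv (x + 1 / 2); rewrite intrD; lra.
Qed.

Lemma smooth_glue (e c a : R) (w : R -> R) (e12 : 0 < e < 1 / 2)
    (w_ge : forall t, e <= t -> w t = a + c) (w_le : forall t, t <= - e -> w t = a) : smooth w -> smooth (glue c w).
Proof.
move=> sw; apply: smooth_local => x.
have [n [u [xE u12]]] := round_decomp x.
exists (fun y => c * n%:~R + w (y + - n%:~R)).
  by apply: smoothD; [exact: smooth_cst|exact: smooth_shift].
(* The margin by which the range in [glueE] exceeds the rounding cell; it gives one formula around
   every point, half-integers included. *)
have d0 : 0 < 1 / 2 - e by lra.
near=> y.
have : `|x - y| < 1 / 2 - e by near: y; exact: nbhsx_ballx.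
rewrite ltr_norml => h.
rewrite -(glueE e c a w e12 w_ge w_le); first by congr glue; ring.
by move: h u12; rewrite xE; lra.
Unshelve. all: by end_near. Qed.

Lemma glueD1 (e c a : R) (w : R -> R) (e12 : 0 < e < 1 / 2)
    (w_ge : forall t, e <= t -> w t = a + c) (w_le : forall t, t <= - e -> w t = a) x : glue c w (x + 1) = glue c w x + c.
Proof.
have [n [u [-> u12]]] := round_decomp x.
have -> : n%:~R + u + 1 = (n + 1)%:~R + u :> R by rewrite intrD; ring.
rewrite !(glueE e c a w e12 w_ge w_le) ?intrD; lra.
Qed.

Definition near_int (e : R) (n : int) (z : R) := `|z - n%:~R| <= e.

(** [s] climbs from [n - 1/2] to [n + 1/2] within distance [e] of each integer [n], and [g] is a
    bump there. The last relation says that the 2x2 block with diagonal [1/2 + (s - n)],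
    [1/2 - (s - n)] and off-diagonal entry [g] is a projection of rank one. *)
Definition staircase (e : R) (s g : R -> R) : Prop :=
  [/\ smooth s, smooth g, g 0 = 1 / 2 &
   [/\ forall x, s (x + 1) = s x + 1, forall x, g (x + 1) = g x,
       forall x, s (- x) = - s x, forall x, g (- x) = g x &
    (forall (n : int) x, n%:~R + e <= x <= n%:~R + (1 - e) ->
         s x = n%:~R + 1 / 2 /\ g x = 0) /\
    (forall (n : int) x, near_int e n x -> (s x - n%:~R) ^+ 2 + g x ^+ 2 = 1 / 4)]].

Lemma staircase_exists (e : R) : 0 < e < 1 / 2 ->
  exists s g : R -> R, staircase e s g.
Proof.
move=> e12; have e0 : 0 < e by lra.
(* The point [(wg, ws)] runs through a half circle of radius 1/2 while the angle grows from -pi/2 to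
   pi/2. *)
pose ws t := 1 / 2 * sin (pi * halfstep e t) : R.
pose wg t := 1 / 2 * cos (pi * halfstep e t) : R.
have sm1 : smooth (fun t => pi * halfstep e t).
  by apply: smoothM; [exact: smooth_cst|exact: smooth_halfstep].
have sws : smooth ws.
  apply: smoothM; [exact: smooth_cst|].
  exact: (smooth_comp _ _ smooth_sin sm1).
have swg : smooth wg.
  apply: smoothM; [exact: smooth_cst|].
  exact: (smooth_comp _ _ smooth_cos sm1).
have ws_ge t : e <= t -> ws t = - (1 / 2) + 1.
  by move=> et; rewrite /ws halfstep_ge// mulrA mulr1 sin_pihalf; lra.
have wsN t : ws (- t) = - ws t by rewrite /ws halfstepN mulrN sinN mulrN.
have wgN t : wg (- t) = wg t by rewrite /wg halfstepN mulrN cosN.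
have ws_le t : t <= - e -> ws t = - (1 / 2).
  by move=> et; rewrite -[t]opprK wsN ws_ge; lra.
have wg_ge t : e <= t -> wg t = 0 + 0.
  by move=> et; rewrite /wg halfstep_ge// mulrA mulr1 cos_pihalf; lra.
have wg_le t : t <= - e -> wg t = 0.
  by move=> et; rewrite -[t]opprK wgN wg_ge; lra.
have sE := glueE e 1 _ ws e12 ws_ge ws_le.
have gE := glueE e 0 _ wg e12 wg_ge wg_le.
exists (glue 1 ws), (glue 0 wg); split.
- exact: smooth_glue _ _ _ _ e12 ws_ge ws_le sws.
- exact: smooth_glue _ _ _ _ e12 wg_ge wg_le swg.
- have := gE 0 0; rewrite mulr0z addr0 => ->; last lra.
  rewrite /wg (_ : halfstep e 0 = 0) ?mulr0 ?cos0; first by ring.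
  by have := halfstepN e 0; rewrite oppr0; lra.
have cases x := round_decomp x.
split.
- exact: glueD1 _ _ _ _ e12 ws_ge ws_le.
- by move=> x; rewrite (glueD1 _ _ _ _ e12 wg_ge wg_le) addr0.
- move=> x; have [n [u [-> u12]]] := cases x.
  have -> : - (n%:~R + u) = (- n)%:~R + - u :> R by rewrite mulrNz; ring.
  by rewrite !sE ?wsN ?mulrNz; [ring|lra|lra].
- move=> x; have [n [u [-> u12]]] := cases x.
  have -> : - (n%:~R + u) = (- n)%:~R + - u :> R by rewrite mulrNz; ring.
  by rewrite !gE ?wgN ?mulrNz; [ring|lra|lra].
split=> n x.
  move=> hx; have -> : x = n%:~R + (x - n%:~R) by ring.
  rewrite sE ?gE; try lra.
  by rewrite ws_ge ?wg_ge; try lra.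
rewrite /near_int ler_norml => hx; have -> : x = n%:~R + (x - n%:~R) by ring.
rewrite sE ?gE; try lra.
have := cos2Dsin2 (pi * halfstep e (x - n%:~R)); rewrite /ws /wg.
set S := sin _; set C := cos _ => h.
have -> : 1 * n%:~R + 1 / 2 * S - n%:~R = 1 / 2 * S by ring.
have -> : 1 / 4 = 1 / 4 * (C ^+ 2 + S ^+ 2) by rewrite h mulr1.
by field.
Qed.

End Bumps.

(** * Integrals of continuous functions over [0, 1] *)

Section RealIntegral.
Context {R : realType}.
Implicit Types f g F : R -> R.

Lemma continuous_addf f g : continuous f -> continuous g ->
  continuous (fun x => f x + g x).
Proof. by move=> cf cg x; apply: continuousD; [exact: cf|exact: cg]. Qed.

Lemma continuous_scalef (c : R) f : continuous f -> continuous (fun x => c * f x).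
Proof. by move=> cf x; apply: continuousM; [exact: cvg_cst|exact: cf]. Qed.

Lemma continuous_shiftf f a : continuous f -> continuous (fun x => f (x + a)).
Proof.
move=> cf x; apply: (@continuous_comp _ _ _ (fun x => x + a) f); last exact: cf.
by apply: continuousD; [exact: cvg_id|exact: cvg_cst].
Qed.

Lemma continuous_oppf f : continuous f -> continuous (fun x => f (- x)).
Proof.
by move=> cf x; apply: continuous_comp; [exact: continuousN|exact: cf].
Qed.


Definition int01 f : R := (\int[lebesgue_measure]_(x in `[0%R, 1%R]) f x)%R.

Lemma int01E F f : isD F f -> continuous f -> int01 f = F 1 - F 0.
Proof.
move=> hF cf; rewrite /int01 /Rintegral.
have cF := isD_continuous _ _ hF.
rewrite (@continuous_FTC2 _ f F 0 1 ltr01) //.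
- exact: continuous_subspaceT.
- split.
  + by move=> x _; apply: isD_derivable hF.
  + exact: cvg_at_right_filter (cF 0).
  + exact: cvg_at_left_filter (cF 1).
- by move=> x _; rewrite (isD_derive1 _ _ hF).
Qed.

Lemma antiderivative_right f a : continuous f ->
  exists F, forall x, a < x -> is_derive (x : R) (1 : R) F (f x).
Proof.
move=> cf; exists (fun x => \int[lebesgue_measure]_(t in `[a, x]) f t)%R => x ax.
have x1 : x < x + 1 by rewrite ltrDl.
have [] := continuous_FTC1_closed x1 _ ax (cf x).
  apply: continuous_compact_integrable; first exact: segment_compact.
  exact: continuous_subspaceT.
by move=> d; rewrite derive1E => e; exact: (DeriveDef d e).
Qed.

(** An integral from a fixed base point only covers the points to its right. A second one, built for
    x -> f(-x) and reflected, covers the points below 1; on ]-1, 1[ the two differ by a constant, so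
    they can be joined at 0. A global antiderivative reduces the rules for [int01] to evaluations at
    0 and 1. *)
Lemma antiderivative f : continuous f -> exists F, isD F f.
Proof.
move=> cf; have [F1 h1] := antiderivative_right f (-1) cf.
have cfN := continuous_oppf f cf.
have [F2 h2] := antiderivative_right _ (-1) cfN.
have h3 (x : R) : x < 1 -> is_derive (x : R) (1 : R) (fun x => - F2 (- x)) (f x).
  move=> x1; have hN : is_derive (x : R) (1 : R) (fun y : R => - y) (-1).
    exact: is_deriveNid.
  have h2x : is_derive (- x) (1 : R) F2 (f x).
    by have := h2 (- x); rewrite opprK; apply; lra.
  have h := is_deriveN (@is_derive1_comp _ F2 (fun y : R => - y) _ _ _ h2x hN).
  by apply: is_derive_eq; rewrite mulrN1 opprK.
pose c := F1 0 + F2 0.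
have eqF (x : R) : -1 < x -> x < 1 -> F1 x = - F2 (- x) + c.
  move=> x1 x2; pose G := fun y => F1 y + F2 (- y).
  have dG (y : R) : -1 < y -> y < 1 -> is_derive (y : R) (1 : R) G 0.
    move=> y1 y2; have h := is_deriveB (h1 y y1) (h3 y y2).
    rewrite (_ : G = (F1 - (fun x => - F2 (- x)))).
      by apply: is_derive_eq; rewrite subrr.
    by apply/funext => z; rewrite /G /= -[RHS]/(F1 z - - F2 (- z)) opprK.
  suff : G x = G 0 by rewrite /G oppr0 -/c => <-; ring.
  have key (y z : R) : -1 < y -> y <= z -> z < 1 -> G z = G y.
    move=> y1 yz z1; have [||c0 _] := @MVT_segment _ G (fun=> 0) y z yz.
    - by move=> t; rewrite in_itv/= => /andP[? ?]; apply: dG; lra.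
    - apply: derivable_within_continuous => t; rewrite in_itv/= => /andP[yt tz].
      by have [] := dG t (lt_le_trans y1 yt) (le_lt_trans tz z1).
    by rewrite mul0r => /eqP; rewrite subr_eq0 => /eqP.
  by have [x0|x0] := leP 0 x; [apply: key|rewrite (key x 0)]; lra.
exists (fun x => if 0 <= x then F1 x else - F2 (- x) + c) => x.
have [x0|x0] := ltP x 0.
  apply: (@near_eq_is_derive _ _ _ (fun x => - F2 (- x) + c)).
    by near=> y; rewrite ifF//; apply/negbTE; rewrite -ltNge; near: y; exact: lt_nbhsl.
  have h := is_deriveD (h3 x _) (is_derive_cst c x (1 : R)).
  by have := h ltac:(lra) => {}h; apply: is_derive_eq; rewrite addr0.
have x1 : -1 < x by lra.
apply: near_eq_is_derive (h1 x x1).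
near=> y; case: ifPn => //; rewrite -ltNge => y0; apply: eqF; last lra.
by near: y; exact: lt_nbhsr.
Unshelve. all: by end_near. Qed.

Lemma int01D f g : continuous f -> continuous g ->
  int01 (fun x => f x + g x) = int01 f + int01 g.
Proof.
move=> cf cg; have [F hF] := antiderivative f cf; have [G hG] := antiderivative g cg.
rewrite (int01E _ _ hF)// (int01E _ _ hG)// (int01E _ _ (isDD _ _ _ _ hF hG)).
  by ring.
exact: continuous_addf.
Qed.

Lemma int01Z (c : R) f : continuous f -> int01 (fun x => c * f x) = c * int01 f.
Proof.
move=> cf; have [F hF] := antiderivative f cf.
have h := isD_ext _ _ _ (isDM _ _ _ _ (isD_cst c) hF).
rewrite (int01E _ _ hF)// (int01E (fun x => c * F x) (fun x => c * f x)).
- by ring.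
- by apply: h => x; rewrite mulr0 addr0.
- exact: continuous_scalef.
Qed.

(** The mean value theorem, applied to an antiderivative of [g - f]. *)
Lemma int01_le f g : continuous f -> continuous g ->
  (forall x, 0 <= x <= 1 -> f x <= g x) -> int01 f <= int01 g.
Proof.
move=> cf cg fg.
have ch' := continuous_scalef (-1) f cf.
have ch := continuous_addf g _ cg ch'.
have [H hH] := antiderivative _ ch.
have : 0 <= int01 (fun x => g x + -1 * f x).
  rewrite (int01E _ _ hH)//; have [c] := isD_MVT _ _ _ _ hH ler01.
  rewrite in_itv/= => c01 ->; rewrite subr0 mulr1; have := fg c c01; lra.
by rewrite int01D// int01Z//; lra.
Qed.

Lemma continuous_cstf (d : R) : continuous (fun _ : R => d).
Proof. by move=> x; exact: cvg_cst. Qed.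

Lemma int01_cst (d : R) : int01 (fun=> d) = d.
Proof.
rewrite (int01E (fun x => d * x + 0) (fun=> d)); first by ring.
- exact: isD_lin.
- exact: continuous_cstf.
Qed.

Lemma int01_bound f (c : R) : continuous f -> (forall x, `|f x| <= c) ->
  `|int01 f| <= c.
Proof.
move=> cf hc; rewrite ler_norml; apply/andP; split.
  rewrite -[X in X <= _]int01_cst; apply: int01_le => //.
  - exact: continuous_cstf.
  - by move=> x _; have := hc x; rewrite ler_norml => /andP[].
rewrite -[X in _ <= X]int01_cst; apply: int01_le => //.
- exact: continuous_cstf.
- by move=> x _; have := hc x; rewrite ler_norml => /andP[].
Qed.

(** Periodicity makes [F (x + 1) - F x] constant for an antiderivative [F]. *)
Lemma int01_shift f a : continuous f -> (forall x, f (x + 1) = f x) ->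
  int01 (fun x => f (x + a)) = int01 f.
Proof.
move=> cf pf; have [F hF] := antiderivative f cf.
have shift b := isD_shift _ _ b hF.
rewrite (int01E _ _ (shift a)); last first.
  exact: continuous_shiftf.
rewrite (int01E _ _ hF)//.
have h : isD (fun x => F (x + 1) + - F x) (fun=> 0).
  by apply: isD_ext (isDD _ _ _ _ (shift 1) (isDN _ _ hF)) _ => x; rewrite pf subrr.
by have := isD0_cst _ a 0 h; rewrite !add0r [1 + a]addrC.
Qed.

Lemma int01_opp f : continuous f -> (forall x, f (x + 1) = f x) ->
  int01 (fun x => f (- x)) = int01 f.
Proof.
move=> cf pf; rewrite -(int01_shift f (-1))//.
have cf1 := continuous_shiftf f (-1) cf.
have [F hF] := antiderivative f cf.
have h1 := isD_comp _ _ _ _ hF (isD_lin 1 (-1)).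
have h2 := isD_comp _ _ _ _ hF (isD_lin (-1) 0).
rewrite (int01E (fun x => F (1 * x - 1)) (fun x => f (x - 1)))//; last first.
  by apply: isD_ext h1 _ => x; rewrite mul1r mulr1.
rewrite (int01E (fun x => - F (- 1 * x + 0)) (fun x => f (- x)))//.
- rewrite (_ : -1 * 1 + 0 = -1); last by ring.
  rewrite (_ : -1 * 0 + 0 = 0); last by ring.
  rewrite (_ : 1 * 1 - 1 = 0); last by ring.
  by rewrite (_ : 1 * 0 - 1 = -1); ring.
- by apply: isD_ext (isDN _ _ h2) _ => x; rewrite mulN1r addr0 mulrN1 opprK.
- exact: continuous_oppf.
Qed.

Lemma periodic_int (f : R -> R) : (forall x, f (x + 1) = f x) ->
  forall (n : int) x, f (x + n%:~R) = f x.
Proof.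
move=> pf; have nat n x : f (x + n%:R) = f x.
  by elim: n x => [|n IH] x; rewrite ?addr0// -natr1 addrA pf IH.
case=> n x; first exact: nat.
by rewrite NegzE mulrNz -(nat n.+1) pmulrn subrK.
Qed.

Lemma periodic_bounded f : continuous f -> (forall x, f (x + 1) = f x) ->
  exists2 c, 0 <= c & forall x, `|f x| <= c.
Proof.
move=> cf pf.
have cw : {within `[0, 1], continuous f} by exact: continuous_subspaceT.
have [a _ ha] := EVT_max ler01 cw; have [b _ hb] := EVT_min ler01 cw.
exists (`|f a| + `|f b|); first by rewrite addr_ge0.
move=> x; rewrite -(periodic_int f pf (- Num.floor x)) mulrNz.
have hx : x - (Num.floor x)%:~R \in `[0, 1]%R.
  by rewrite in_itv/=; have := floor_itv x; rewrite intrD; lra.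
have := ha _ hx; have := hb _ hx; have := normr_ge0 (f a); have := normr_ge0 (f b).
have := ler_norm (f a); have := lerNnormlW (lexx `|f b|).
by rewrite ler_norml; lra.
Qed.

End RealIntegral.

(** * Complex-valued functions *)

Section ComplexFunctions.
Context {R : realType}.
Implicit Types (f g F G : R -> R[i]) (c : R[i]).

Local Notation Re := complex.Re.
Local Notation Im := complex.Im.

Lemma cReD (x y : R[i]) : Re (x + y) = Re x + Re y. Proof. by case: x y => ? ? []. Qed.
Lemma cImD (x y : R[i]) : Im (x + y) = Im x + Im y. Proof. by case: x y => ? ? []. Qed.
Lemma cReN (x : R[i]) : Re (- x) = - Re x. Proof. by case: x. Qed.
Lemma cImN (x : R[i]) : Im (- x) = - Im x. Proof. by case: x. Qed.
Lemma cReM (x y : R[i]) : Re (x * y) = Re x * Re y - Im x * Im y.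
Proof. by case: x y => ? ? []. Qed.
Lemma cImM (x y : R[i]) : Im (x * y) = Re x * Im y + Im x * Re y.
Proof. by case: x y => ? ? []. Qed.
Lemma cReJ (x : R[i]) : Re (x^*) = Re x. Proof. by case: x. Qed.
Lemma cImJ (x : R[i]) : Im (x^*) = - Im x. Proof. by case: x. Qed.

Lemma conjcM (x y : R[i]) : (x * y)^*%C = x^*%C * y^*%C.
Proof. exact: rmorphM. Qed.

Lemma complex_ext (x y : R[i]) : Re x = Re y -> Im x = Im y -> x = y.
Proof. by case: x y => ? ? [? ?] /= -> ->. Qed.

Definition csmooth f := smooth (fun x => Re (f x)) /\ smooth (fun x => Im (f x)).

Definition ccont f := continuous (fun x => Re (f x)) /\ continuous (fun x => Im (f x)).

Definition cisD F f := isD (fun x => Re (F x)) (fun x => Re (f x)) /\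
  isD (fun x => Im (F x)) (fun x => Im (f x)).

Definition cderive f (x : R) : R[i] :=
  derive1 (fun x => Re (f x)) x +i* derive1 (fun x => Im (f x)) x.

Lemma smooth_funE f : smooth_fun f <-> csmooth f.
Proof.
split=> [h|[/smoothE h1 /smoothE h2] n x]; last by split; [exact: h1|exact: h2].
by split; apply/smoothE => n x; have [] := h n x.
Qed.

Lemma csmooth_ccont f : csmooth f -> ccont f.
Proof. by case=> h1 h2; split; apply: smooth_continuous. Qed.

Lemma csmooth_derive f : csmooth f -> cisD f (cderive f) /\ csmooth (cderive f).
Proof.
by move=> [/smooth_derive1[h1 s1] /smooth_derive1[h2 s2]].
Qed.

Lemma csmoothD f g : csmooth f -> csmooth g -> csmooth (fun x => f x + g x).
Proof.
move=> [f1 f2] [g1 g2]; split.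
  by under eq_fun do rewrite cReD; exact: smoothD.
by under eq_fun do rewrite cImD; exact: smoothD.
Qed.

Lemma csmoothM f g : csmooth f -> csmooth g -> csmooth (fun x => f x * g x).
Proof.
move=> [f1 f2] [g1 g2]; split.
  by under eq_fun do rewrite cReM; apply: smoothB; exact: smoothM.
by under eq_fun do rewrite cImM; apply: smoothD; exact: smoothM.
Qed.

Lemma csmoothJ f : csmooth f -> csmooth (fun x => (f x)^*).
Proof.
move=> [f1 f2]; split.
  by under eq_fun do rewrite cReJ.
by under eq_fun do rewrite cImJ; exact: smoothN.
Qed.

Lemma csmooth_cst c : csmooth (fun=> c).
Proof. by split; exact: smooth_cst. Qed.

Lemma csmooth_real (u : R -> R) : smooth u -> csmooth (fun x => (u x)%:C).
Proof. by move=> su; split=> //; exact: smooth_cst. Qed.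

Lemma csmooth_shift f a : csmooth f -> csmooth (fun x => f (x + a)).
Proof.
move=> [h1 h2]; split.
  exact: (smooth_shift (fun x => Re (f x))).
exact: (smooth_shift (fun x => Im (f x))).
Qed.

Lemma csmooth_opp f : csmooth f -> csmooth (fun x => f (- x)).
Proof.
move=> [h1 h2]; split.
  exact: (smooth_opp (fun x => Re (f x))).
exact: (smooth_opp (fun x => Im (f x))).
Qed.

Lemma cisDM F G f g : cisD F f -> cisD G g ->
  cisD (fun x => F x * G x) (fun x => F x * g x + f x * G x).
Proof.
move=> [f1 f2] [g1 g2]; split.
  under eq_fun do rewrite cReM.
  apply: isD_ext (isDD _ _ _ _ (isDM _ _ _ _ f1 g1) (isDN _ _ (isDM _ _ _ _ f2 g2))) _ => x.
  by rewrite cReD !cReM; ring.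
under eq_fun do rewrite cImM.
apply: isD_ext (isDD _ _ _ _ (isDM _ _ _ _ f1 g2) (isDM _ _ _ _ f2 g1)) _ => x.
by rewrite cImD !cImM; ring.
Qed.

Lemma cisD_uniq F f g : cisD F f -> cisD F g -> f =1 g.
Proof.
move=> [f1 f2] [g1 g2] x; apply: complex_ext.
  have := isD_derive1 _ _ f1; have := isD_derive1 _ _ g1 => -> h.
  by have := congr1 (@^~ x) h.
have := isD_derive1 _ _ f2; have := isD_derive1 _ _ g2 => -> h.
by have := congr1 (@^~ x) h.
Qed.

Lemma cisD_derive F f : cisD F f -> cderive F = f.
Proof.
move=> h; apply/funext => x; apply: complex_ext; rewrite /cderive /=.
  by rewrite (isD_derive1 _ _ h.1).
by rewrite (isD_derive1 _ _ h.2).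
Qed.

Lemma cintE f :
  cintegral01 f = int01 (fun x => Re (f x)) +i* int01 (fun x => Im (f x)).
Proof. by []. Qed.

Lemma cint_FTC F f : cisD F f -> ccont f -> cintegral01 f = F 1 - F 0.
Proof.
move=> [h1 h2] [c1 c2]; rewrite cintE (int01E _ _ h1)// (int01E _ _ h2)//.
by apply: complex_ext; rewrite ?cReD ?cImD ?cReN ?cImN.
Qed.

Lemma cintD f g : ccont f -> ccont g ->
  cintegral01 (fun x => f x + g x) = cintegral01 f + cintegral01 g.
Proof.
move=> [f1 f2] [g1 g2]; rewrite !cintE; apply: complex_ext => /=.
  by under eq_fun do rewrite cReD; exact: int01D.
by under eq_fun do rewrite cImD; exact: int01D.
Qed.

Lemma cintZ c f : ccont f -> cintegral01 (fun x => c * f x) = c * cintegral01 f.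
Proof.
move=> [f1 f2]; rewrite !cintE; apply: complex_ext; rewrite ?cReM ?cImM /=.
  under eq_fun do rewrite cReM -mulNr.
  rewrite int01D ?int01Z ?mulNr//; exact: continuous_scalef.
under eq_fun do rewrite cImM.
rewrite int01D ?int01Z//; exact: continuous_scalef.
Qed.

Lemma cintJ f : ccont f -> cintegral01 (fun x => (f x)^*) = (cintegral01 f)^*.
Proof.
move=> [f1 f2]; rewrite !cintE; apply: complex_ext; rewrite ?cReJ ?cImJ /=.
  by under eq_fun do rewrite cReJ.
under eq_fun do rewrite cImJ -mulN1r.
by rewrite int01Z// mulN1r.
Qed.

Lemma cint_shift f a : ccont f -> (forall x, f (x + 1) = f x) ->
  cintegral01 (fun x => f (x + a)) = cintegral01 f.
Proof.
move=> [f1 f2] pf; rewrite !cintE; apply: complex_ext => /=.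
  by rewrite (int01_shift (fun x => Re (f x)))// => x; rewrite pf.
by rewrite (int01_shift (fun x => Im (f x)))// => x; rewrite pf.
Qed.

Lemma cint_opp f : ccont f -> (forall x, f (x + 1) = f x) ->
  cintegral01 (fun x => f (- x)) = cintegral01 f.
Proof.
move=> [f1 f2] pf; rewrite !cintE; apply: complex_ext => /=.
  by rewrite (int01_opp (fun x => Re (f x)))// => x; rewrite pf.
by rewrite (int01_opp (fun x => Im (f x)))// => x; rewrite pf.
Qed.

(** * The exponential on the circle *)

Lemma cexpD (x y : R) : cexp (x + y) = cexp x * cexp y.
Proof.
by apply: complex_ext; rewrite ?cReM ?cImM /= mulrDr ?cosD ?sinD //; ring.
Qed.

Lemma cexp0 : cexp 0 = 1 :> R[i].
Proof. by rewrite /cexp mulr0 cos0 sin0. Qed.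

Lemma cexpN (x : R) : cexp (- x) = (cexp x)^*.
Proof. by rewrite /cexp mulrN cosN sinN. Qed.

Lemma cexpMN (x : R) : cexp x * cexp (- x) = 1.
Proof. by rewrite -cexpD subrr cexp0. Qed.

Lemma cexp1 : cexp 1 = 1 :> R[i].
Proof. by rewrite /cexp mulr1 mulr_natl cos2pi sin2pi. Qed.

Lemma cexp_int (n : int) : cexp (n%:~R) = 1 :> R[i].
Proof.
have nat m : cexp (m%:R) = 1 :> R[i].
  by elim: m => [|m IH]; [exact: cexp0|rewrite -natr1 cexpD IH cexp1 mulr1].
case: n => n; first exact: nat.
by rewrite NegzE mulrNz cexpN -pmulrn nat conjc1.
Qed.

Lemma csmooth_cexp a : csmooth (fun x => cexp (a * x)).
Proof.
have sl : smooth (fun x => 2 * pi * (a * x)).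
  rewrite (_ : (fun _ => _) = fun x => (2 * pi * a) * x + 0) ?smooth_lin//.
    exact: smooth_lin.
  by apply/funext => x; rewrite addr0 mulrA.
split; rewrite /cexp /=.
  exact: (smooth_comp _ _ smooth_cos sl).
exact: (smooth_comp _ _ smooth_sin sl).
Qed.

Lemma cisD_cexp a :
  cisD (fun x => cexp (a * x)) (fun x => (0 +i* (2 * pi * a)) * cexp (a * x)).
Proof.
have sl : isD (fun x => 2 * pi * (a * x)) (fun=> 2 * pi * a).
  rewrite (_ : (fun _ => _) = fun x => (2 * pi * a) * x + 0); first exact: isD_lin.
  by apply/funext => x; rewrite addr0 mulrA.
split; rewrite /cexp /=.
  apply: isD_ext (isD_comp _ _ _ _ isD_cos sl) _ => x; rewrite /= mul0r; ring.
apply: isD_ext (isD_comp _ _ _ _ isD_sin sl) _ => x; rewrite /= mul0r; ring.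
Qed.

End ComplexFunctions.

(** * Real-valued norms and symmetric sums *)

Section RealNorm.
Context {R : realType}.

(* The norms of a normed space over R[i] are real complex numbers; [nr] is
   their value in R. *)
Definition nr (V : normedZmodType R[i]) (x : V) : R := complex.Re `|x|.

Lemma nrE (V : normedZmodType R[i]) (x : V) : `|x| = (nr V x)%:C.
Proof.
rewrite /nr; have := normr_ge0 x; case: `|x| => a b.
by rewrite lecE /= => /andP[/eqP-> _].
Qed.

Lemma nr_ge0 (V : normedZmodType R[i]) (x : V) : 0 <= nr V x.
Proof. by rewrite -ler0c -nrE normr_ge0. Qed.

Lemma nrD (V : normedZmodType R[i]) (x y : V) : nr V (x + y) <= nr V x + nr V y.
Proof. by rewrite -lecR rmorphD/= -!nrE ler_normD. Qed.

Lemma nrN (V : normedZmodType R[i]) (x : V) : nr V (- x) = nr V x.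
Proof. by rewrite /nr normrN. Qed.

Lemma nrB (V : normedZmodType R[i]) (x y : V) : nr V (x - y) <= nr V x + nr V y.
Proof. by rewrite -[nr V y]nrN nrD. Qed.

Lemma nr_dist (V : normedZmodType R[i]) (x y : V) : nr V (x - y) = nr V (y - x).
Proof. by rewrite -nrN opprB. Qed.

Lemma nr0 (V : normedZmodType R[i]) : nr V 0 = 0.
Proof. by rewrite /nr normr0. Qed.

Lemma nr_le0 (V : normedZmodType R[i]) (x : V) : nr V x <= 0 -> x = 0.
Proof.
move=> h; apply/eqP; rewrite -normr_eq0 nrE; apply/eqP.
by rewrite (_ : nr V x = 0)//; apply/eqP; rewrite eq_le h nr_ge0.
Qed.

Lemma nr_le_eq0 (V : normedZmodType R[i]) (x : V) :
  (forall e : R, 0 < e -> nr V x <= e) -> x = 0.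
Proof.
move=> h; apply: nr_le0; rewrite leNgt; apply/negP => x0.
by have := h (nr V x / 2); rewrite divr_gt0// => /(_ isT); lra.
Qed.

Local Notation nrc := (nr R[i]).

Lemma nrcM (x y : R[i]) : nrc (x * y) = nrc x * nrc y.
Proof. by apply: complexI; rewrite rmorphM/= -!nrE normrM. Qed.

Lemma nrc_sqr (x : R[i]) : nrc x ^+ 2 = complex.Re x ^+ 2 + complex.Im x ^+ 2.
Proof. by rewrite /nr normc_def /= sqr_sqrtr// addr_ge0// sqr_ge0. Qed.

Lemma nrc_le (x : R[i]) : nrc x <= `|complex.Re x| + `|complex.Im x|.
Proof.
rewrite -(@ler_pXn2r _ 2) ?nnegrE ?nr_ge0 ?addr_ge0// nrc_sqr.
rewrite -(real_normK (num_real (complex.Re x))) -(real_normK (num_real (complex.Im x))).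
have := mulr_ge0 (normr_ge0 (complex.Re x)) (normr_ge0 (complex.Im x)).
by rewrite !expr2; nra.
Qed.

Lemma nrc_geRe (x : R[i]) : `|complex.Re x| <= nrc x.
Proof.
rewrite -(@ler_pXn2r _ 2) ?nnegrE ?nr_ge0// nrc_sqr real_normK ?num_real//.
by rewrite lerDl sqr_ge0.
Qed.

Lemma nrc_geIm (x : R[i]) : `|complex.Im x| <= nrc x.
Proof.
rewrite -(@ler_pXn2r _ 2) ?nnegrE ?nr_ge0// nrc_sqr real_normK ?num_real//.
by rewrite lerDr sqr_ge0.
Qed.

Lemma nrc_cexp (x : R) : nrc (cexp x) = 1.
Proof.
apply/eqP; rewrite -(@eqrXn2 _ 2) ?nr_ge0// nrc_sqr expr1n /=.
by rewrite cos2Dsin2.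
Qed.

Lemma nrc1 : nrc 1 = 1.
Proof. by rewrite -cexp0 nrc_cexp. Qed.

Lemma nrZ (V : normedModType R[i]) (c : R[i]) (x : V) : nr V (c *: x) = nrc c * nr V x.
Proof. by apply: complexI; rewrite rmorphM/= -!nrE normrZ. Qed.

(** The real and imaginary parts are bounded separately, whence the factor 2. *)
Lemma cint_bound (f : R -> R[i]) (c : R) : ccont f ->
  (forall x, nrc (f x) <= c) -> nrc (cintegral01 f) <= 2 * c.
Proof.
move=> [c1 c2] h; rewrite cintE (le_trans (nrc_le _))//= mulrDl mul1r lerD//.
  by apply: int01_bound => // x; apply: le_trans (nrc_geRe _) (h x).
by apply: int01_bound => // x; apply: le_trans (nrc_geIm _) (h x).
Qed.

Section Symsum.
Context (V : zmodType).
Implicit Types F G : int -> V.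

Lemma symsum0 F : symsum 0 F = F 0.
Proof. by rewrite /symsum big_ord1 subrr. Qed.

Lemma symsumS N F :
  symsum N.+1 F = symsum N F + (F (N.+1%:Z) + F (- N.+1%:Z)).
Proof.
rewrite /symsum doubleS big_ord_recl big_ord_recr /=.
rewrite (_ : \sum_(i < _) _ = \sum_(i < N.*2.+1) F (i%:Z - N%:Z)); last first.
  by apply: eq_bigr => i _; congr F; rewrite /bump /=; lia.
rewrite addrCA; congr (_ + _); rewrite addrC; congr (F _ + F _).
  by rewrite /bump /=; lia.
by rewrite sub0r.
Qed.

Lemma symsum_ext N F G : (forall n, F n = G n) -> symsum N F = symsum N G.
Proof. by move=> FG; apply: eq_bigr => i _. Qed.

Lemma symsumD N F G : symsum N (fun n => F n + G n) = symsum N F + symsum N G.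
Proof. exact: big_split. Qed.

Lemma symsum_opp N F : symsum N (fun n => F (- n)) = symsum N F.
Proof.
elim: N => [|N IH]; first by rewrite !symsum0 oppr0.
by rewrite !symsumS IH opprK [F (- _) + _]addrC.
Qed.

Lemma symsum_morph (W : zmodType) (h : V -> W) N F :
  h 0 = 0 -> {morph h : x y / x + y} -> h (symsum N F) = symsum N (fun n => h (F n)).
Proof.
by move=> h0 hD; rewrite /symsum (big_morph h hD h0).
Qed.

End Symsum.

End RealNorm.

(** * Fourier series of smooth functions on the circle *)

#[local] Arguments cexp : simpl never.

Section Fourier.
Context {R : realType}.
Implicit Types (f g : R -> R[i]) (n : int).
Local Notation Re := complex.Re.
Local Notation Im := complex.Im.
Local Notation nrc := (nr R[i]).

Definition circle f := csmooth f /\ forall x, f (x + 1) = f x.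

Lemma smooth_circleE f : smooth_circle f <-> circle f.
Proof. by split=> -[/smooth_funE h1 h2]. Qed.

Lemma circleD f g : circle f -> circle g -> circle (fun x => f x + g x).
Proof.
by move=> [f1 f2] [g1 g2]; split=> [|x]; [exact: csmoothD|rewrite f2 g2].
Qed.

Lemma circleM f g : circle f -> circle g -> circle (fun x => f x * g x).
Proof.
by move=> [f1 f2] [g1 g2]; split=> [|x]; [exact: csmoothM|rewrite f2 g2].
Qed.

Lemma circleJ f : circle f -> circle (fun x => (f x)^*%C).
Proof. by move=> [f1 f2]; split=> [|x]; [exact: csmoothJ|rewrite f2]. Qed.

Lemma circle_cst (c : R[i]) : circle (fun=> c).
Proof. by split=> //; exact: csmooth_cst. Qed.

Lemma circle_shift f a : circle f -> circle (fun x => f (x + a)).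
Proof.
move=> [f1 f2]; split=> [|x]; first exact: csmooth_shift.
by rewrite -[RHS]f2; congr f; ring.
Qed.

Lemma circle_opp f : circle f -> circle (fun x => f (- x)).
Proof.
move=> [f1 f2]; split=> [|x]; first exact: csmooth_opp.
by rewrite -[LHS]f2; congr f; ring.
Qed.

Lemma circle_cexp n : circle (fun x => cexp (n%:~R * x)).
Proof.
split=> [|x]; first exact: csmooth_cexp.
by rewrite mulrDr mulr1 cexpD cexp_int mulr1.
Qed.

Lemma circle_cexpN n : circle (fun x => cexp (- (n%:~R * x))).
Proof.
have := circle_cexp (- n); rewrite (_ : (fun x => _) = fun x => cexp (- (n%:~R * x)))//.
by apply/funext => x; rewrite mulrNz mulNr.
Qed.

Lemma circle_derive f : circle f -> cisD f (cderive f) /\ circle (cderive f).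
Proof.
move=> [/[dup] sf /csmooth_derive[df sdf] pf]; split=> //; split=> // x.
have shift : cisD (fun x => f (x + 1)) (fun x => cderive f (x + 1)).
  by split; [exact: isD_shift df.1|exact: isD_shift df.2].
rewrite (_ : (fun x => f (x + 1)) = f) in shift; last by apply/funext.
exact: (cisD_uniq _ _ _ shift df).
Qed.

Lemma cderive_shift f a : circle f ->
  cderive (fun x => f (x + a)) = fun x => cderive f (x + a).
Proof.
move=> /circle_derive[df _]; apply: cisD_derive.
by split; [exact: isD_shift df.1|exact: isD_shift df.2].
Qed.

Lemma circle_ccont f : circle f -> ccont f.
Proof. by case=> /csmooth_ccont. Qed.

Lemma circle_bounded f : circle f -> exists2 c, 0 <= c & forall x, nrc (f x) <= c.
Proof.
move=> [/csmooth_ccont[c1 c2] pf].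
have [|a a0 ha] := periodic_bounded _ c1; first by move=> x; rewrite pf.
have [|b b0 hb] := periodic_bounded _ c2; first by move=> x; rewrite pf.
by exists (a + b) => [|x]; [exact: addr_ge0|rewrite (le_trans (nrc_le _))// lerD].
Qed.

Lemma fcD f g n : circle f -> circle g ->
  fourier_coef (fun x => f x + g x) n = fourier_coef f n + fourier_coef g n.
Proof.
move=> cf cg; rewrite /fourier_coef; under eq_fun do rewrite mulrDl.
by apply: cintD; apply: circle_ccont; apply: circleM => //; exact: circle_cexpN.
Qed.

Lemma fcZ c f n : circle f ->
  fourier_coef (fun x => c * f x) n = c * fourier_coef f n.
Proof.
move=> cf; rewrite /fourier_coef; under eq_fun do rewrite -mulrA.
by apply: cintZ; apply: circle_ccont; apply: circleM => //; exact: circle_cexpN.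
Qed.

Lemma fc_cexp f m n :
  fourier_coef (fun x => f x * cexp (m%:~R * x)) n = fourier_coef f (n - m).
Proof.
congr cintegral01; apply/funext => x; rewrite -mulrA -cexpD; congr (_ * cexp _).
by rewrite intrD mulrNz; ring.
Qed.

Lemma fc_shift f a n : circle f ->
  fourier_coef (fun x => f (x + a)) n = cexp (n%:~R * a) * fourier_coef f n.
Proof.
move=> cf; have cfe := circleM _ _ cf (circle_cexpN n).
rewrite /fourier_coef -(cint_shift _ a (circle_ccont _ cfe))//; last exact: cfe.2.
rewrite -cintZ; last exact: circle_ccont (circle_shift _ a cfe).
congr cintegral01; apply/funext => x; rewrite mulrCA -cexpD; congr (_ * cexp _).
by ring.
Qed.

Lemma fc_opp f n : circle f ->
  fourier_coef (fun x => f (- x)) n = fourier_coef f (- n).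
Proof.
move=> cf; have cfe := circleM _ _ cf (circle_cexpN (- n)).
rewrite /fourier_coef -(cint_opp _ (circle_ccont _ cfe))//; last exact: cfe.2.
congr cintegral01; apply/funext => x; congr (_ * cexp _).
by rewrite mulrNz; ring.
Qed.

Lemma fcJ f n : circle f ->
  fourier_coef (fun x => (f x)^*%C) n = (fourier_coef f (- n))^*%C.
Proof.
move=> cf; have cfe := circleM _ _ cf (circle_cexpN (- n)).
rewrite /fourier_coef -(cintJ _ (circle_ccont _ cfe)).
congr cintegral01; apply/funext => x; rewrite conjcM -cexpN; congr (_ * cexp _).
by rewrite mulrNz; ring.
Qed.

(** Integration by parts: the derivative of the periodic function [f x * cexp (- (n x))] integrates
    to 0 over a period. *)
Lemma fc_derive f n : circle f ->
  fourier_coef (cderive f) n = (0 +i* (2 * pi * n%:~R)) * fourier_coef f n.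
Proof.
move=> cf; have [df cdf] := circle_derive _ cf.
have ce := circle_cexpN n.
have de : cisD (fun x : R => cexp (- (n%:~R * x)))
    (fun x : R => (0 +i* (2 * pi * - n%:~R)) * cexp (- (n%:~R * x))).
  have := cisD_cexp (- n%:~R : R).
  by under eq_fun do rewrite mulNr; under [X in cisD _ X -> _]eq_fun do rewrite mulNr.
have h := cint_FTC _ _ (cisDM _ _ _ _ df de).
have c1 : circle (fun x => cderive f x * cexp (- (n%:~R * x))) by exact: circleM.
have c2 : circle (fun x => f x * cexp (- (n%:~R * x))) by exact: circleM.
have c3 : circle (fun x => f x * ((0 +i* (2 * pi * - n%:~R)) * cexp (- (n%:~R * x)))).
  by apply: circleM => //; apply: circleM => //; exact: circle_cst.
have := h (circle_ccont _ (circleD _ _ c3 c1)).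
rewrite cintD; [|exact: circle_ccont..].
have -> : f 1 * cexp (- (n%:~R * 1)) - f 0 * cexp (- (n%:~R * 0)) = 0.
  by have := c2.2 0; rewrite add0r => ->; rewrite subrr.
have -> : (fun x => f x * ((0 +i* (2 * pi * - n%:~R)) * cexp (- (n%:~R * x)))) =
    (fun x => (- (0 +i* (2 * pi * n%:~R))) * (f x * cexp (- (n%:~R * x)))).
  apply/funext => x; rewrite mulrCA; congr (_ * _).
  by apply: complex_ext; rewrite ?cReN ?cImN /=; ring.
rewrite cintZ; last exact: circle_ccont.
by rewrite /fourier_coef => /eqP; rewrite addrC mulNr subr_eq0 => /eqP.
Qed.

Lemma fc_bound f c n : circle f -> (forall x, nrc (f x) <= c) ->
  nrc (fourier_coef f n) <= 2 * c.
Proof.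
move=> cf h; apply: cint_bound => [|x].
  by apply: circle_ccont; apply: circleM => //; exact: circle_cexpN.
by rewrite nrcM nrc_cexp mulr1.
Qed.

(** * Decay of Fourier coefficients *)

Lemma nrc_im (y : R) : nrc (0 +i* y) = `|y|.
Proof. by rewrite /nr normc_def /= expr0n add0r sqrtr_sqr. Qed.

(** The factor [2 * pi] is weakened to 4, using [pi >= 2]. *)
Lemma fc_decay1 f n : circle f ->
  4 * `|n%:~R| * nrc (fourier_coef f n) <= nrc (fourier_coef (cderive f) n).
Proof.
move=> cf; rewrite fc_derive// nrcM nrc_im ler_wpM2r ?nr_ge0//.
rewrite normrM ler_wpM2r// ger0_norm ?mulr_ge0 ?pi_ge0//.
by have := pi_ge2 R; lra.
Qed.

(** Two derivatives gain a factor [16 * J ^+ 2]; against the bound [2 * c] this leaves [c / 8]. *)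
Lemma decay_from_two_steps (a b d c J : R) : 0 < J -> 4 * J * a <= b ->
  4 * J * b <= d -> d <= 2 * c -> a <= c / 8 / J ^+ 2.
Proof.
move=> j0 h1 h2 h3; rewrite ler_pdivlMr ?exprn_gt0// expr2.
have h4 : 4 * J * (4 * J * a) <= 4 * J * b by rewrite ler_wpM2l// mulr_ge0// ltW.
have -> : a * (J * J) = 4 * J * (4 * J * a) / 16 by field.
lra.
Qed.

Lemma fc_decay2 f c (j : nat) n : circle f -> `|n|%N = j.+1 ->
  (forall x, nrc (cderive (cderive f) x) <= c) ->
  nrc (fourier_coef f n) <= c / 8 / j.+1%:R ^+ 2.
Proof.
move=> cf nj h; have [df cdf] := circle_derive _ cf.
have [_ cddf] := circle_derive _ cdf.
have h2 := fc_bound _ c n cddf h.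
have h1 := fc_decay1 _ n cf; have h1' := fc_decay1 _ n cdf.
have nE : `|n%:~R| = j.+1%:R :> R by rewrite -intr_norm -abszE nj.
rewrite nE in h1 h1'.
have j0 : 0 < j.+1%:R :> R by rewrite ltr0n.
exact: decay_from_two_steps j0 h1 h1' h2.
Qed.

(** Comparison with a telescoping series, by [1 / (m+1)^2 <= 1/m - 1/(m+1)]; each step adds two
    terms, whence the factor 2. *)
Lemma symsum_tail (V : normedZmodType R[i]) (F : int -> V) (B : R) N m :
  (forall j (n : int), `|n|%N = j.+1 -> nr V (F n) <= B / j.+1%:R ^+ 2) ->
  (0 < N)%N -> (N <= m)%N ->
  nr V (symsum m F - symsum N F) <= 2 * B * (N%:R^-1 - m%:R^-1).
Proof.
move=> FB N0; elim: m => [|m IH]; first by rewrite leqn0 => /eqP->; rewrite !subrr nr0 mulr0.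
rewrite leq_eqVlt => /predU1P[->|]; first by rewrite !subrr nr0 mulr0.
rewrite ltnS => Nm; rewrite symsumS addrAC (le_trans (nrD _ _ _))//.
have m0 : (0 < m)%N by exact: leq_trans Nm.
have mR : 0 < m%:R :> R by rewrite ltr0n.
have h1 := FB m m.+1%:Z erefl; have h2 := FB m (- m.+1%:Z) erefl.
have h3 := nrD _ (F m.+1%:Z) (F (- m.+1%:Z)).
have B0 : 0 <= B.
  have := le_trans (nr_ge0 _ _) (FB 0 1 erefl).
  by rewrite expr1n divr1.
have h4 : B / m.+1%:R ^+ 2 <= B * (m%:R^-1 - m.+1%:R^-1).
  rewrite ler_wpM2l// -natr1.
  have m1 : 0 < m%:R + 1 :> R by lra.
  rewrite -subr_ge0.
  have -> : m%:R^-1 - (m%:R + 1)^-1 - ((m%:R + 1) ^+ 2)^-1 =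
      (m%:R * (m%:R + 1) ^+ 2)^-1 :> R by field; rewrite !gt_eqF.
  by rewrite invr_ge0 mulr_ge0 ?ltW// exprn_gt0.
have -> : 2 * B * (N%:R^-1 - m.+1%:R^-1) =
    2 * B * (N%:R^-1 - m%:R^-1) + 2 * (B * (m%:R^-1 - m.+1%:R^-1)) by ring.
apply: lerD (IH Nm) _; apply: (le_trans h3); apply: (le_trans (lerD h1 h2)).
have -> (z : R) : 2 * z = z + z by ring.
exact: lerD.
Qed.

(** The indices 1 and -1 contribute at most [2 * B], and the tail beyond them another [2 * B]. *)
Lemma symsum_bound (V : normedZmodType R[i]) (F : int -> V) (B : R) m :
  (forall j (n : int), `|n|%N = j.+1 -> nr V (F n) <= B / j.+1%:R ^+ 2) ->
  nr V (symsum m F) <= nr V (F 0) + 4 * B.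
Proof.
move=> FB.
have B0 : 0 <= B.
  have := le_trans (nr_ge0 _ _) (FB 0 1 erefl).
  by rewrite expr1n divr1.
case: m => [|m]; first by rewrite symsum0; lra.
have -> : symsum m.+1 F = symsum 1 F + (symsum m.+1 F - symsum 1 F).
  by rewrite addrC subrK.
have h1 := nrD _ (symsum 1 F) (symsum m.+1 F - symsum 1 F).
have h2 := symsum_tail _ _ _ _ _ FB (isT : (0 < 1)%N) (isT : (1 <= m.+1)%N).
have h3 : symsum 1 F = F 0 + (F 1 + F (-1)) by rewrite symsumS symsum0.
have h4 := nrD _ (F 0) (F 1 + F (-1)); have h5 := nrD _ (F 1) (F (-1)).
have := FB 0 1 erefl; have := FB 0 (-1) erefl; rewrite expr1n divr1.
have m1 : 0 <= m.+1%:R^-1 :> R by rewrite invr_ge0.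
have h6 : 2 * B * (1^-1 - m.+1%:R^-1) <= 2 * B.
  by rewrite invr1 -[leRHS]mulr1 ler_wpM2l ?mulr_ge0//; lra.
rewrite -h3 in h4 => f1 f2; have h7 := le_trans h2 h6; clear h2 h6.
apply: (le_trans h1); apply: (le_trans (lerD h4 h7)); lra.
Qed.

(** * Pointwise convergence of Fourier series through the Fejer kernel *)

(** The passage from averages back to the sequence. If [a N] exceeded [B] by [d > 0], every later
    term would be at least [d] and the sums would grow like [d * K], against a growth of at most
    [d / 2 * K]. *)
Lemma average_le (a : nat -> R) (B : R) N :
  (forall m, (N <= m)%N -> a N - B <= a m) ->
  (forall e : R, 0 < e -> exists C, forall K, \sum_(m < K) a m <= e * K%:R + C) ->
  a N <= B.
Proof.
move=> h1 h2; rewrite leNgt; apply/negP => aB.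
pose d := a N - B; have d0 : 0 < d by rewrite /d; lra.
have [C hC] := h2 (d / 2) ltac:(lra).
have low K : \sum_(m < N) a m + d * K%:R <= \sum_(m < N + K) a m.
  elim: K => [|K IH]; first by rewrite mulr0 addr0 addn0.
  rewrite addnS big_ord_recr /= -natr1; have := h1 (N + K)%N (leq_addr _ _).
  by rewrite -/d; lra.
set A := \sum_(m < N) a m in low.
have hK (K : nat) : d / 2 * K%:R <= C + d / 2 * N%:R - A.
  by have := hC (N + K)%N; have := low K; rewrite natrD; lra.
have [K hK'] : exists K : nat, (C + d / 2 * N%:R - A) / (d / 2) < K%:R.
  exists (Num.bound `|(C + d / 2 * N%:R - A) / (d / 2)|).
  exact: le_lt_trans (ler_norm _) (archi_boundP (normr_ge0 _)).
by move: hK'; rewrite ltr_pdivrMr ?divr_gt0// [_%:R * _]mulrC ltNge hK.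
Qed.

(** The Fejer kernel without its factor 1/N: a sum of N Dirichlet kernels. *)
Definition fejer N (x : R) : R[i] :=
  \sum_(m < N) symsum m (fun n => cexp (- (n%:~R * x))).

Lemma circle_fejer N : circle (fejer N).
Proof.
have cs m : circle (fun x => symsum m (fun n => cexp (- (n%:~R * x)))).
  elim: m => [|m IH].
    by under eq_fun do rewrite symsum0; exact: circle_cexpN.
  under eq_fun do rewrite symsumS.
  by apply: circleD => //; apply: circleD; exact: circle_cexpN.
rewrite /fejer; elim: N => [|N IH].
  by under eq_fun do rewrite big_ord0; exact: circle_cst.
by under eq_fun do rewrite big_ord_recr /=; exact: circleD.
Qed.

Lemma cint_fejer f N : circle f ->
  cintegral01 (fun x => f x * fejer N x) = \sum_(m < N) symsum m (fourier_coef f).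
Proof.
move=> cf.
have cs m : circle (fun x => f x * symsum m (fun n => cexp (- (n%:~R * x)))) /\
    cintegral01 (fun x => f x * symsum m (fun n => cexp (- (n%:~R * x)))) =
    symsum m (fourier_coef f).
  elim: m => [|m [c1 c2]].
    under eq_fun do rewrite symsum0.
    by rewrite symsum0; split=> //; apply: circleM => //; exact: circle_cexpN.
  have cn n : circle (fun x => f x * cexp (- (n%:~R * x))).
    by apply: circleM => //; exact: circle_cexpN.
  under eq_fun do rewrite symsumS !mulrDr.
  split; first by apply: circleD => //; exact: circleD.
  rewrite cintD; [|exact: circle_ccont|by apply: circle_ccont; exact: circleD].
  by rewrite c2 symsumS cintD//; exact: circle_ccont.
elim: N => [|N IH].
  rewrite big_ord0 /fejer; under eq_fun do rewrite big_ord0 mulr0.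
  by rewrite (cint_FTC (fun=> 0)) ?subrr//; split; first [exact: isD_cst|exact: continuous_cstf].
rewrite big_ord_recr /=; under eq_fun do rewrite /fejer big_ord_recr /= mulrDr.
have [c1 c2] := cs N.
rewrite cintD; [|by apply: circle_ccont; apply: circleM => //; exact: circle_fejer|exact: circle_ccont].
by rewrite c2 IH.
Qed.

(** Both ranges are indexed from 0 to N - 1, in the shape of the cross terms in [fejerE]. *)
Lemma symsum_rev (V : zmodType) N (F : int -> V) :
  symsum N F = F 0 + (\sum_(k < N) F (N%:Z - k%:Z) + \sum_(k < N) F (k%:Z - N%:Z)).
Proof.
have h : symsum N F = F 0 + (\sum_(k < N) F (k.+1%:Z) + \sum_(k < N) F (- k.+1%:Z)).
  elim: N => [|N IH]; first by rewrite symsum0 !big_ord0 !addr0.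
  rewrite symsumS IH !big_ord_recr /= -!addrA; congr (_ + (_ + _)).
  by rewrite addrCA.
rewrite h; congr (_ + (_ + _)); rewrite [RHS](reindex_inj rev_ord_inj) /=.
  by apply: eq_bigr => i _; congr F; have := ltn_ord i; lia.
by apply: eq_bigr => i _; congr F; have := ltn_ord i; lia.
Qed.

(** With [z_k = cexp (k x)], the N-th Dirichlet kernel is the increment of the squared modulus of
    [z_0 + ... + z_(N-1)] when [z_N] is added: the two cross terms carry the frequencies 1 to N of
    either sign, and [z_N] times its conjugate is the constant term. *)
Lemma fejerE N x :
  fejer N x = (\sum_(k < N) cexp (k%:R * x)) * (\sum_(k < N) cexp (k%:R * x))^*%C.
Proof.
set E := fun n : int => cexp (- (n%:~R * x)).
have ED n m : E (n + m) = E n * E m.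
  by rewrite /E -cexpD; congr cexp; rewrite intrD; ring.
have EN (n : nat) : E (- n%:Z) = cexp (n%:R * x).
  by rewrite /E mulrNz mulNr opprK -pmulrn.
have [c hc] : exists c : nat -> R[i], forall k, (cexp (k%:R * x))^*%C = c k.
  by exists (fun k => (cexp (k%:R * x))^*%C).
have EP (n : nat) : E n%:Z = c n by rewrite /E cexpN -pmulrn hc.
have -> M : (\sum_(k < M) cexp (k%:R * x))^*%C = \sum_(k < M) c k.
  by rewrite rmorph_sum; apply: eq_bigr => k _; exact: hc.
rewrite /fejer; elim: N => [|N IH]; first by rewrite !big_ord0 mul0r.
rewrite !big_ord_recr /= IH symsum_rev.
have -> : \sum_(k < N) cexp (- ((N%:Z - k%:Z)%:~R * x)) =
    c N * \sum_(k < N) cexp (k%:R * x).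
  by rewrite mulr_sumr; apply: eq_bigr => k _; rewrite -/(E _) ED EN EP.
have -> : \sum_(k < N) cexp (- ((k%:Z - N%:Z)%:~R * x)) =
    cexp (N%:R * x) * \sum_(k < N) c k.
  rewrite mulr_sumr; apply: eq_bigr => k _.
  by rewrite -/(E _) ED EN EP mulrC.
have -> : cexp (- (0%:~R * x)) = cexp (N%:R * x) * c N.
  by rewrite -hc -cexpN cexpMN mulr0z mul0r oppr0 cexp0.
by ring.
Qed.

Lemma fejer_real N x : fejer N x = (nrc (\sum_(k < N) cexp (k%:R * x)) ^+ 2)%:C.
Proof.
rewrite fejerE; set z := \sum_(k < N) _.
by rewrite -sqr_normc nrE rmorphXn.
Qed.

(** The geometric sum [D] satisfies [(cexp x - 1) * D = cexp (N x) - 1], of modulus at most 2, while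
    [|cexp x - 1|^2 = 2 (1 - cos (2 pi x))]. *)
Lemma fejer_le N x :
  (1 - cos (2 * pi * x)) * nrc (\sum_(k < N) cexp (k%:R * x)) ^+ 2 <= 2.
Proof.
set D := \sum_(k < N) _.
have h : (cexp x - 1) * D = cexp (N%:R * x) - 1.
  rewrite /D; elim: N {D} => [|N IH].
    by rewrite big_ord0 mulr0 mul0r cexp0 subrr.
  have -> : N.+1%:R * x = N%:R * x + x by rewrite -natr1; ring.
  by rewrite big_ord_recr /= mulrDr IH cexpD; ring.
have h1 : nrc (cexp x - 1) ^+ 2 = 2 * (1 - cos (2 * pi * x)).
  rewrite nrc_sqr /cexp /= subr0.
  by have := cos2Dsin2 (2 * pi * x); set c := cos _; set t := sin _; nra.
have h2 : nrc (cexp (N%:R * x) - 1) <= 2.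
  by apply: le_trans (nrB _ _ _) _; rewrite nrc_cexp nrc1; lra.
have h3 : nrc (cexp (N%:R * x) - 1) ^+ 2 <= 4.
  have := nr_ge0 _ (cexp (N%:R * x) - 1); nra.
by rewrite -h nrcM exprMn h1 in h3; nra.
Qed.

(** For [n <> 0] the decay estimate is applied to a function whose derivative vanishes. *)
Lemma fc_cst n : fourier_coef (fun _ : R => 1) n = (n == 0)%:R.
Proof.
have c1 := circle_cst 1.
have [->|n0] := eqVneq n 0.
  rewrite /fourier_coef (_ : (fun _ => _) = fun=> 1); last first.
    by apply/funext => x; rewrite mulr0z mul0r oppr0 cexp0 mul1r.
  by rewrite cintE /= !int01_cst.
have := fc_decay1 _ n c1.
rewrite (_ : cderive (fun=> 1) = fun=> 0 * 1); last first.
  rewrite mul0r; apply: cisD_derive; split; exact: isD_cst.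
rewrite fcZ// mul0r nr0 pmulr_rle0; first exact: nr_le0.
by rewrite mulr_gt0// normr_gt0 intr_eq0.
Qed.

Lemma symsum_fc_cst m : symsum m (fourier_coef (fun _ : R => 1)) = 1.
Proof.
elim: m => [|m IH]; first by rewrite symsum0 fc_cst.
by rewrite symsumS IH !fc_cst /= !addr0.
Qed.

Lemma int01_fejer N : int01 (fun x => Re (fejer N x)) = N%:R.
Proof.
have := cint_fejer _ N (circle_cst 1).
under eq_bigr do rewrite symsum_fc_cst.
under eq_fun do rewrite mul1r.
rewrite sumr_const card_ord cintE -(rmorph_nat (real_complex R)).
by move=> /(congr1 (@complex.Re R)).
Qed.

(* Near 0 the continuity of [u] controls it, elsewhere the Fejer kernel is
   bounded independently of N. *)
Lemma fejer_estimate (u : R -> R) : continuous u -> (forall x, u (x + 1) = u x) ->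
  u 0 = 0 -> forall e : R, 0 < e ->
  exists C, forall K, `|int01 (fun x => u x * Re (fejer K x))| <= e * K%:R + C.
Proof.
move=> cu pu u0 e e0; have [B B0 uB] := periodic_bounded _ cu pu.
have [d [d0 d12 hd]] : exists d : R, [/\ 0 < d, d < 1 / 2 & forall x, `|x| < d -> `|u x| <= e].
  have /cvgrPdist_le /(_ e e0) := cu 0.
  (* The cap 1/4 keeps [d] below 1/2. *)
  move=> /nbhs_ballP[d /= d0 hd]; exists (Num.min d (1 / 4)).
  split; [by rewrite lt_min d0; lra|by rewrite gt_min; apply/orP; right; lra|].
  move=> x; rewrite lt_min => /andP[xd _].
  have := hd x; rewrite /ball /= sub0r normrN u0 sub0r normrN; exact.
(* On [d, 1 - d] the cosine is at most its value at the ends, so [fejer_le] bounds the kernel there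
   by [2 / c], whatever its index. *)
pose c := 1 - cos (2 * pi * d).
have p0 := pi_gt0 R.
have cosd x : d <= x <= 1 - d -> cos (2 * pi * x) <= cos (2 * pi * d).
  have half y : d <= y <= 1 / 2 -> cos (2 * pi * y) <= cos (2 * pi * d).
    move=> hy; rewrite leNgt ltr_cos ?in_itv/=; first by rewrite -leNgt ler_pM2l; lra.
      by apply/andP; split; nra.
    by apply/andP; split; nra.
  move=> hx; have [x12|x12] := leP x (1 / 2); first by apply: half; lra.
  have -> : cos (2 * pi * x) = cos (2 * pi * (1 - x)).
    rewrite -cosN -cosD2pi; congr cos; rewrite mulr2n; ring.
  by apply: half; lra.
have c0 : 0 < c.
  rewrite subr_gt0 -[ltRHS](cos0 R) ltr_cos ?in_itv/=; first by nra.
    by apply/andP; split; nra.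
  by apply/andP; split; nra.
have kc K : continuous (fun x => Re (fejer K x)).
  by have [] := circle_ccont _ (circle_fejer K).
have k0 K x : 0 <= Re (fejer K x) by rewrite fejer_real /= sqr_ge0.
exists (2 * B / c) => K.
have pointwise x : 0 <= x <= 1 -> `|u x * Re (fejer K x)| <= e * Re (fejer K x) + 2 * B / c.
  move=> hx; rewrite normrM [`|Re _|]ger0_norm//.
  have Bc : 0 <= 2 * B / c by rewrite divr_ge0 ?mulr_ge0// ltW.
  have small : `|u x| <= e -> `|u x| * Re (fejer K x) <= e * Re (fejer K x) + 2 * B / c.
    by move=> h; have := ler_wpM2r (k0 K x) h; lra.
  have [xd|xd] := ltP x d; first by apply: small; apply: hd; rewrite ger0_norm; lra.
  have [xd'|xd'] := ltP (1 - d) x.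
    apply: small; rewrite -[u x](_ : u (x - 1) = _); last by rewrite -pu subrK.
    by apply: hd; rewrite ler0_norm; lra.
  have hk := fejer_le K x; rewrite -[nrc _ ^+ 2](_ : Re (fejer K x) = _) in hk; last first.
    by rewrite fejer_real.
  have cx := cosd x ltac:(lra).
  have hk2 : c * Re (fejer K x) <= 2 by apply: le_trans hk; rewrite ler_wpM2r// /c; lra.
  have : `|u x| * Re (fejer K x) <= 2 * B / c.
    rewrite ler_pdivlMr// -mulrA [Re _ * c]mulrC [2 * B]mulrC.
    by apply: ler_pM => //; rewrite mulr_ge0// ltW.
  by have := mulr_ge0 (ltW e0) (k0 K x); lra.
have cm : continuous (fun x => u x * Re (fejer K x)).
  by move=> x; apply: continuousM; [exact: cu|exact: kc].
have cb (a b : R) : continuous (fun x => a * Re (fejer K x) + b).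
  by apply: continuous_addf; [exact: continuous_scalef|exact: continuous_cstf].
have ib (a b : R) : int01 (fun x => a * Re (fejer K x) + b) = a * K%:R + b.
  rewrite int01D ?int01Z ?int01_fejer ?int01_cst//; last exact: continuous_cstf.
  exact: continuous_scalef.
rewrite ler_norml; apply/andP; split.
  rewrite -[X in X <= _](_ : int01 (fun x => - e * Re (fejer K x) - 2 * B / c) = _); last first.
    by rewrite ib; ring.
  apply: int01_le => // x hx; have := pointwise x hx.
  by rewrite ler_norml; lra.
rewrite -ib; apply: int01_le => // x hx; have := pointwise x hx.
by rewrite ler_norml; lra.
Qed.

(** By the Fejer estimate the averages of [S m - f 0] tend to 0, and beyond N the partial sums move
    by at most [c / 4 / N]. So [average_le] bounds the real and imaginary parts of [S N - f 0], with
    either sign, by [c / 4 / N]. *)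
Lemma fourier_at0 f c N : circle f -> (forall x, nrc (cderive (cderive f) x) <= c) ->
  (0 < N)%N -> nrc (symsum N (fourier_coef f) - f 0) <= c / N%:R.
Proof.
move=> cf fc N0; pose S m := symsum m (fourier_coef f).
have NR : 0 < N%:R :> R by rewrite ltr0n.
have c0 : 0 <= c by exact: le_trans (nr_ge0 _ _) (fc 0).
have tail m : (N <= m)%N -> nrc (S m - S N) <= c / 4 / N%:R.
  move=> Nm; have FB j n : `|n|%N = j.+1 ->
      nrc (fourier_coef f n) <= c / 8 / j.+1%:R ^+ 2.
    by move=> nj; exact: fc_decay2.
  have := symsum_tail _ _ _ _ _ FB N0 Nm.
  have m0 : 0 <= m%:R^-1 :> R by rewrite invr_ge0.
  rewrite -/(S m) -/(S N); set M := m%:R^-1 in m0 *; set I := N%:R^-1; nra.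
pose g x := f x + (- f 0).
have cg : circle g by apply: circleD => //; exact: circle_cst.
have Sg m : symsum m (fourier_coef g) = S m - f 0.
  rewrite (symsum_ext _ _ _ (fun n => fourier_coef f n + - f 0 * fourier_coef (fun=> 1) n)).
    rewrite symsumD -(symsum_morph _ _ ( *%R (- f 0))) ?mulr0//; last by move=> ? ?; rewrite mulrDr.
    by rewrite symsum_fc_cst mulr1.
  move=> n; rewrite -fcZ; last exact: circle_cst.
  rewrite -fcD//; last by apply: circleM; exact: circle_cst.
  by congr fourier_coef; apply/funext => x; rewrite mulr1.
have [c1 c2] := circle_ccont _ cg.
have g0 : g 0 = 0 by rewrite /g subrr.
have sumE K : \sum_(m < K) (S m - f 0) =
    int01 (fun x => Re (g x) * Re (fejer K x)) +i* int01 (fun x => Im (g x) * Re (fejer K x)).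
  rewrite (eq_bigr (fun m : 'I_K => symsum m (fourier_coef g))); last by move=> m _; rewrite Sg.
  rewrite -cint_fejer// cintE; congr (int01 _ +i* int01 _); apply/funext => x.
    by rewrite cReM fejer_real /= mulr0 subr0.
  by rewrite cImM fejer_real /= mulr0 add0r.
(* [h] will be Re, Im and their opposites: additive real functions dominated by the modulus. *)
have avg (h : R[i] -> R) (u : R -> R) : h 0 = 0 -> {morph h : x y / x + y} ->
    {morph h : x / - x} -> (forall x, `|h x| <= nrc x) ->
    (forall K, `|h (\sum_(m < K) (S m - f 0))| = `|int01 (fun x => u x * Re (fejer K x))|) ->
    continuous u -> (forall x, u (x + 1) = u x) -> u 0 = 0 ->
    h (S N - f 0) <= c / 4 / N%:R.
  move=> h0 hD hN hn hS cu pu u0.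
  apply: (average_le (fun m => h (S m - f 0))).
    move=> m Nm; have := le_trans (hn _) (tail m Nm).
    rewrite (_ : S m - S N = (S m - f 0) + - (S N - f 0)); last by ring.
    by rewrite hD hN ler_norml; lra.
  move=> e e0; have [C hC] := fejer_estimate u cu pu u0 e e0; exists C => K.
  rewrite -(big_morph h hD h0); apply: le_trans (hC K).
  by rewrite -hS ler_norm.
have pg x : g (x + 1) = g x by exact: cg.2.
have r1 : Re (S N - f 0) <= c / 4 / N%:R.
  apply: (avg (@complex.Re R) (fun x => Re (g x))) => //.
  - exact: cReD. - exact: cReN. - exact: nrc_geRe.
  - by move=> K; rewrite sumE.
  - by move=> x; rewrite pg.
  - by rewrite g0.
have r2 : Im (S N - f 0) <= c / 4 / N%:R.
  apply: (avg (@complex.Im R) (fun x => Im (g x))) => //.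
  - exact: cImD. - exact: cImN. - exact: nrc_geIm.
  - by move=> K; rewrite sumE.
  - by move=> x; rewrite pg.
  - by rewrite g0.
have r3 : - Re (S N - f 0) <= c / 4 / N%:R.
  apply: (avg (fun x => - Re x) (fun x => Re (g x))) => //.
  - by rewrite oppr0.
  - by move=> x y; rewrite cReD opprD.
  - by move=> x; rewrite cReN.
  - by move=> x; rewrite normrN nrc_geRe.
  - by move=> K; rewrite normrN sumE.
  - by move=> x; rewrite pg.
  - by rewrite g0.
have r4 : - Im (S N - f 0) <= c / 4 / N%:R.
  apply: (avg (fun x => - Im x) (fun x => Im (g x))) => //.
  - by rewrite oppr0.
  - by move=> x y; rewrite cImD opprD.
  - by move=> x; rewrite cImN.
  - by move=> x; rewrite normrN nrc_geIm.
  - by move=> K; rewrite normrN sumE.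
  - by move=> x; rewrite pg.
  - by rewrite g0.
rewrite (le_trans (nrc_le _))//.
have a1 : `|Re (S N - f 0)| <= c / 4 / N%:R by rewrite ler_norml; lra.
have a2 : `|Im (S N - f 0)| <= c / 4 / N%:R by rewrite ler_norml; lra.
rewrite (le_trans (lerD a1 a2))//.
have := divr_ge0 c0 (ltW NR).
by rewrite (_ : c / 4 / N%:R = c / N%:R / 4); [lra|ring].
Qed.

(** The estimate at 0, applied to a translate of [f]. *)
Lemma fourier_inversion f c N x : circle f ->
  (forall x, nrc (cderive (cderive f) x) <= c) -> (0 < N)%N ->
  nrc (symsum N (fun n => fourier_coef f n * cexp (n%:~R * x)) - f x) <= c / N%:R.
Proof.
move=> cf fc N0; have cs := circle_shift _ x cf.
have h y : nrc (cderive (cderive (fun x0 => f (x0 + x))) y) <= c.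
  by rewrite !cderive_shift//; have [] := circle_derive _ cf.
have := fourier_at0 _ _ _ cs h N0; rewrite add0r; congr (nrc (_ - _) <= _).
by apply: symsum_ext => n; rewrite fc_shift// mulrC.
Qed.

End Fourier.

(** * Unitaries and limits in a C*-algebra *)

Section CStarFacts.
Context {R : realType} {A : cstarAlgType R}.
Implicit Types (x y u v w : A).
Local Notation nra x := (nr _ (x : A)).
Local Notation nrc := (nr R[i]).

Lemma starD x y : star (x + y) = star x + star y. Proof. exact: cstar_starD. Qed.
Lemma starM x y : star (x * y) = star y * star x. Proof. exact: cstar_starM. Qed.
Lemma starK x : star (star x) = x. Proof. exact: cstar_starK. Qed.
Lemma starZ (a : R[i]) x : star (a *: x) = a^*%C *: star x.
Proof. exact: cstar_starZ. Qed.

Lemma star1 : star (1 : A) = 1.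
Proof.
have : star 1 * 1 = 1 :> A.
  by rewrite -[X in _ * X](starK 1) -starM mulr1 starK.
by rewrite mulr1.
Qed.

Lemma star0 : star (0 : A) = 0.
Proof. by apply: (addrI (star 0)); rewrite -starD !addr0. Qed.

Lemma nraM x y : nra (x * y) <= nra x * nra y.
Proof. by rewrite -lecR rmorphM /= -!nrE; exact: cstar_normM. Qed.

Lemma nra_sqr x : nra (star x * x) = nra x ^+ 2.
Proof.
have h : `|star x * x| = `|x| ^+ 2 by exact: cstar_normE.
by apply: complexI; rewrite rmorphXn /= -!nrE.
Qed.

(** The C*-identity gives [|y|^2 <= |star y| |y|]; this is applied to [x] and to [star x]. *)
Lemma nra_star x : nra (star x) = nra x.
Proof.
have h y : nra y <= nra (star y).
  have [y0|y0] := leP (nra y) 0; first by rewrite (le_trans y0)// nr_ge0.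
  by rewrite -(ler_pM2r y0) -expr2 -nra_sqr nraM.
by apply/eqP; rewrite eq_le h -{2}[x]starK h.
Qed.

Lemma nra1 : nra 1 = 1.
Proof.
have := nra_sqr 1; rewrite star1 mulr1 expr2 => /eqP.
rewrite -subr_eq0 -{1}[nra 1]mulr1 -mulrBr mulf_eq0 => /orP[/eqP h|].
  by have := @nr_le0 _ _ (1 : A); rewrite h lexx => /(_ isT) /eqP; rewrite oner_eq0.
by rewrite subr_eq0 => /eqP <-.
Qed.

Lemma nra_unitary u : unitary u -> nra u = 1.
Proof.
move=> [h _]; have := nra_sqr u; rewrite h nra1 => /esym/eqP.
by rewrite sqrp_eq1 ?nr_ge0// => /eqP.
Qed.

Lemma unitary_star u : unitary u -> unitary (star u).
Proof. by move=> [h1 h2]; split; rewrite starK. Qed.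

Lemma unitaryM u v : unitary u -> unitary v -> unitary (u * v).
Proof.
move=> [u1 u2] [v1 v2]; split; rewrite starM.
  by rewrite mulrA -[star v * _ * _]mulrA u1 mulr1.
by rewrite mulrA -[u * v * _]mulrA v2 mulr1.
Qed.

Lemma unitaryX u k : unitary u -> unitary (u ^+ k).
Proof.
move=> hu; elim: k => [|k IH]; last by rewrite exprS; exact: unitaryM.
by split; rewrite expr0 star1 mulr1.
Qed.

Lemma upow_unitary u n : unitary u -> unitary (upow u n).
Proof. by case: n => n hu; apply: unitaryX => //; exact: unitary_star. Qed.

Lemma upowS u n : unitary u -> upow u (n + 1) = upow u n * u.
Proof.
move=> [h1 h2]; case: n => n.
  by rewrite (_ : Posz n + 1 = Posz n.+1) /= ?exprSr//; lia.
case: n => [|n]; first by rewrite /= expr1 h1.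
rewrite (_ : Negz n.+1 + 1 = Negz n) /=; last by lia.
by rewrite [in RHS]exprSr -mulrA h1 mulr1.
Qed.

Lemma upowB1 u n : unitary u -> upow u (n - 1) = upow u n * star u.
Proof.
move=> hu; have := upowS u (n - 1) hu; rewrite subrK => ->.
by rewrite -mulrA (proj2 hu) mulr1.
Qed.

Lemma upowD u n m : unitary u -> upow u (n + m) = upow u n * upow u m.
Proof.
move=> hu; elim/int_ind: m => [|m IH|m IH].
- by rewrite addr0 /= mulr1.
- have -> : n + m.+1%:Z = n + m%:Z + 1 by lia.
  rewrite upowS// IH -mulrA; congr (_ * _).
  by rewrite -upowS//; congr upow; lia.
- have -> : n - m.+1%:Z = n - m%:Z - 1 by lia.
  rewrite upowB1// IH -mulrA; congr (_ * _).
  by rewrite -upowB1//; congr upow; lia.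
Qed.

Lemma star_upow u n : unitary u -> star (upow u n) = upow u (- n).
Proof.
move=> hu; have [h1 h2] := upow_unitary u n hu.
have : upow u n * upow u (- n) = 1 by rewrite -upowD// subrr.
by move=> /(congr1 ( *%R (star (upow u n)))); rewrite mulrA h1 mul1r mulr1.
Qed.

Lemma upowN1 u : upow u (-1) = star u. Proof. exact: expr1. Qed.

(** Multiplying the relation by [star v] on both sides gives the one for [star v], from which the
    negative powers follow. *)
Lemma comm_upow v w t : unitary v -> v * w = cexp t *: (w * v) ->
  forall n, upow v n * w = cexp (n%:~R * t) *: (w * upow v n).
Proof.
move=> hv vw.
have vw' : star v * w = cexp (- t) *: (w * star v).
  have [h1 h2] := hv.
  have : star v * (v * w) * star v = cexp t *: (star v * (w * v) * star v).
    by rewrite vw -scalerAr -scalerAl.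
  rewrite !mulrA h1 mul1r -[_ * v * star v]mulrA h2 mulr1 => ->.
  by rewrite scalerA mulrC cexpMN scale1r.
elim/int_ind => [|n IH|n IH].
- by rewrite mul0r cexp0 scale1r /= mul1r mulr1.
- have -> : n.+1%:Z = n%:Z + 1 by lia.
  rewrite upowS// -[LHS]mulrA vw -scalerAr [upow v _ * (_ * _)]mulrA IH -scalerAl scalerA -cexpD -mulrA.
  by congr (cexp _ *: _); rewrite intrD; ring.
- have -> : - n.+1%:Z = - n%:Z - 1 by lia.
  rewrite upowB1// -[LHS]mulrA vw' -scalerAr [upow v _ * (_ * _)]mulrA IH -scalerAl scalerA -cexpD -mulrA.
  by congr (cexp _ *: _); rewrite intrD mulrN1z; ring.
Qed.

Lemma comm_upow2 v w t : unitary v -> unitary w -> v * w = cexp t *: (w * v) ->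
  forall n m, upow v n * upow w m = cexp (n%:~R * (m%:~R * t)) *: (upow w m * upow v n).
Proof.
move=> hv hw vw n m.
have h1 := comm_upow v w t hv vw n.
have h2 : w * upow v n = cexp (- (n%:~R * t)) *: (upow v n * w).
  by rewrite h1 scalerA mulrC cexpMN scale1r.
have := comm_upow w _ _ hw h2 m => ->.
rewrite scalerA -cexpD (_ : _ + _ = 0) ?cexp0 ?scale1r//; ring.
Qed.

(** * Limits with real error bounds *)

(** Norms and tolerances of the ambient topology lie in [R[i]]; here they are real, so that the
    estimates are inequalities in an ordered field. *)
Definition lim_to (F : nat -> A) x :=
  forall e : R, 0 < e -> exists N0, forall N, (N0 <= N)%N -> nra (F N - x) <= e.

Lemma lim_toP F x : lim_to F x <-> F @ \oo --> x.
Proof.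
split=> [h|/cvgrPdist_le h e e0].
  apply/cvgrPdist_le => eps eps0.
  have epsE : eps = (complex.Re eps)%:C.
    by move: eps0; case: eps => a b; rewrite ltcE /= => /andP[/eqP-> _].
  have [|N0 hN] := h (complex.Re eps); first by rewrite -ltcR -epsE.
  exists N0 => // N /= NN; rewrite epsE nrE lecR nr_dist; exact: hN.
have [|N0 _ hN] := h e%:C; first by rewrite ltcR.
exists N0 => N NN; have := hN N NN; rewrite /= nrE lecR nr_dist; exact.
Qed.

Lemma lim_to_uniq F x y : lim_to F x -> lim_to F y -> x = y.
Proof.
move=> hx hy; apply/eqP; rewrite -subr_eq0; apply/eqP; apply: nr_le_eq0 => e e0.
have [|N1 h1] := hx (e / 2); first by rewrite divr_gt0.
have [|N2 h2] := hy (e / 2); first by rewrite divr_gt0.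
have := h1 (maxn N1 N2) (leq_maxl _ _); have := h2 (maxn N1 N2) (leq_maxr _ _).
set z := F _ => a b; rewrite (_ : x - y = (z - y) - (z - x)); last first.
  by rewrite opprB [RHS]addrC addrA subrK.
by apply: (le_trans (nrB _ _ _)); lra.
Qed.

Lemma lim_to_cst x : lim_to (fun=> x) x.
Proof. by move=> e e0; exists 0%N => N _; rewrite subrr nr0 ltW. Qed.

Lemma lim_to_ext F G x N1 : (forall N, (N1 <= N)%N -> F N = G N) ->
  lim_to F x -> lim_to G x.
Proof.
move=> FG h e /h[N0 hN]; exists (maxn N0 N1) => N.
by rewrite geq_max => /andP[h0 h1]; rewrite -FG//; exact: hN.
Qed.

Lemma lim_to_near F G x : lim_to F x -> lim_to (fun N => G N - F N) 0 -> lim_to G x.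
Proof.
move=> h1 h2 e e0.
have [|N1 {}h1] := h1 (e / 2); first by rewrite divr_gt0.
have [|N2 {}h2] := h2 (e / 2); first by rewrite divr_gt0.
exists (maxn N1 N2) => N; rewrite geq_max => /andP[a b].
have := h1 N a; have := h2 N b; rewrite subr0 => c d.
rewrite (_ : G N - x = (G N - F N) + (F N - x)); last by rewrite addrA subrK.
by apply: (le_trans (nrD _ _ _)); lra.
Qed.

Lemma lim_toD F G x y : lim_to F x -> lim_to G y -> lim_to (fun N => F N + G N) (x + y).
Proof. by move=> /lim_toP h1 /lim_toP h2; apply/lim_toP; exact: cvgD. Qed.

Lemma lim_to_lip (h : A -> A) (c : R) F x : 0 < c -> {morph h : x y / x + y} ->
  (forall x, nra (h x) <= c * nra x) -> lim_to F x -> lim_to (fun N => h (F N)) (h x).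
Proof.
move=> c0 hD hc hF e e0; have [|N0 hN] := hF (e / c); first by rewrite divr_gt0.
exists N0 => N NN.
have h0 : h 0 = 0 by apply: (addrI (h 0)); rewrite -hD !addr0.
have hN' y : h (- y) = - h y.
  by apply/eqP; rewrite -addr_eq0 -hD addNr h0.
rewrite -hN' -hD (le_trans (hc _))// mulrC -ler_pdivlMr//; exact: hN.
Qed.

Lemma nra_gt0_cover x : exists2 c : R, 0 < c & nra x <= c.
Proof. by exists (nra x + 1); have := nr_ge0 _ (x : A); lra. Qed.

Lemma lim_toMl F x y : lim_to F x -> lim_to (fun N => y * F N) (y * x).
Proof.
have [c c0 hc] := nra_gt0_cover y.
apply: (lim_to_lip (fun z : A => y * z) c F x c0) => [a b|a].
  by rewrite mulrDr.
by apply: le_trans (nraM _ _) _; rewrite ler_wpM2r// nr_ge0.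
Qed.

Lemma lim_toMr F x y : lim_to F x -> lim_to (fun N => F N * y) (x * y).
Proof.
have [c c0 hc] := nra_gt0_cover y.
apply: (lim_to_lip (fun z : A => z * y) c F x c0) => [a b|a].
  by rewrite mulrDl.
by apply: le_trans (nraM _ _) _; rewrite mulrC ler_wpM2r// nr_ge0.
Qed.

Lemma lim_toZ F x (a : R[i]) : lim_to F x -> lim_to (fun N => a *: F N) (a *: x).
Proof.
apply: (lim_to_lip ( *:%R a) (nrc a + 1)).
- by have := nr_ge0 _ a; lra.
- by move=> y z; rewrite scalerDr.
- by move=> y; rewrite nrZ ler_wpM2r ?nr_ge0//; lra.
Qed.

Lemma lim_to_star F x : lim_to F x -> lim_to (fun N => star (F N)) (star x).
Proof.
apply: (lim_to_lip (@star R A) 1) => //; first exact: starD.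
by move=> y; rewrite nra_star mul1r.
Qed.

Lemma lim_to_bound F x (c : R) : (forall N, nra (F N) <= c) -> lim_to F x -> nra x <= c.
Proof.
move=> hF hx; rewrite leNgt; apply/negP => xc.
have [|N0 hN] := hx ((nra x - c) / 2); first by rewrite divr_gt0// subr_gt0.
have := hN N0 (leqnn _); have := hF N0; set z := F N0 => a b.
have := nrB _ z (z - x); rewrite (_ : z - (z - x) = x); last by rewrite opprB addrCA subrr addr0.
by move=> d; lra.
Qed.

Lemma lim_to_bound_inv F (c : R) : 0 <= c ->
  (forall N, (0 < N)%N -> nra (F N) <= c / N%:R) -> lim_to F 0.
Proof.
move=> c0 h e e0; exists (Num.bound (c / e)).+1 => N hN.
have N0 : (0 < N)%N by exact: leq_ltn_trans hN.
rewrite subr0 (le_trans (h N N0))// ler_pdivrMr ?ltr0n//.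
rewrite mulrC -ler_pdivrMr// ltW//.
apply: lt_le_trans (archi_boundP _) _; first by rewrite divr_ge0// ltW.
by rewrite ler_nat ltnW.
Qed.

Lemma lim_to_complete F (c : R) : 0 <= c ->
  (forall N m, (0 < N)%N -> (N <= m)%N -> nra (F m - F N) <= c / N%:R) ->
  exists x, lim_to F x.
Proof.
move=> c0 h.
suff cF : cvg (F @ \oo) by exists (lim (F @ \oo)); apply/lim_toP.
apply/cauchy_cvgP; apply/cauchy_ballP => eps eps0.
have epsE : eps = (complex.Re eps)%:C.
  by move: eps0; case: eps => a b; rewrite ltcE /= => /andP[/eqP-> _].
have e0 : 0 < complex.Re eps by rewrite -ltcR -epsE.
set e := complex.Re eps in epsE e0.
pose N0 := (Num.bound (c / (e / 3))).+1.
have hN0 : c / N0%:R <= e / 3.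
  have e30 : 0 < e / 3 by rewrite divr_gt0.
  rewrite ler_pdivrMr ?ltr0n// mulrC -ler_pdivrMr// ltW//.
  apply: lt_le_trans (archi_boundP _) _; first by rewrite divr_ge0// ltW.
  by rewrite ler_nat.
pose T := [set y : A | exists2 n, (N0 <= n)%N & y = F n].
have FT : (F @ \oo) T by exists N0 => // n /= hn; exists n.
exists (T, T) => //= -[a b] [[n /= hn ->] [m /= hm ->]].
rewrite -ball_normE /= epsE nrE ltcR.
have g1 := h N0 n isT hn; have g2 := h N0 m isT hm.
rewrite (_ : F n - F m = (F n - F N0) - (F m - F N0)); last first.
  by rewrite opprB addrA subrK.
by apply: le_lt_trans (nrB _ _ _) _; lra.
Qed.

End CStarFacts.

(** * The functional calculus f |-> f(V) *)

Section FunctionalCalculus.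
Context {R : realType} {A : cstarAlgType R}.
Implicit Types (w : A) (f g : R -> R[i]) (n : int).
Local Notation nra x := (nr _ (x : A)).
Local Notation nrc := (nr R[i]).

Definition partial_at (V : A) f N : A :=
  symsum N (fun n => fourier_coef f n *: upow V n).

Lemma nra_coef (V : A) f n : unitary V ->
  nra (fourier_coef f n *: upow V n) = nrc (fourier_coef f n).
Proof. by move=> hV; rewrite nrZ nra_unitary ?mulr1//; exact: upow_unitary. Qed.

Lemma cderive2_bounded f : circle f ->
  exists2 c, 0 <= c & forall x, nrc (cderive (cderive f) x) <= c.
Proof.
by move=> /circle_derive[_ /circle_derive[_ /circle_bounded]].
Qed.

Lemma fun_at_ext (V : A) f g : (forall x, f x = g x) -> fun_at V f = fun_at V g.
Proof. by move=> fg; congr fun_at; apply/funext. Qed.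

(** The coefficients decay quadratically and the powers of [V] have norm 1, so the partial sums are
    Cauchy with rate 1/N. *)
Lemma fun_at_lim (V : A) f : unitary V -> circle f ->
  lim_to (partial_at V f) (fun_at V f).
Proof.
move=> hV cf; have [c c0 hc] := cderive2_bounded f cf.
have [N m N0 Nm|x hx] := lim_to_complete (partial_at V f) c c0.
  have FB j n : `|n|%N = j.+1 ->
      nra (fourier_coef f n *: upow V n) <= c / 8 / j.+1%:R ^+ 2.
    by move=> nj; rewrite nra_coef//; exact: fc_decay2.
  have := symsum_tail _ _ _ _ _ FB N0 Nm.
  rewrite -/(partial_at V f m) -/(partial_at V f N) => /le_trans; apply.
  have m0 : 0 <= m%:R^-1 :> R by rewrite invr_ge0.
  have i0 : 0 <= N%:R^-1 :> R by rewrite invr_ge0.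
  move: (N%:R^-1) (m%:R^-1) i0 m0 => I J i0 m0.
  have -> : 2 * (c / 8) * (I - J) = (c * I - c * J) / 4 by field.
  have := mulr_ge0 c0 i0; have := mulr_ge0 c0 m0.
  by move: (c * I) (c * J) => P Q; lra.
suff -> : fun_at V f = x by [].
by apply: cvg_lim; [exact: norm_hausdorff|exact/lim_toP].
Qed.

Lemma fun_atE (V : A) f x : unitary V -> circle f -> lim_to (partial_at V f) x ->
  fun_at V f = x.
Proof. by move=> hV cf; apply: lim_to_uniq; exact: fun_at_lim. Qed.

(** Cruder than a bound by the sup norm, but obtained from the Fourier coefficients alone: [2 * c0]
    bounds the one of index 0, and the second derivative bounds the sum of the others. *)
Lemma fun_at_bound (V : A) f (c0 c2 : R) : unitary V -> circle f ->
  (forall x, nrc (f x) <= c0) -> (forall x, nrc (cderive (cderive f) x) <= c2) ->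
  nra (fun_at V f) <= 2 * c0 + c2.
Proof.
move=> hV cf h0 h2; apply: lim_to_bound (fun_at_lim V f hV cf) => N.
have FB j n : `|n|%N = j.+1 ->
    nra (fourier_coef f n *: upow V n) <= c2 / 8 / j.+1%:R ^+ 2.
  by move=> nj; rewrite nra_coef//; exact: fc_decay2.
apply: (le_trans (symsum_bound _ _ _ N FB)); rewrite nra_coef//.
have := fc_bound f c0 0 cf h0.
by have := le_trans (nr_ge0 _ _) (h2 0); lra.
Qed.

Lemma fun_atD (V : A) f g : unitary V -> circle f -> circle g ->
  fun_at V (fun x => f x + g x) = fun_at V f + fun_at V g.
Proof.
move=> hV cf cg; apply: fun_atE => //; first exact: circleD.
apply: (lim_to_ext _ _ _ 0%N _ (lim_toD _ _ _ _ (fun_at_lim V f hV cf) (fun_at_lim V g hV cg))) => N _.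
rewrite /partial_at -symsumD; apply: symsum_ext => n.
by rewrite fcD// scalerDl.
Qed.

Lemma fun_atZ (V : A) f c : unitary V -> circle f ->
  fun_at V (fun x => c * f x) = c *: fun_at V f.
Proof.
move=> hV cf; apply: fun_atE => //; first by apply: circleM => //; exact: circle_cst.
apply: (lim_to_ext _ _ _ 0%N _ (lim_toZ _ _ c (fun_at_lim V f hV cf))) => N _.
rewrite /partial_at (symsum_morph _ _ ( *:%R c)) ?scaler0//; last first.
  by move=> ? ?; rewrite scalerDr.
by apply: symsum_ext => n; rewrite fcZ// scalerA.
Qed.

Lemma fun_at0 (V : A) : unitary V -> fun_at V (fun=> 0) = 0.
Proof.
move=> hV; have := fun_atZ V (fun=> 0) 0 hV (circle_cst 0).
by rewrite scale0r; under [X in fun_at _ X]eq_fun do rewrite mul0r.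
Qed.

Lemma fun_at_star (V : A) f : unitary V -> circle f ->
  star (fun_at V f) = fun_at V (fun x => (f x)^*%C).
Proof.
move=> hV cf; apply/esym/fun_atE => //; first exact: circleJ.
apply: (lim_to_ext _ _ _ 0%N _ (lim_to_star _ _ (fun_at_lim V f hV cf))) => N _.
rewrite /partial_at (symsum_morph _ _ (@star R A)) ?star0//; last exact: starD.
rewrite -[RHS]symsum_opp; apply: symsum_ext => n.
by rewrite starZ star_upow// fcJ// opprK.
Qed.

(** Moving [w] across the n-th power of [V] costs the phase [cexp (n t)], which is also the effect
    of translation by [t] on the n-th Fourier coefficient. *)
Lemma fun_at_comm (V w : A) f t : unitary V -> V * w = cexp t *: (w * V) -> circle f ->
  fun_at V f * w = w * fun_at V (fun x => f (x + t)).
Proof.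
move=> hV Vw cf; have ct := circle_shift _ t cf.
apply: lim_to_uniq (lim_toMr _ _ w (fun_at_lim V f hV cf)) _.
apply: (lim_to_ext _ _ _ 0%N _ (lim_toMl _ _ w (fun_at_lim V _ hV ct))) => N _.
rewrite /partial_at (symsum_morph _ _ (fun z : A => w * z)) ?mulr0//; last first.
  by move=> ? ?; rewrite mulrDr.
rewrite (symsum_morph _ _ (fun z : A => z * w)) ?mul0r//; last first.
  by move=> ? ?; rewrite mulrDl.
apply: symsum_ext => n; rewrite -scalerAl -scalerAr (comm_upow V w t)//.
by rewrite scalerA fc_shift// mulrC.
Qed.

Lemma fun_at_morph (V V' : A) (phi : A -> A) f : unitary V -> unitary V' ->
  {morph phi : x y / x + y} -> (forall (c : R[i]) x, phi (c *: x) = c *: phi x) ->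
  (forall x, nra (phi x) <= nra x) ->
  (forall n, phi (upow V n) = upow V' n) -> circle f ->
  phi (fun_at V f) = fun_at V' f.
Proof.
move=> hV hV' phiD phiZ hphi phiV cf.
apply/esym/fun_atE => //.
have hc x : nra (phi x) <= 1 * nra x by rewrite mul1r.
apply: (lim_to_ext _ _ _ 0%N _ (lim_to_lip phi 1 _ _ ltr01 phiD hc (fun_at_lim V f hV cf))) => N _.
rewrite /partial_at (symsum_morph _ _ phi) //; last first.
  by apply: (addrI (phi 0)); rewrite -phiD !addr0.
by apply: symsum_ext => n; rewrite phiZ phiV.
Qed.

Lemma symsum_shift1 (W : zmodType) N (G : int -> W) :
  symsum N (fun n => G (n - 1)) = symsum N G + (G (- N%:Z - 1) - G N%:Z).
Proof.
elim: N => [|N IH].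
  by rewrite !symsum0 oppr0 addrCA subrr addr0.
rewrite !symsumS IH (_ : N.+1%:Z - 1 = N%:Z); last by lia.
rewrite (_ : - N%:Z - 1 = - N.+1%:Z); last by lia.
move: (symsum N G) (G (- N.+1%:Z)) (G (- N.+1%:Z - 1)) (G N.+1) (G N) => s a b c d.
have -> : s + (a - d) + (d + b) = s + (a + b) + (- d + d).
  by rewrite -!addrA; congr (s + (a + _)); rewrite [RHS]addrC -!addrA.
rewrite addNr addr0 -!addrA; congr (s + _).
by rewrite [RHS]addrCA [c + _]addrC addrNK addrC.
Qed.

(** Multiplication by the exponential shifts the coefficients by one. The partial sums of both sides
    then differ by two boundary terms, which the decay of the coefficients makes small. *)
Lemma fun_at_cexp1 (V : A) f : unitary V -> circle f ->
  fun_at V (fun x => f x * cexp (1%:~R * x)) = fun_at V f * V.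
Proof.
move=> hV cf; have [c c0 hc] := cderive2_bounded f cf.
apply: fun_atE => //; first by apply: circleM => //; exact: circle_cexp.
pose G n := fourier_coef f n *: upow V n.
have GB j n : `|n|%N = j.+1 -> nra (G n) <= c / 8 / j.+1%:R ^+ 2.
  by move=> nj; rewrite nra_coef//; exact: fc_decay2.
apply: (lim_to_near (fun N => partial_at V f N * V)).
  exact: lim_toMr (fun_at_lim V f hV cf).
apply: (lim_to_bound_inv _ c c0) => N N0.
have -> : partial_at V (fun x => f x * cexp (1%:~R * x)) N =
    symsum N (fun n => G (n - 1)) * V.
  rewrite /partial_at (symsum_morph _ _ (fun z : A => z * V)) ?mul0r//; last first.
    by move=> ? ?; rewrite mulrDl.
  apply: symsum_ext => n; rewrite /G -scalerAl -upowS// subrK.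
  by rewrite fc_cexp.
rewrite symsum_shift1 -/(partial_at V f N) -mulrBl [_ + _ - _]addrAC subrr add0r.
apply: (le_trans (nraM _ _)); rewrite (nra_unitary V)// mulr1.
apply: (le_trans (nrB _ _ _)).
case: N N0 => // N _.
have h1 := GB N.+1 (- N.+1%:Z - 1) ltac:(lia).
have h2 := GB N N.+1%:Z erefl.
have N1 : 0 < N.+1%:R :> R by rewrite ltr0n.
have le1 : 1 <= N.+1%:R :> R by rewrite ler1n.
have b2 : c / 8 / N.+1%:R ^+ 2 <= c / N.+1%:R / 8.
  rewrite (_ : c / 8 / N.+1%:R ^+ 2 = c / N.+1%:R / 8 / N.+1%:R); last first.
    by field; rewrite gt_eqF.
  by rewrite ler_pdivrMr// ler_peMr// !divr_ge0// ltW.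
have b1 : c / 8 / N.+2%:R ^+ 2 <= c / 8 / N.+1%:R ^+ 2.
  rewrite ler_wpM2l ?divr_ge0// lef_pV2 ?posrE ?exprn_gt0 ?ltr0n//.
  by rewrite lerXn2r ?nnegrE// ler_nat.
apply: (le_trans (lerD (le_trans h1 b1) h2)); apply: (le_trans (lerD b2 b2)).
by move: (divr_ge0 c0 (ltW N1)); move: (c / N.+1%:R) => X; lra.
Qed.

Lemma fun_at_cexp (V : A) f n : unitary V -> circle f ->
  fun_at V (fun x => f x * cexp (n%:~R * x)) = fun_at V f * upow V n.
Proof.
move=> hV cf.
have cn (m : int) : circle (fun x => f x * cexp (m%:~R * x)).
  by apply: circleM => //; exact: circle_cexp.
have step (m : int) : fun_at V (fun x => f x * cexp ((m + 1)%:~R * x)) =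
    fun_at V (fun x => f x * cexp (m%:~R * x)) * V.
  rewrite -(fun_at_cexp1 V _ hV (cn m)); apply: fun_at_ext => x.
  by rewrite -mulrA -cexpD; congr (_ * cexp _); rewrite intrD; ring.
elim/int_ind: n => [|n IH|n IH].
- by rewrite /= mulr1; congr fun_at; apply/funext => x; rewrite mul0r cexp0 mulr1.
- have -> : n.+1%:Z = n%:Z + 1 by lia.
  by rewrite step IH upowS// mulrA.
(* For negative indices the recursion is solved for the unknown factor by multiplying with
   [star V]. *)
- have := step (- n.+1%:Z); rewrite (_ : - n.+1%:Z + 1 = - n%:Z); last by lia.
  rewrite IH; move: (fun_at V (fun x => f x * cexp ((- n.+1%:Z)%:~R * x))) => z e.
  rewrite -[LHS]mulr1 -(proj2 hV) mulrA -e -mulrA -upowB1//.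
  by congr (_ * upow _ _); lia.
Qed.

(** * Multiplicativity of the functional calculus *)

Definition trig_sum g N x := symsum N (fun n => fourier_coef g n * cexp (n%:~R * x)).

Lemma circle_trig_sum g N : circle (trig_sum g N).
Proof.
have h n : circle (fun x => fourier_coef g n * cexp (n%:~R * x)).
  by apply: circleM; [exact: circle_cst|exact: circle_cexp].
rewrite /trig_sum; elim: N => [|N IH].
  by under eq_fun do rewrite symsum0; exact: h.
by under eq_fun do rewrite symsumS; apply: circleD => //; exact: circleD.
Qed.

Lemma cisD_add f g f' g' : cisD f f' -> cisD g g' ->
  cisD (fun x => f x + g x) (fun x => f' x + g' x).
Proof.
move=> [f1 f2] [g1 g2]; split.
  under eq_fun do rewrite cReD; apply: isD_ext (isDD _ _ _ _ f1 g1) _ => x.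
  by rewrite cReD.
under eq_fun do rewrite cImD; apply: isD_ext (isDD _ _ _ _ f2 g2) _ => x.
by rewrite cImD.
Qed.

Lemma cisD_cst (c : R[i]) : cisD (fun _ : R => c) (fun=> 0).
Proof. by split; exact: isD_cst. Qed.

Lemma cisD_scale c f f' : cisD f f' -> cisD (fun x => c * f x) (fun x => c * f' x).
Proof.
move=> df; have := cisDM _ _ _ _ (cisD_cst c) df.
by under [X in cisD _ X -> _]eq_fun do rewrite mul0r addr0.
Qed.

Lemma cderive_trig_sum g N : circle g ->
  cisD (trig_sum g N) (trig_sum (cderive g) N).
Proof.
move=> cg.
have h n : cisD (fun x => fourier_coef g n * cexp (n%:~R * x))
    (fun x => fourier_coef (cderive g) n * cexp (n%:~R * x)).
  have := cisD_scale (fourier_coef g n) _ _ (cisD_cexp (n%:~R : R)).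
  rewrite (_ : (fun x : R => fourier_coef g n * ((0 +i* (2 * pi * n%:~R)) * cexp (n%:~R * x))) =
    (fun x => fourier_coef (cderive g) n * cexp (n%:~R * x)))//.
  by apply/funext => x; rewrite fc_derive// mulrCA mulrA.
rewrite /trig_sum; elim: N => [|N IH].
  by under eq_fun do rewrite symsum0; under [X in cisD _ X]eq_fun do rewrite symsum0.
under eq_fun do rewrite symsumS; under [X in cisD _ X]eq_fun do rewrite symsumS.
by apply: cisD_add => //; exact: cisD_add.
Qed.

Definition remainder g N x := trig_sum g N x - g x.

(** Differentiation commutes with Fourier remainders, so inversion for [g], [g'] and [g''] controls
    a remainder together with two of its derivatives. *)
Lemma cderive_remainder g N : circle g ->
  cisD (remainder g N) (remainder (cderive g) N).
Proof.
move=> cg; have [dg _] := circle_derive _ cg.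
have := cisD_add _ _ _ _ (cderive_trig_sum g N cg) (cisD_scale (-1) _ _ dg).
rewrite /remainder.
by under eq_fun do rewrite mulN1r; under [X in cisD _ X -> _]eq_fun do rewrite mulN1r.
Qed.

Lemma circle_remainder g N : circle g -> circle (remainder g N).
Proof.
move=> cg; have := circleD _ _ (circle_trig_sum g N) (circleM _ _ (circle_cst (-1)) cg).
by rewrite /remainder; under eq_fun do rewrite mulN1r.
Qed.

Lemma fun_at_trig (V : A) f g N : unitary V -> circle f -> circle g ->
  fun_at V (fun x => f x * trig_sum g N x) = fun_at V f * partial_at V g N.
Proof.
move=> hV cf cg.
have h n : circle (fun x => f x * (fourier_coef g n * cexp (n%:~R * x))) /\
    fun_at V (fun x => f x * (fourier_coef g n * cexp (n%:~R * x))) =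
    fun_at V f * (fourier_coef g n *: upow V n).
  have cc : circle (fun x => f x * cexp (n%:~R * x)).
    by apply: circleM => //; exact: circle_cexp.
  under eq_fun do rewrite mulrCA; split; first by apply: circleM => //; exact: circle_cst.
  by rewrite fun_atZ// fun_at_cexp// scalerAr.
have cs M : circle (fun x => f x * trig_sum g M x).
  by apply: circleM => //; exact: circle_trig_sum.
rewrite /trig_sum /partial_at; elim: N => [|N IH].
  by under eq_fun do rewrite symsum0; rewrite symsum0 (h 0).2.
under eq_fun do rewrite symsumS !mulrDr.
have [h1 e1] := h N.+1%:Z; have [h2 e2] := h (- N.+1%:Z).
rewrite symsumS fun_atD//; [|exact: (cs N)|exact: (circleD _ _ h1 h2)].
by rewrite fun_atD// IH e1 e2 !mulrDr.
Qed.

(** With [g] replaced by its N-th Fourier sum the identity is exact. The error is the value at [V]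
    of [f] times the remainder of [g], and this product is O(1/N) together with its second
    derivative, as [fun_at_bound] requires. *)
Lemma fun_atM (V : A) f g : unitary V -> circle f -> circle g ->
  fun_at V (fun x => f x * g x) = fun_at V f * fun_at V g.
Proof.
move=> hV cf cg.
have cfg : circle (fun x => f x * g x) by exact: circleM.
apply: (lim_to_uniq (fun N => fun_at V f * partial_at V g N)); last first.
  exact: lim_toMl (fun_at_lim V g hV cg).
have [df cdf] := circle_derive _ cf; have [ddf cddf] := circle_derive _ cdf.
have [dg cdg] := circle_derive _ cg; have [ddg cddg] := circle_derive _ cdg.
have [a a0 ha] := circle_bounded _ cf.
have [a' a'0 ha'] := circle_bounded _ cdf.
have [a'' a''0 ha''] := circle_bounded _ cddf.
have [b b0 hb] := cderive2_bounded _ cg.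
have [b' b'0 hb'] := cderive2_bounded _ cdg.
have [b'' b''0 hb''] := cderive2_bounded _ cddg.
(* Twice a bound for [f * r], plus the four Leibniz terms of its second derivative, for a remainder
   [r] and without the factor 1/N. The constants [b], [b'], [b''] bound derivatives of [g] of orders
   2, 3, 4, because inversion consumes two derivatives. *)
pose C := 2 * (a * b) + ((a * b'' + a' * b') + (a' * b' + a'' * b)).
have C0 : 0 <= C by rewrite /C !addr_ge0 ?mulr_ge0.
apply: (lim_to_near (fun=> fun_at V (fun x => f x * g x))); first exact: lim_to_cst.
apply: (lim_to_bound_inv _ C C0) => N N0.
have cr := circle_remainder g N cg.
have -> : fun_at V f * partial_at V g N - fun_at V (fun x => f x * g x) =
    fun_at V (fun x => f x * remainder g N x).
  rewrite -fun_at_trig//.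
  have -> : (fun x => f x * trig_sum g N x) =
      (fun x => f x * remainder g N x + f x * g x).
    by apply/funext => x; rewrite /remainder; ring.
  by rewrite fun_atD ?addrK//; exact: circleM.
have NR : 0 < N%:R :> R by rewrite ltr0n.
have r0 x : nrc (remainder g N x) <= b / N%:R by exact: fourier_inversion.
have r1 x : nrc (remainder (cderive g) N x) <= b' / N%:R by exact: fourier_inversion.
have r2 x : nrc (remainder (cderive (cderive g)) N x) <= b'' / N%:R.
  exact: fourier_inversion.
have dr := cderive_remainder g N cg; have ddr := cderive_remainder _ N cdg.
have d1 := cisDM _ _ _ _ df dr.
have d2 := cisD_add _ _ _ _ (cisDM _ _ _ _ df ddr) (cisDM _ _ _ _ ddf dr).
have prod (z w : R[i]) (s t : R) : nrc z <= s -> nrc w <= t / N%:R ->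
    nrc (z * w) <= s * t / N%:R.
  by move=> zs wt; rewrite nrcM -mulrA ler_pM ?nr_ge0.
have CE : C / N%:R = 2 * (a * b / N%:R) + ((a * b'' / N%:R + a' * b' / N%:R) +
    (a' * b' / N%:R + a'' * b / N%:R)) by rewrite /C; field; rewrite gt_eqF.
rewrite CE; apply: fun_at_bound => //; first exact: circleM.
  by move=> x; exact: prod.
move=> x; rewrite (cisD_derive _ _ d1) (cisD_derive _ _ d2).
apply: (le_trans (nrD _ _ _)); apply: lerD; apply: (le_trans (nrD _ _ _)); apply: lerD; exact: prod.
Qed.

End FunctionalCalculus.

(** * Smooth elements and their expansions *)

Section SmoothElements.
Context {R : realType} {A : cstarAlgType R}.
Implicit Types (f g : R -> R[i]) (n : int).
Local Notation nra x := (nr _ (x : A)).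
Local Notation nrc := (nr R[i]).

(** Each further power of [1 + |n|] is paid for by one derivative. *)
Lemma fc_rapid k f : circle f ->
  exists2 C : R, 0 <= C & forall n, (1 + `|n|%:~R) ^+ k * nrc (fourier_coef f n) <= C.
Proof.
elim: k f => [|k IH] f cf.
  have [c c0 hc] := circle_bounded _ cf; exists (2 * c); first by rewrite mulr_ge0.
  by move=> n; rewrite expr0 mul1r; exact: fc_bound.
have [_ cdf] := circle_derive _ cf.
have [C1 C10 h1] := IH f cf; have [C2 C20 h2] := IH _ cdf.
exists (C1 + C2); first exact: addr_ge0.
move=> n; have := h1 n; have := h2 n; have := fc_decay1 f n cf.
rewrite -intr_norm.
have a0 : 0 <= `|n|%:~R :> R by rewrite ler0z.
have P0 : 0 <= (1 + `|n|%:~R) ^+ k :> R by rewrite exprn_ge0// addr_ge0.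
have u0 := nr_ge0 _ (fourier_coef f n).
move: a0 P0 u0; rewrite exprSr.
move: (`|n|%:~R) (nrc (fourier_coef f n)) => a u a0.
move: ((1 + a) ^+ k) => P P0 u0 h3 h4 h5.
have h6 : P * (4 * a * u) <= C2 by apply: le_trans h4; exact: ler_wpM2l.
have h7 : 0 <= P * (a * u) by rewrite !mulr_ge0.
have -> : P * (1 + a) * u = P * u + P * (a * u) by ring.
move: h6; rewrite (_ : P * (4 * a * u) = 4 * (P * (a * u))); last by ring.
by move: (P * u) (P * (a * u)) h5 h7 => X Y; lra.
Qed.

Lemma schwartzP (a : int -> int -> R[i]) : schwartz a <->
  forall k, exists C : R, forall m n : int,
    (1 + `|m|%:~R + `|n|%:~R) ^+ k * nrc (a m n) <= C.
Proof.
have e (m n : int) k : (1 + `|m|%:~R + `|n|%:~R) ^+ k * `|a m n| =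
    ((1 + `|m|%:~R + `|n|%:~R) ^+ k * nrc (a m n))%:C.
  by rewrite rmorphM rmorphXn /= !rmorphD /= rmorph1 !rmorph_int -nrE.
split=> h k; have [C hC] := h k; exists C => m n.
  by rewrite -lecR -e.
by rewrite e lecR.
Qed.

(** Records the coefficient of index (0, 0), on which the trace depends, along with a rapidly
    decreasing expansion. *)
Definition has_coefs (U V : A) (c : R[i]) (x : A) : Prop :=
  exists a, [/\ schwartz a, has_expansion U V a x & a 0 0 = c].

Lemma has_coefs_smooth (U V : A) c x : has_coefs U V c x -> smooth_elt U V x.
Proof. by move=> [a [h1 h2 _]]; exists a. Qed.

Lemma has_coefsD (U V : A) c d x y : has_coefs U V c x -> has_coefs U V d y ->
  has_coefs U V (c + d) (x + y).
Proof.
move=> [a [a1 a2 a3]] [b [b1 b2 b3]]; exists (fun m n => a m n + b m n).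
split; last by rewrite a3 b3.
  move/schwartzP : a1 => a1; move/schwartzP : b1 => b1; apply/schwartzP => k.
  have [C hC] := a1 k; have [D hD] := b1 k; exists (C + D) => m n.
  apply: le_trans (lerD (hC m n) (hD m n)); rewrite -mulrDr.
  apply: ler_wpM2l (nrD _ _ _); apply: exprn_ge0.
  by rewrite !addr_ge0// ler0z.
move/lim_toP : a2 => a2; move/lim_toP : b2 => b2; apply/lim_toP.
apply: (lim_to_ext _ _ _ 0%N _ (lim_toD _ _ _ _ a2 b2)) => N _.
rewrite -symsumD; apply: symsum_ext => m; rewrite -symsumD; apply: symsum_ext => n.
by rewrite scalerDl.
Qed.

Lemma symsum_delta (W : zmodType) N (m0 : int) (x : W) :
  symsum N (fun m => if m == m0 then x else 0) = if (`|m0| <= N)%N then x else 0.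
Proof.
elim: N => [|N IH].
  rewrite symsum0 leqn0 absz_eq0 eq_sym.
  by case: eqP.
rewrite symsumS IH.
have [h|h] := leqP `|m0|%N N.
  rewrite (_ : (`|m0| <= N.+1)%N = true); last by lia.
  by rewrite !ifF ?addr0//; apply/eqP; lia.
have [h1|h1] := eqVneq (N.+1%:Z) m0.
  by rewrite -h1 /= leqnn addr0 add0r.
have [h2|h2] := eqVneq (- N.+1%:Z) m0.
  by rewrite -h2 /= leqnn !add0r.
by rewrite !addr0 ifF//; apply/negbTE; lia.
Qed.

(** The strict bounds on [T] keep the five indices distinct and in range. *)
Lemma symsum_support (W : zmodType) (M T : nat) (X : int -> W) : (0 < T < M)%N ->
  (forall n, n != 0 -> n != T%:Z -> n != - T%:Z -> n != M%:Z -> n != - M%:Z -> X n = 0) ->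
  symsum M X = X 0 + X T%:Z + X (- T%:Z) + X M%:Z + X (- M%:Z).
Proof.
move=> TM X0.
transitivity (symsum M (fun n => (if n == 0 then X 0 else 0) +
    (if n == T%:Z then X T%:Z else 0) + (if n == - T%:Z then X (- T%:Z) else 0) +
    (if n == M%:Z then X M%:Z else 0) + (if n == - M%:Z then X (- M%:Z) else 0))).
  apply: symsum_ext => n.
  have [->|n0] := eqVneq n 0; first by rewrite !ifF ?addr0//; apply/eqP; lia.
  have [->|nT] := eqVneq n T%:Z.
    by rewrite !ifF ?addr0 ?add0r//; apply/eqP; lia.
  have [->|nT'] := eqVneq n (- T%:Z).
    by rewrite !ifF ?addr0 ?add0r//; apply/eqP; lia.
  have [->|nM] := eqVneq n M%:Z.
    by rewrite !ifF ?addr0 ?add0r//; apply/eqP; lia.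
  have [->|nM'] := eqVneq n (- M%:Z); first by rewrite !add0r.
  by rewrite X0// !addr0.
rewrite !symsumD !symsum_delta !abszN /= leqnn.
by rewrite (_ : (T <= M)%N = true)//; lia.
Qed.

Lemma has_coefs_monomial (U V : A) m0 f : unitary U -> unitary V -> circle f ->
  has_coefs U V (if m0 == 0 then fourier_coef f 0 else 0) (upow U m0 * fun_at V f).
Proof.
move=> hU hV cf.
exists (fun m n => if m == m0 then fourier_coef f n else 0); split.
- apply/schwartzP => k; have [C C0 hC] := fc_rapid k f cf.
  exists ((1 + `|m0|%:~R) ^+ k * C) => m n.
  have m00 : 0 <= `|m0|%:~R :> R by rewrite ler0z.
  have n00 : 0 <= `|n|%:~R :> R by rewrite ler0z.
  have K0 : 0 <= (1 + `|m0|%:~R) ^+ k :> R by rewrite exprn_ge0// addr_ge0.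
  case: eqP => [->|_]; last by rewrite nr0 mulr0 mulr_ge0.
  (* The weights are separated by [1 + |m0| + |n| <= (1 + |m0|) (1 + |n|)]. *)
  apply: le_trans (ler_wpM2l K0 (hC n)); rewrite mulrA ler_wpM2r ?nr_ge0//.
  rewrite -exprMn lerXn2r ?nnegrE ?mulr_ge0 ?addr_ge0//.
  by move: (`|m0|%:~R : R) (`|n|%:~R : R) m00 n00 => a b; nra.
- apply/lim_toP; apply: (lim_to_ext _ _ _ `|m0|%N _
    (lim_toMl _ _ (upow U m0) (fun_at_lim V f hV cf))) => N mN.
  transitivity (symsum N (fun m => if m == m0 then upow U m0 * partial_at V f N else 0)).
    by rewrite symsum_delta mN.
  apply: symsum_ext => m; case: eqP => [->|_]; last first.
    rewrite -[LHS](mulr0 (0 : A)) -[RHS](symsum_ext _ _ (fun=> 0)); last first.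
      by move=> n; rewrite scale0r.
    by rewrite mulr0 /symsum big1.
  rewrite /partial_at (symsum_morph _ _ (fun z : A => upow U m0 * z)) ?mulr0//; last first.
    by move=> ? ?; rewrite mulrDr.
  by apply: symsum_ext => n; rewrite scalerAr.
- by rewrite eq_sym.
Qed.

Lemma has_coefs_symsum (U V : A) M (F : int -> R -> R[i]) :
  unitary U -> unitary V -> (forall n, circle (F n)) ->
  has_coefs U V (fourier_coef (F 0) 0) (symsum M (fun n => upow U n * fun_at V (F n))).
Proof.
move=> hU hV cF; elim: M => [|M IH].
  rewrite symsum0; exact: (has_coefs_monomial U V 0 (F 0) hU hV (cF 0)).
have h1 := has_coefs_monomial U V M.+1%:Z _ hU hV (cF M.+1%:Z).
have h2 := has_coefs_monomial U V (- M.+1%:Z) _ hU hV (cF (- M.+1%:Z)).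
rewrite symsumS; have := has_coefsD _ _ _ _ _ _ IH (has_coefsD _ _ _ _ _ _ h1 h2).
by rewrite /= !addr0.
Qed.

Lemma upow_star (u : A) n : unitary u -> upow (star u) n = upow u (- n).
Proof.
by case: n => [[|n]|n] hu //=; rewrite starK.
Qed.

(** Both sides reverse the index of the Fourier coefficients. This is how the flip acts on f(V). *)
Lemma fun_at_starV (V : A) f : unitary V -> circle f ->
  fun_at (star V) f = fun_at V (fun x => f (- x)).
Proof.
move=> hV cf; apply: fun_atE => //; first exact: unitary_star.
apply: (lim_to_ext _ _ _ 0%N _ (fun_at_lim V _ hV (circle_opp _ cf))) => N _.
rewrite /partial_at -symsum_opp; apply: symsum_ext => n.
by rewrite fc_opp// opprK upow_star.
Qed.

(** [F], [G], [H] play the components along 1, U^T, U^M, and [G'], [H'] the adjoints of the last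
    two. Twelve of the 25 products vanish; the others are collected by their degree in U. *)
Lemma square_band (F G G' H H' : A) :
  G * G = 0 -> H * H = 0 -> G * H = 0 -> H * G = 0 -> G * H' = 0 -> H * G' = 0 ->
  G' * H = 0 -> H' * G = 0 -> G' * G' = 0 -> H' * H' = 0 -> G' * H' = 0 ->
  H' * G' = 0 -> F * G + G * F = G -> F * G' + G' * F = G' ->
  F * H + H * F = H -> F * H' + H' * F = H' ->
  F * F + G * G' + G' * G + H * H' + H' * H = F ->
  (F + G + G' + H + H') * (F + G + G' + H + H') = F + G + G' + H + H'.
Proof.
move=> e1 e2 e3 e4 e5 e6 e7 e8 e9 e10 e11 e12 hG hG' hH hH' hF.
have -> : (F + G + G' + H + H') * (F + G + G' + H + H') =
    (F * F + F * G + F * G' + F * H + F * H') + (G * F + G * G') +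
    (G' * F + G' * G) + (H * F + H * H') + (H' * F + H' * H).
  rewrite !mulrDl !mulrDr e1 e2 e3 e4 e5 e6 e7 e8 e9 e10 e11 e12.
  by rewrite !addr0.
rewrite (AC (5*2*2*2*2) ((1*7*9*11*13)*(2*6)*(3*8)*(4*10)*(5*12))).
by rewrite /= hF hG hG' hH hH'.
Qed.

(** No stabilisation is required: an idempotent is the product of [x = p] and [y = p] in either
    order. *)
Lemma K0_eq_refl (U V : A) (p : A) : unitary U -> unitary V ->
  smooth_elt U V p -> projection p -> K0_eq U V p p.
Proof.
move=> hU hV sp [_ pp].
pose x : 'M[A]_(1 + 0) := block_mx p%:M 0 0 1%:M.
have xx : x *m x = x.
  rewrite /x mulmx_block !mulmx0 !mul0mx !addr0 !add0r mulmx1 -scalar_mxM pp.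
  by [].
exists 0%N, x, x; split=> // i j.
have -> : x i j = p.
  rewrite /x !mxE; case: splitP => [i0 _|[//]]; rewrite !mxE.
  by case: splitP => [j0 _|[//]]; rewrite !mxE !ord1.
by [].
Qed.

End SmoothElements.

(** * Flip-invariant projections from functions on the circle *)

Section ProjectionFromFunctions.
Context {R : realType}.

(** Stated for an abstract calculus [phi], with [W n] in the role of U^n, so that only algebraic
    rules remain. The conditions on f, g, h are the components of p^2 = p along powers of U, up to
    taking adjoints; the three evenness conditions say that the flip fixes the middle component and
    exchanges each other one with its adjoint. *)
Lemma flip_projection (theta : R) (A : cstarAlgType R) (W : int -> A)
    (phi : (R -> R) -> A) (P : (R -> R) -> Prop) (sigma : {lrmorphism A -> A})
    (PM : forall u v, P u -> P v -> P (fun x => u x * v x))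
    (PD : forall u v, P u -> P v -> P (fun x => u x + v x))
    (Pshift : forall u a, P u -> P (fun x => u (x + a)))
    (phi_ext : forall u v, (forall x, u x = v x) -> phi u = phi v)
    (phiM : forall u v, P u -> P v -> phi u * phi v = phi (fun x => u x * v x))
    (phiD : forall u v, P u -> P v -> phi u + phi v = phi (fun x => u x + v x))
    (phi0 : phi (fun=> 0) = 0)
    (phi_star : forall u, P u -> star (phi u) = phi u)
    (phiW : forall u n, P u -> phi u * W n = W n * phi (fun x => u (x + n%:~R * theta)))
    (WD : forall n m, W n * W m = W (n + m)) (W0 : W 0 = 1)
    (Wstar : forall n, star (W n) = W (- n))
    (sigma_star : forall x, sigma (star x) = star (sigma x))
    (sigma_phi : forall u, P u -> sigma (phi u) = phi (fun x => u (- x)))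
    (sigmaW : forall n, sigma (W n) = W (- n))
    (M T : nat) (f g h : R -> R) (Pf : P f) (Pg : P g) (Ph : P h)
    (f_even : forall x, f (- x) = f x)
    (g_even : forall x, g (- x) = g (x - T%:R * theta))
    (h_even : forall x, h (- x) = h (x - M%:R * theta))
    (gg : forall x, g (x + T%:R * theta) * g x = 0)
    (hh : forall x, h (x + M%:R * theta) * h x = 0)
    (gh : forall x, g (x + M%:R * theta) * h x = 0)
    (hg : forall x, h (x + T%:R * theta) * g x = 0)
    (gh0 : forall x, g x * h x = 0)
    (ghd : forall x, g (x + M%:R * theta - T%:R * theta) * h x = 0)
    (fg : forall x, (f (x + T%:R * theta) + f x) * g x = g x)
    (fh : forall x, (f (x + M%:R * theta) + f x) * h x = h x)
    (ff : forall x, f x ^+ 2 + g (x - T%:R * theta) ^+ 2 + g x ^+ 2 +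
       h (x - M%:R * theta) ^+ 2 + h x ^+ 2 = f x) :
  let p := W 0 * phi f + W T%:Z * phi g + W (- T%:Z) * phi (fun x => g (x - T%:R * theta)) +
    W M%:Z * phi h + W (- M%:Z) * phi (fun x => h (x - M%:R * theta)) in
  projection p /\ sigma p = p.
Proof.
have [F FE] : exists F, F = phi f by exists (phi f).
have [G GE] : exists G, G = W T%:Z * phi g by eexists.
have [H HE] : exists H, H = W M%:Z * phi h by eexists.
(* Written as the adjoint of [G]; moving the power of U to the left translates the function and
   gives the form used in the statement. *)
have [G' GE'] : exists G', G' = phi g * W (- T%:Z) by eexists.
have [H' HE'] : exists H', H' = phi h * W (- M%:Z) by eexists.
have GE2 : G' = W (- T%:Z) * phi (fun x => g (x - T%:R * theta)).
  rewrite GE' (phiW _ _ Pg); congr (_ * _); apply: phi_ext => x.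
  by rewrite mulrNz mulNr -pmulrn.
have HE2 : H' = W (- M%:Z) * phi (fun x => h (x - M%:R * theta)).
  rewrite HE' (phiW _ _ Ph); congr (_ * _); apply: phi_ext => x.
  by rewrite mulrNz mulNr -pmulrn.
rewrite /= W0 mul1r -FE -GE -HE -GE2 -HE2.
have starG : star G = G' by rewrite GE GE' starM (phi_star _ Pg) Wstar.
have starH : star H = H' by rewrite HE HE' starM (phi_star _ Ph) Wstar.
have starG' : star G' = G by rewrite -starG starK.
have starH' : star H' = H by rewrite -starH starK.
have starF : star F = F by rewrite FE (phi_star _ Pf).
have phi_eq0 u : (forall x, u x = 0) -> phi u = 0.
  by move=> u0; rewrite (phi_ext u (fun=> 0)).
have WphiW u v (n m : int) : P u -> P v ->
    (forall x, u (x + m%:~R * theta) * v x = 0) -> (W n * phi u) * (W m * phi v) = 0.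
  move=> cu cv uv; rewrite mulrA -[W n * _ * _]mulrA (phiW _ _ cu) -!mulrA.
  by rewrite (phiM _ _ (Pshift _ _ cu) cv) (phi_eq0 _ uv) !mulr0.
have GG : G * G = 0 by rewrite GE; apply: WphiW => // x; exact: gg.
have HH : H * H = 0 by rewrite HE; apply: WphiW => // x; exact: hh.
have GH : G * H = 0 by rewrite GE HE; apply: WphiW => // x; exact: gh.
have HG : H * G = 0 by rewrite HE GE; apply: WphiW => // x; exact: hg.
have GH' : G * H' = 0.
  rewrite GE HE' mulrA -[_ * phi g * _]mulrA (phiM _ _ Pg Ph) (phi_eq0 _ gh0).
  by rewrite mulr0 mul0r.
have G'H : G' * H = 0.
  rewrite GE' HE mulrA -[phi g * _ * _]mulrA WD (phiW _ _ Pg) -mulrA.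
  rewrite (phiM _ _ (Pshift _ _ Pg) Ph) phi_eq0 ?mulr0// => x.
  rewrite -[RHS](ghd x); congr (g _ * _).
  by rewrite intrD mulrNz -!pmulrn; ring.
have HG' : H * G' = 0 by rewrite -starH' -starG -starM GH' star0.
have H'G : H' * G = 0 by rewrite -starH -starG' -starM G'H star0.
have G'G' : G' * G' = 0 by rewrite -starG -starM GG star0.
have H'H' : H' * H' = 0 by rewrite -starH -starM HH star0.
have G'H' : G' * H' = 0 by rewrite -starG -starH -starM HG star0.
have H'G' : H' * G' = 0 by rewrite -starG -starH -starM GH star0.
have band u (n : int) : P u ->
    (forall x, (f (x + n%:~R * theta) + f x) * u x = u x) ->
    F * (W n * phi u) + W n * phi u * F = W n * phi u.
  move=> cu fu; have Pfs := Pshift f (n%:~R * theta) Pf.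
  rewrite FE mulrA (phiW _ _ Pf) -!mulrA (phiM _ _ Pfs cu) (phiM _ _ cu Pf) -mulrDr.
  rewrite (phiD _ _ (PM _ _ Pfs cu) (PM _ _ cu Pf)); congr (_ * _).
  by apply: phi_ext => x; rewrite -[RHS]fu; ring.
have FG : F * G + G * F = G by rewrite GE; exact: band.
have FH : F * H + H * F = H by rewrite HE; exact: band.
have FG' : F * G' + G' * F = G'.
  by rewrite -{1}starG -{1}starG -starF -!starM -starD addrC FG.
have FH' : F * H' + H' * F = H'.
  by rewrite -{1}starH -{1}starH -starF -!starM -starD addrC FH.
have sq u (n : int) : P u ->
    W n * phi u * (phi u * W (- n)) = phi (fun x => u (x - n%:~R * theta) ^+ 2) /\
    phi u * W (- n) * (W n * phi u) = phi (fun x => u x ^+ 2).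
  move=> cu; split; rewrite mulrA.
    rewrite -[W n * phi u * phi u]mulrA (phiM _ _ cu cu) -mulrA (phiW _ _ (PM _ _ cu cu)).
    rewrite mulrA WD subrr W0 mul1r; apply: phi_ext => x.
    by rewrite mulrNz mulNr expr2.
  by rewrite -[phi u * _ * _]mulrA WD addNr W0 mulr1 (phiM _ _ cu cu).
have Psq u : P u -> P (fun x => u x ^+ 2) by move=> cu; exact: (PM _ _ cu cu).
have FF : F * F + G * G' + G' * G + H * H' + H' * H = F.
  have [g1 g2] := sq g T%:Z Pg; have [h1 h2] := sq h M%:Z Ph.
  rewrite FE GE GE' HE HE' g1 g2 h1 h2 (phiM _ _ Pf Pf).
  have k1 := PM _ _ Pf Pf; have k2 := Psq _ (Pshift g (- (T%:Z%:~R * theta)) Pg).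
  have k3 := Psq g Pg; have k4 := Psq _ (Pshift h (- (M%:Z%:~R * theta)) Ph).
  have k5 := Psq h Ph.
  have k12 := PD _ _ k1 k2; have k123 := PD _ _ k12 k3; have k1234 := PD _ _ k123 k4.
  rewrite (phiD _ _ k1 k2) (phiD _ _ k12 k3) (phiD _ _ k123 k4) (phiD _ _ k1234 k5).
  by apply: phi_ext => x; rewrite -[RHS]ff -expr2 -!pmulrn.
split; first split.
- by rewrite !starD starF starG starG' starH starH' (AC 5 (1*3*2*5*4)).
- exact: square_band.
have sigmaF : sigma F = F by rewrite FE (sigma_phi _ Pf); exact: phi_ext.
have sigmaG : sigma G = G'.
  by rewrite GE rmorphM /= sigmaW (sigma_phi _ Pg) GE2; congr (_ * _); exact: phi_ext.
have sigmaH : sigma H = H'.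
  by rewrite HE rmorphM /= sigmaW (sigma_phi _ Ph) HE2; congr (_ * _); exact: phi_ext.
have sigmaG' : sigma G' = G by rewrite -starG sigma_star sigmaG starG'.
have sigmaH' : sigma H' = H by rewrite -starH sigma_star sigmaH starH'.
by rewrite !raddfD /= sigmaF sigmaG sigmaG' sigmaH sigmaH' (AC 5 (1*3*2*5*4)).
Qed.

(** The trace is the zeroth Fourier coefficient of the component along 1, that is, the integral of
    [f]; the class is represented by the projection itself. *)
Lemma projection_of_functions (theta : R) (A : cstarAlgType R) (U V : A)
    (rel : torus_relations theta U V)
    (sigma : {lrmorphism A -> A}) (hsigma : is_flip U V sigma)
    (tau : A -> R[i]) (htau : is_canonical_trace U V tau)
    (M T : nat) (hT : (0 < T < M)%N) (f g h : R -> R)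
    (sf : smooth f) (pf : forall x, f (x + 1) = f x)
    (sg : smooth g) (pg : forall x, g (x + 1) = g x)
    (sh : smooth h) (ph : forall x, h (x + 1) = h x)
    (f_even : forall x, f (- x) = f x)
    (g_even : forall x, g (- x) = g (x - T%:R * theta))
    (h_even : forall x, h (- x) = h (x - M%:R * theta))
    (gg : forall x, g (x + T%:R * theta) * g x = 0)
    (hh : forall x, h (x + M%:R * theta) * h x = 0)
    (gh : forall x, g (x + M%:R * theta) * h x = 0)
    (hg : forall x, h (x + T%:R * theta) * g x = 0)
    (gh0 : forall x, g x * h x = 0)
    (ghd : forall x, g (x + M%:R * theta - T%:R * theta) * h x = 0)
    (fg : forall x, (f (x + T%:R * theta) + f x) * g x = g x)
    (fh : forall x, (f (x + M%:R * theta) + f x) * h x = h x)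
    (ff : forall x, f x ^+ 2 + g (x - T%:R * theta) ^+ 2 + g x ^+ 2 +
       h (x - M%:R * theta) ^+ 2 + h x ^+ 2 = f x)
    (h_neq0 : exists x, h x != 0)
    (intf : int01 f = T%:R * theta) :
  exists p : A,
    [/\ projection p, smooth_elt U V p /\ of_order U V M p, sigma p = p,
        represents_K0 U V tau p (T%:R * theta)
      & tau p = (T%:R * theta)%:C].
Proof.
have [hU hV VU] := rel.
have [[sigma_star sigma_norm] _ sigmaU sigmaV] := hsigma.
have sigmaX (x : A) n : sigma (x ^+ n) = sigma x ^+ n by exact: rmorphXn.
pose c (u : R -> R) (x : R) := (u x)%:C.
have cc u : smooth u -> (forall x, u (x + 1) = u x) -> circle (c u).
  by move=> su pu; split=> [|x]; [exact: csmooth_real|rewrite /c pu].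
have cf := cc f sf pf; have cg := cc g sg pg; have ch := cc h sh ph.
have ccM u v : circle (c u) -> circle (c v) -> circle (c (fun x => u x * v x)).
  move=> cu cv; rewrite (_ : c (fun x => u x * v x) = fun x => c u x * c v x).
    exact: circleM.
  by apply/funext => x; rewrite /c rmorphM.
have ccD u v : circle (c u) -> circle (c v) -> circle (c (fun x => u x + v x)).
  move=> cu cv; rewrite (_ : c (fun x => u x + v x) = fun x => c u x + c v x).
    exact: circleD.
  by apply/funext => x; rewrite /c rmorphD.
have ccS u a : circle (c u) -> circle (c (fun x => u (x + a))).
  by move=> cu; exact: (circle_shift _ a cu).
pose t := T%:R * theta; pose mu := M%:R * theta.
(* The components of degree -T and -M are translated because the powers of U stand to the left of
   the coefficient functions. *)
pose Fn (n : int) : R -> R[i] :=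
  if n == 0 then c f else if n == T%:Z then c g else
  if n == - T%:Z then c (fun x => g (x - t)) else if n == M%:Z then c h else
  if n == - M%:Z then c (fun x => h (x - mu)) else fun=> 0.
have cFn n : circle (Fn n).
  rewrite /Fn; do 5 ?[case: ifP => _] => //.
  - exact: ccS.
  - exact: ccS.
  - exact: circle_cst.
have Fn0 : Fn 0 = c f by rewrite /Fn eqxx.
have FnT : Fn T%:Z = c g by rewrite /Fn eqxx ifF//; apply/eqP; lia.
have FnT' : Fn (- T%:Z) = c (fun x => g (x - t)).
  by rewrite /Fn eqxx !ifF//; apply/eqP; lia.
have FnM : Fn M%:Z = c h by rewrite /Fn eqxx !ifF//; apply/eqP; lia.
have FnM' : Fn (- M%:Z) = c (fun x => h (x - mu)).
  by rewrite /Fn eqxx !ifF//; apply/eqP; lia.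
have Fn_eq0 n : n != 0 -> n != T%:Z -> n != - T%:Z -> n != M%:Z -> n != - M%:Z ->
    Fn n = fun=> 0.
  by rewrite /Fn; do 5 (move=> /negbTE ->).
pose p := symsum M (fun n => upow U n * fun_at V (Fn n)).
have pE : p = upow U 0 * fun_at V (c f) + upow U T%:Z * fun_at V (c g) +
    upow U (- T%:Z) * fun_at V (c (fun x => g (x - t))) + upow U M%:Z * fun_at V (c h) +
    upow U (- M%:Z) * fun_at V (c (fun x => h (x - mu))).
  have := symsum_support A M T (fun n => upow U n * fun_at V (Fn n)) hT.
  rewrite Fn0 FnT FnT' FnM FnM'; apply => n n0 nT nT' nM nM'.
  by rewrite (Fn_eq0 n n0 nT nT' nM nM') (fun_at0 V hV) mulr0.
have coefs : has_coefs U V (fourier_coef (Fn 0) 0) p by exact: has_coefs_symsum.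
have sp : smooth_elt U V p := has_coefs_smooth _ _ _ _ coefs.
have taup : tau p = (T%:R * theta)%:C.
  have [a [a1 a2 a3]] := coefs; rewrite (htau a p a1 a2) a3 Fn0 /fourier_coef.
  rewrite (_ : (fun x => _) = c f); last first.
    by apply/funext => x; rewrite mulr0z mul0r oppr0 cexp0 mulr1.
  by rewrite cintE /c /= intf int01_cst.
have phi_ext u v : (forall x, u x = v x) -> fun_at V (c u) = fun_at V (c v).
  by move=> uv; apply: fun_at_ext => x; rewrite /c uv.
have phiM u v : circle (c u) -> circle (c v) ->
    fun_at V (c u) * fun_at V (c v) = fun_at V (c (fun x => u x * v x)).
  move=> cu cv; rewrite -(fun_atM V (c u) (c v) hV cu cv).
  by apply: fun_at_ext => x; rewrite /c rmorphM.
have phiD u v : circle (c u) -> circle (c v) ->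
    fun_at V (c u) + fun_at V (c v) = fun_at V (c (fun x => u x + v x)).
  move=> cu cv; rewrite -(fun_atD V (c u) (c v) hV cu cv).
  by apply: fun_at_ext => x; rewrite /c rmorphD.
have phi_star u : circle (c u) -> star (fun_at V (c u)) = fun_at V (c u).
  move=> cu; rewrite (fun_at_star V (c u) hV cu).
  by apply: fun_at_ext => x; rewrite /c conjc_real.
have phiW u n : circle (c u) -> fun_at V (c u) * upow U n =
    upow U n * fun_at V (c (fun x => u (x + n%:~R * theta))).
  move=> cu; apply: (fun_at_comm V (upow U n) (c u) (n%:~R * theta) hV _ cu).
  have := comm_upow2 V U theta hV hU VU 1 n; rewrite mul1r.
  by rewrite (_ : upow V 1 = V)// /= expr1.
have sigma_phi u : circle (c u) -> sigma (fun_at V (c u)) = fun_at V (c (fun x => u (- x))).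
  move=> cu; transitivity (fun_at (star V) (c u)); last exact: (fun_at_starV V (c u) hV cu).
  apply: (fun_at_morph V (star V) sigma (c u) hV (unitary_star _ hV) _ _ _ _ cu).
  - exact: raddfD.
  - by move=> a x; rewrite linearZ.
  - by move=> x; rewrite -lecR -!nrE; exact: sigma_norm.
  - by case=> n /=; rewrite sigmaX ?sigma_star sigmaV upowN1.
have sigmaW n : sigma (upow U n) = upow U (- n).
  rewrite -(upow_star U n hU) -(upowN1 U) -sigmaU.
  by case: n => n /=; rewrite sigmaX ?sigma_star.
have [projp sigmap] : projection p /\ sigma p = p.
  rewrite pE; exact: (flip_projection theta A (upow U) (fun u => fun_at V (c u))
    (fun u => circle (c u)) sigma ccM ccD ccS phi_ext phiM phiD (fun_at0 V hV)
    phi_star phiW (fun n m => esym (upowD U n m hU)) erefl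
    (fun n => star_upow U n hU) sigma_star sigma_phi sigmaW M T f g h cf cg ch
    f_even g_even h_even gg hh gh hg gh0 ghd fg fh ff).
exists p; split=> //.
- split=> //; exists Fn; split=> //.
    by move=> n _; apply/smooth_circleE.
  have [x hx] := h_neq0; exists x; rewrite FnM.
  by apply: contra_neq hx => /complexI.
- by exists p; split=> //; exact: K0_eq_refl.
Qed.

End ProjectionFromFunctions.

(** * The functions f, g and h *)

Section BandFunctions.
Context {R : realType}.

(** Of the three quarter points of the interval, at least one differs from both [p] and [q]. *)
Lemma between_avoiding (a b p q : R) : a < b ->
  exists d, [/\ a < d < b, d != p & d != q].
Proof.
move=> ab; pose w i := a + (b - a) * i / 4.
have [h1|h1] := boolP ((w 1 != p) && (w 1 != q)).
  by have /andP[? ?] := h1; exists (w 1); split=> //; rewrite /w; lra.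
have [h2|h2] := boolP ((w 2 != p) && (w 2 != q)).
  by have /andP[? ?] := h2; exists (w 2); split=> //; rewrite /w; lra.
exists (w 3); split; first by rewrite /w; lra.
- apply/eqP => e; move: h1 h2; rewrite !negb_and !negbK -e.
  move=> /orP[|] /eqP e1 /orP[|] /eqP e2; move: e1 e2; rewrite /w => e1 e2;
    by move: ab e1 e2; rewrite /w in e; lra.
- apply/eqP => e; move: h1 h2; rewrite !negb_and !negbK -e.
  move=> /orP[|] /eqP e1 /orP[|] /eqP e2; move: e1 e2; rewrite /w => e1 e2;
    by move: ab e1 e2; rewrite /w in e; lra.
Qed.

(** For an antiderivative [S] of [s], the function [S (x + 1) - S x - x] is constant; its values at
    [t / 2] and [- (t / 2)] are compared. *)
Lemma int01_staircase (s : R -> R) t : continuous s -> (forall x, s (x + 1) = s x + 1) ->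
  int01 (fun x => s (x + t / 2) + -1 * s (x + - (t / 2))) = t.
Proof.
move=> cs s1; have [S hS] := antiderivative s cs.
have shift b := isD_shift _ _ b hS.
have ca b : continuous (fun x => s (x + b)) by exact: continuous_shiftf.
rewrite int01D ?int01Z//; last exact: continuous_scalef.
rewrite (int01E _ _ (shift _))// (int01E _ _ (shift (- (t / 2))))//.
have h : isD (fun x => S (x + 1) + - S x + - (1 * x + 0)) (fun=> 0).
  apply: isD_ext (isDD _ _ _ _ (isDD _ _ _ _ (shift 1) (isDN _ _ hS)) (isDN _ _ (isD_lin 1 0))) _ => x.
  by rewrite s1; ring.
have := isD0_cst _ (t / 2) (- (t / 2)) h.
by rewrite !add0r ![1 + _]addrC; lra.
Qed.

Lemma int_between (n : int) : -1 < n%:~R :> R -> n%:~R < 2 :> R -> n = 0 \/ n = 1.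
Proof.
rewrite -[-1]/((-1)%:~R) -[2]/(2%:~R) !ltr_int => h1 h2.
by case: n h1 h2 => -[|[|n]] //= _ _; [left|right].
Qed.

(** * Relative positions of points on the circle *)

Lemma staircase_dichotomy (e : R) s g z : 0 < e < 1 / 2 -> staircase e s g ->
  (exists n, near_int e n z) \/
  exists n : int, [/\ s z = n%:~R + 1 / 2, g z = 0 & n%:~R + e <= z <= n%:~R + 1 - e].
Proof.
move=> e12 [_ _ _ [_ _ _ _ [off _]]].
have := floor_itv z; rewrite intrD; move: (Num.floor z) => n fz.
have [h1|h1] := leP z (n%:~R + e).
  by left; exists n; rewrite /near_int ler_norml; clear -h1 fz e12; lra.
have [h2|h2] := leP (n%:~R + 1 - e) z.
  by left; exists (n + 1); rewrite /near_int ler_norml intrD; clear -h2 fz e12; lra.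
right; exists n; have [|-> ->] := off n z; first by clear -h1 h2; lra.
by split=> //; clear -h1 h2; lra.
Qed.

(* On the circle, [b] follows [a] at distance at least [4 * e]. *)
Definition precedes (e : R) (s g : R -> R) (a b : R) : Prop :=
  (forall x n, near_int e n (x + a) -> s (x + b) = n%:~R + 1 / 2 /\ g (x + b) = 0) /\
  (forall x n, near_int e n (x + b) -> s (x + a) = n%:~R - 1 / 2 /\ g (x + a) = 0).

Lemma precedesI (e : R) s g a b : 0 < e -> staircase e s g ->
  4 * e <= b - a <= 1 - 4 * e -> precedes e s g a b.
Proof.
move=> e0 [_ _ _ [_ _ _ _ [off _]]] ab; split=> x n; rewrite /near_int ler_norml => hn.
  by apply: off; clear -e0 ab hn; lra.
have [|-> ->] := off (n - 1) (x + a); rewrite intrD mulrN1z; clear -e0 ab hn; first lra.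
by split=> //; lra.
Qed.

(** For pairs that are separated modulo 1 but whose order on the circle is not known; [m] selects a
    representative of [b - a], and only the vanishing of [g] is retained. *)
Lemma off_points (e : R) s g a b (m : int) : 0 < e -> staircase e s g ->
  4 * e <= `|b - a - m%:~R| -> `|b - a - m%:~R| <= 1 - 4 * e ->
  forall x n, near_int e n (x + a) -> g (x + b) = 0.
Proof.
move=> e0 [_ _ _ [_ _ _ _ [off _]]] h1 h2 x n; rewrite /near_int ler_norml => hn.
have [h|h] := leP 0 (b - a - m%:~R).
  rewrite ger0_norm// in h1 h2; have [|//] := off (n + m) (x + b).
  by rewrite intrD; clear -e0 h1 h2 hn; lra.
rewrite ltr0_norm// in h1 h2; have [|//] := off (n + m - 1) (x + b).
by rewrite !intrD mulrN1z; clear -e0 h1 h2 hn; lra.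
Qed.

(* [y] and [y + mu] are the two ends of the second block: [y] lies outside the
   arc [-t/2, t/2] modulo 1 and [y + mu] inside. *)
Lemma block_position (t mu : R) : 0 < t < 1 -> 0 < mu < 1 ->
  exists y e : R, [/\ 0 < e < 1 / 2, 4 * e <= t <= 1 - 4 * e /\ 4 * e <= mu <= 1 - 4 * e,
    4 * e <= - (t / 2) - y /\ t / 2 - y <= 1 - 4 * e,
    4 * e <= y + mu + t / 2 /\ 4 * e <= t / 2 - (y + mu) &
    4 * e <= `|2 * y + 1| /\ 4 * e <= `|2 * (y + mu)|].
Proof.
move=> t01 mu01.
(* With [y = - (t / 2) - d], the bounds [0 < d < 1 - t] put [y] outside the arc and
   [mu - t < d < mu] put [y + mu] inside. The two excluded values would make [y = - 1/2] or
   [y + mu = 0], points that coincide on the circle with their mirror images. *)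
have [d [dlo dhi dn1 dn2]] : exists d : R, [/\ 0 < d /\ mu - t < d, d < mu /\ d < 1 - t,
    d != (1 - t) / 2 & d != mu - t / 2].
  have [|d [/andP[d1 d2] d3 d4]] := between_avoiding (Num.max 0 (mu - t))
      (Num.min mu (1 - t)) ((1 - t) / 2) (mu - t / 2).
    by rewrite gt_max !lt_min; apply/andP; split; apply/andP; split; lra.
  by exists d; move: d1 d2; rewrite gt_max lt_min => /andP[? ?] /andP[? ?].
pose y := - (t / 2) - d.
have a1 : 2 * y + 1 != 0.
  by apply: contra_neq dn1; rewrite /y; lra.
have a2 : y + mu != 0.
  by apply: contra_neq dn2; rewrite /y; lra.
(* The minimum of all the gaps that have to stay open; its quarter serves as the radius [e]. *)
pose m := Num.min (Num.min (Num.min t (1 - t)) (Num.min d (1 - t - d)))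
   (Num.min (Num.min (Num.min mu (1 - mu)) (Num.min (y + mu + t / 2) (t / 2 - (y + mu))))
     (Num.min `|2 * y + 1| `|2 * (y + mu)|)).
have m0 : 0 < m.
  rewrite /m !lt_min !normr_gt0 a1 mulf_neq0//= !andbT.
  by rewrite /y; repeat (apply/andP; split); lra.
have [[m1 m2 m3 m4] [m5 m6 m7 m8] m9 m10] :
    [/\ [/\ m <= t, m <= 1 - t, m <= d & m <= 1 - t - d],
        [/\ m <= mu, m <= 1 - mu, m <= y + mu + t / 2 & m <= t / 2 - (y + mu)],
        m <= `|2 * y + 1| & m <= `|2 * (y + mu)|].
  have : m <= m by []; rewrite {2}/m !le_min => /andP[/andP[/andP[? ?] /andP[? ?]]].
  by move=> /andP[/andP[/andP[? ?] /andP[? ?]] /andP[? ?]].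
clearbody m; exists y, (m / 4).
have -> : 4 * (m / 4) = m by field.
split=> //.
- by clear -m0 m1 m2; lra.
- by clear -m1 m2 m5 m6; split; lra.
- by rewrite /y; clear -m3 m4; split; lra.
Qed.

(** [f] is a smoothed indicator function of the arc, raised near [y0] and [- y0] and lowered near
    [y1] and [- y1]; these changes have equal integrals and cancel in the trace. The additional
    blocks are [{y0, y1}] and its mirror image [{- y1, - y0}]. The off-diagonal entries [g] and [h]
    are attached to the end of a block that is carried to the other end by adding [t] or [mu]. *)
Lemma band_functions_reduced (t mu : R) : 0 < t < 1 -> 0 < mu < 1 ->
  exists f g h : R -> R,
  [/\ [/\ smooth f, smooth g, smooth h & int01 f = t],
      [/\ forall x, f (x + 1) = f x, forall x, g (x + 1) = g x,
          forall x, h (x + 1) = h x & exists x, h x != 0],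
      [/\ forall x, f (- x) = f x, forall x, g (- x) = g (x - t) &
          forall x, h (- x) = h (x - mu)],
      [/\ forall x, g (x + t) * g x = 0, forall x, h (x + mu) * h x = 0,
          forall x, g (x + mu) * h x = 0, forall x, h (x + t) * g x = 0 &
          (forall x, g x * h x = 0) /\ forall x, g (x + mu - t) * h x = 0] &
      [/\ forall x, (f (x + t) + f x) * g x = g x,
          forall x, (f (x + mu) + f x) * h x = h x &
          forall x, f x ^+ 2 + g (x - t) ^+ 2 + g x ^+ 2 +
            h (x - mu) ^+ 2 + h x ^+ 2 = f x]].
Proof.
move=> t01 mu01.
have [y0 [e [e12 [t4 mu4] [d1 d2] [u1 u2] [v1 v2]]]] := block_position t mu t01 mu01.
have [s [ga hs]] : exists s ga, staircase e s ga by exact: staircase_exists.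
have [y1 y1E] : exists y1, y1 = y0 + mu by exists (y0 + mu).
rewrite -y1E in u1 u2 v2.
have e0 : 0 < e by clear -e12; lra.
(* Six block ends give fifteen pairs. Thirteen follow the order [y0], [- (t / 2)], then [y1] and
   [- y1], then [t / 2], [- y0]; the mirror pairs [y0], [- y0] and [y1], [- y1] are only known to be
   separated modulo 1. *)
have B1 : precedes e s ga (- (t / 2)) (t / 2).
  by apply: precedesI => //; clear -t4; lra.
have B2 : precedes e s ga y0 (- (t / 2)).
  by apply: precedesI => //; clear -d1 d2 e0 t4; lra.
have B3 : precedes e s ga y0 (t / 2).
  by apply: precedesI => //; clear -d1 d2 e0 t4; lra.
have B4 : precedes e s ga (t / 2) (- y0).
  by apply: precedesI => //; clear -d1 d2 e0 t4; lra.
have B5 : precedes e s ga (- (t / 2)) (- y0).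
  by apply: precedesI => //; clear -d1 d2 e0 t4; lra.
have B6 : precedes e s ga (- (t / 2)) y1.
  by apply: precedesI => //; clear -u1 u2 e0 t4; lra.
have B7 : precedes e s ga y1 (t / 2).
  by apply: precedesI => //; clear -u1 u2 e0 t4; lra.
have B8 : precedes e s ga (- y1) (t / 2).
  by apply: precedesI => //; clear -u1 u2 e0 t4; lra.
have B9 : precedes e s ga (- (t / 2)) (- y1).
  by apply: precedesI => //; clear -u1 u2 e0 t4; lra.
have B10 : precedes e s ga y0 y1.
  by apply: precedesI => //; clear -mu4 y1E; lra.
have B11 : precedes e s ga (- y1) (- y0).
  by apply: precedesI => //; clear -mu4 y1E; lra.
have B12 : precedes e s ga y0 (- y1).
  by apply: precedesI => //; clear -u1 u2 d1 d2 e0 t4; lra.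
have B13 : precedes e s ga y1 (- y0).
  by apply: precedesI => //; clear -u1 u2 d1 d2 e0 t4; lra.
pose dis a b := forall x n, near_int e n (x + a) -> ga (x + b) = 0.
have D14 : dis (- y0) y0.
  apply: (off_points e s ga _ _ (-1) e0 hs); rewrite mulrN1z.
    by rewrite (_ : _ - _ = 2 * y0 + 1)//; ring.
  by rewrite ler_norml; clear -d1 d2 t4 e0; lra.
have D14' : dis y0 (- y0).
  apply: (off_points e s ga _ _ 1 e0 hs); rewrite mulr1z.
    by rewrite (_ : _ - _ = - (2 * y0 + 1)) ?normrN//; ring.
  by rewrite ler_norml; clear -d1 d2 t4 e0; lra.
have D15 : dis (- y1) y1.
  apply: (off_points e s ga _ _ 0 e0 hs); rewrite mulr0z.
    by rewrite (_ : _ - _ = 2 * y1)//; ring.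
  by rewrite ler_norml; clear -u1 u2 t4 e0; lra.
have D15' : dis y1 (- y1).
  apply: (off_points e s ga _ _ 0 e0 hs); rewrite mulr0z.
    by rewrite (_ : _ - _ = - (2 * y1)) ?normrN//; ring.
  by rewrite ler_norml; clear -u1 u2 t4 e0; lra.
have P a b : precedes e s ga a b -> dis a b /\ dis b a.
  by move=> [h1 h2]; split=> x n hn; [case: (h1 x n hn)|case: (h2 x n hn)].
have [D1 D1'] := P _ _ B1; have [D2 D2'] := P _ _ B2; have [D3 D3'] := P _ _ B3.
have [D4 D4'] := P _ _ B4; have [D5 D5'] := P _ _ B5; have [D6 D6'] := P _ _ B6.
have [D7 D7'] := P _ _ B7; have [D8 D8'] := P _ _ B8; have [D9 D9'] := P _ _ B9.
have [D10 D10'] := P _ _ B10; have [D11 D11'] := P _ _ B11.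
have [D12 D12'] := P _ _ B12; have [D13 D13'] := P _ _ B13.
have dich z := staircase_dichotomy e s ga z e12 hs.
have [ss sg ga0 [s1 ga1 s_odd ga_even [_ on]]] := hs.
have ga_near z : ga z != 0 -> exists n, near_int e n z.
  by move=> gz; have [//|[n [_ g0 _]]] := dich z; rewrite g0 eqxx in gz.
(* The block with diagonal [k], [1 - k] and off-diagonal entry [l] is the projection onto the line
   spanned by [(sin, cos)] of the angle [ga], an angle that starts and ends at 0. *)
pose k x := sin (ga x) ^+ 2; pose l x := sin (ga x) * cos (ga x).
have kl x : k x ^+ 2 + l x ^+ 2 = k x.
  have := cos2Dsin2 (ga x); rewrite /k /l; set S := sin _; set C := cos _ => h.
  have -> : (S ^+ 2) ^+ 2 + (S * C) ^+ 2 = S ^+ 2 * (C ^+ 2 + S ^+ 2) by ring.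
  by rewrite h mulr1.
have k0 x : ga x = 0 -> k x = 0 by rewrite /k => ->; rewrite sin0 expr0n.
have l0 x : ga x = 0 -> l x = 0 by rewrite /l => ->; rewrite sin0 mul0r.
have k_even x : k (- x) = k x by rewrite /k ga_even.
have l_even x : l (- x) = l x by rewrite /l ga_even.
have k1 x : k (x + 1) = k x by rewrite /k ga1.
have l1 x : l (x + 1) = l x by rewrite /l ga1.
have sk : smooth k.
  rewrite /k; apply: (smoothM (fun x => sin (ga x)) (fun x => sin (ga x)));
    exact: smooth_comp smooth_sin sg.
have sl : smooth l.
  by apply: smoothM; [exact: smooth_comp smooth_sin sg|exact: smooth_comp smooth_cos sg].
pose f x := s (x + t / 2) + -1 * s (x + - (t / 2)) + (k (x + - y0) + k (x + y0)) +
  -1 * (k (x + - y1) + k (x + y1)).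
pose g x := ga (x + t / 2); pose h x := l (x + - y0) + l (x + y1).
have gt x : g (x - t) = ga (x + - (t / 2)) by rewrite /g; congr ga; field.
have hmu x : h (x - mu) = l (x + - y1) + l (x + y0).
  by rewrite /h; congr (l _ + l _); rewrite y1E; ring.
have gg0 a b x : dis a b -> ga (x + a) * ga (x + b) = 0.
  move=> ab; have [->|/ga_near[n hn]] := eqVneq (ga (x + a)) 0; first by rewrite mul0r.
  by rewrite (ab _ _ hn) mulr0.
have gl0 a b x : dis a b -> ga (x + a) * l (x + b) = 0.
  move=> ab; have [->|/ga_near[n hn]] := eqVneq (ga (x + a)) 0; first by rewrite mul0r.
  by rewrite (l0 _ (ab _ _ hn)) mulr0.
have ll0 a b x : dis a b -> l (x + a) * l (x + b) = 0.
  move=> ab; have [/l0->|/ga_near[n hn]] := eqVneq (ga (x + a)) 0; first by rewrite mul0r.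
  by rewrite (l0 _ (ab _ _ hn)) mulr0.
(* [fA] to [fF] give the values for x near [- (t / 2)], [t / 2], [y0], [- y0], [y1], [- y1] modulo
   1; at each place a single term of [f] is not locally constant. *)
have fA x n : near_int e n (x + t / 2) ->
    [/\ f x = s (x + t / 2) - n%:~R + 1 / 2, g (x - t) = 0, h x = 0 & h (x - mu) = 0].
  move=> hn; rewrite gt hmu /f /h (B1.2 _ _ hn).1 (D1' _ _ hn).
  rewrite !(k0 _ (D3' _ _ hn), k0 _ (D4 _ _ hn), k0 _ (D7' _ _ hn), k0 _ (D8' _ _ hn)).
  rewrite !(l0 _ (D3' _ _ hn), l0 _ (D4 _ _ hn), l0 _ (D7' _ _ hn), l0 _ (D8' _ _ hn)).
  by split; ring.
have fB x n : near_int e n (x + - (t / 2)) ->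
    [/\ f x = n%:~R + 1 / 2 - s (x + - (t / 2)), g x = 0, h x = 0 & h (x - mu) = 0].
  move=> hn; rewrite hmu /f /h /g (B1.1 _ _ hn).1 (D1 _ _ hn).
  rewrite !(k0 _ (D2' _ _ hn), k0 _ (D5 _ _ hn), k0 _ (D6 _ _ hn), k0 _ (D9 _ _ hn)).
  rewrite !(l0 _ (D2' _ _ hn), l0 _ (D5 _ _ hn), l0 _ (D6 _ _ hn), l0 _ (D9 _ _ hn)).
  by split; ring.
have fC x n : near_int e n (x + - y0) ->
    [/\ f x = k (x + - y0), g x = 0, g (x - t) = 0, h x = l (x + - y0) & h (x - mu) = 0].
  move=> hn; have [e1 z1] := B4.2 _ _ hn; have [e2 z2] := B5.2 _ _ hn.
  rewrite gt hmu /f /h /g e1 e2 z1 z2.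
  rewrite !(k0 _ (D14 _ _ hn), k0 _ (D11' _ _ hn), k0 _ (D13' _ _ hn)).
  rewrite !(l0 _ (D14 _ _ hn), l0 _ (D11' _ _ hn), l0 _ (D13' _ _ hn)).
  by split; ring.
have fD x n : near_int e n (x + y0) ->
    [/\ f x = k (x + y0), g x = 0, g (x - t) = 0, h x = 0 & h (x - mu) = l (x + y0)].
  move=> hn; have [e1 z1] := B3.1 _ _ hn; have [e2 z2] := B2.1 _ _ hn.
  rewrite gt hmu /f /h /g e1 e2 z1 z2.
  rewrite !(k0 _ (D14' _ _ hn), k0 _ (D10 _ _ hn), k0 _ (D12 _ _ hn)).
  rewrite !(l0 _ (D14' _ _ hn), l0 _ (D10 _ _ hn), l0 _ (D12 _ _ hn)).
  by split; ring.
have fE x n : near_int e n (x + - y1) ->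
    [/\ f x = 1 - k (x + - y1), g x = 0, g (x - t) = 0, h x = 0 & h (x - mu) = l (x + - y1)].
  move=> hn; have [e1 z1] := B8.1 _ _ hn; have [e2 z2] := B9.2 _ _ hn.
  rewrite gt hmu /f /h /g e1 e2 z1 z2.
  rewrite !(k0 _ (D15 _ _ hn), k0 _ (D11 _ _ hn), k0 _ (D12' _ _ hn)).
  rewrite !(l0 _ (D15 _ _ hn), l0 _ (D11 _ _ hn), l0 _ (D12' _ _ hn)).
  by split; field.
have fF x n : near_int e n (x + y1) ->
    [/\ f x = 1 - k (x + y1), g x = 0, g (x - t) = 0, h x = l (x + y1) & h (x - mu) = 0].
  move=> hn; have [e1 z1] := B7.1 _ _ hn; have [e2 z2] := B6.2 _ _ hn.
  rewrite gt hmu /f /h /g e1 e2 z1 z2.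
  rewrite !(k0 _ (D15' _ _ hn), k0 _ (D10' _ _ hn), k0 _ (D13 _ _ hn)).
  rewrite !(l0 _ (D15' _ _ hn), l0 _ (D10' _ _ hn), l0 _ (D13 _ _ hn)).
  by split; field.
have sh (u : R -> R) a : smooth u -> smooth (fun x => u (x + a)) by move=> su; exact: smooth_shift.
have sm1 (u : R -> R) : smooth u -> smooth (fun x => -1 * u x).
  by move=> su; apply: smoothM => //; exact: smooth_cst.
have sf1 : smooth (fun x => s (x + t / 2) + -1 * s (x + - (t / 2))).
  by apply: smoothD; [exact: sh|apply: sm1; exact: sh].
have sk2 a : smooth (fun x => k (x + - a) + k (x + a)) by apply: smoothD; exact: sh.
have sk2m a : smooth (fun x => -1 * (k (x + - a) + k (x + a))) by exact: sm1.
have sf12 := smoothD _ _ sf1 (sk2 y0).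
have sf : smooth f by exact: smoothD sf12 (sk2m y1).
exists f, g, h; split.
- split=> //; first exact: sh.
    by apply: smoothD; exact: sh.
  have ck : continuous k by exact: smooth_continuous.
  have ik a : int01 (fun x => k (x + - a) + k (x + a)) = int01 k + int01 k.
    by rewrite int01D ?(int01_shift k)//; exact: continuous_shiftf.
  rewrite /f (int01D _ _ (smooth_continuous _ sf12) (smooth_continuous _ (sk2m y1))).
  rewrite (int01D _ _ (smooth_continuous _ sf1) (smooth_continuous _ (sk2 y0))).
  rewrite (int01Z _ _ (smooth_continuous _ (sk2 y1))) !ik.
  by rewrite int01_staircase//; [ring|exact: smooth_continuous].
- split.
  + by move=> x; rewrite /f ![x + 1 + _]addrAC !s1 !k1; ring.
  + by move=> x; rewrite /g ![x + 1 + _]addrAC ga1.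
  + by move=> x; rewrite /h ![x + 1 + _]addrAC !l1.
  (* At [y0] the angle is [ga 0 = 1/2], whose sine and cosine are positive because
     [1/2 < pi / 2]. *)
  + exists y0; have n0 : near_int e 0 (y0 + - y0) by rewrite /near_int subrr mulr0z subrr normr0 ltW.
    have [_ _ _ -> _] := fC _ _ n0; rewrite subrr /l ga0.
    have p1 := pihalf_ge1 R.
    by rewrite mulf_neq0// gt_eqF// ?sin_gt0_pihalf ?cos_gt0_pihalf//; clear -p1; apply/andP; split; lra.
- split.
  + move=> x; rewrite /f.
    have -> : - x + t / 2 = - (x + - (t / 2)) by ring.
    have -> : - x + - (t / 2) = - (x + t / 2) by ring.
    have -> : - x + - y0 = - (x + y0) by ring.
    have -> : - x + y0 = - (x + - y0) by ring.
    have -> : - x + - y1 = - (x + y1) by ring.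
    have -> : - x + y1 = - (x + - y1) by ring.
    by rewrite !s_odd !k_even; ring.
  + by move=> x; rewrite gt -ga_even /g; congr ga; ring.
  + move=> x; rewrite hmu /h.
    have -> : - x + - y0 = - (x + y0) by ring.
    have -> : - x + y1 = - (x + - y1) by ring.
    by rewrite !l_even addrC.
- have gt' x : g x = ga (x + t + - (t / 2)) by rewrite -gt addrK.
  have hmu' x : h x = l (x + mu + - y1) + l (x + mu + y0) by rewrite -hmu addrK.
  split; last split.
  + by move=> x; rewrite [g x]gt' /g gg0.
  + move=> x; rewrite [h x]hmu' /h.
    by rewrite mulrDl !mulrDr !ll0 ?addr0.
  + move=> x; rewrite [h x]hmu' /g.
    by rewrite mulrDr !gl0 ?addr0.
  + move=> x; rewrite [g x]gt' /h.
    by rewrite mulrC mulrDr !gl0 ?addr0.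
  + by move=> x; rewrite /g /h mulrDr !gl0 ?addr0.
  + move=> x; rewrite gt [h x]hmu'.
    by rewrite mulrDr !gl0 ?addr0.
split.
(* Where [g] does not vanish, [x] and [x + t] are the two ends of one block, and its diagonal
   entries add up to 1. The same holds below for [h] and [mu]. *)
- move=> x; have [->|] := eqVneq (g x) 0; first by rewrite !mulr0.
  move=> /ga_near[n hn]; have [-> _ _ _] := fA _ _ hn.
  have hn' : near_int e n (x + t + - (t / 2)) by rewrite (_ : _ + _ = x + t / 2)//; field.
  have [-> _ _ _] := fB _ _ hn'.
  rewrite (_ : x + t + - (t / 2) = x + t / 2); last by field.
  move: (s (x + t / 2)) (n%:~R : R) (g x) => w z v.
  have -> : z + 1 / 2 - w + (w - z + 1 / 2) = 1 by field.
  by rewrite mul1r.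
- move=> x; have [/l0 z1|] := eqVneq (ga (x + - y0)) 0; last first.
    move=> /ga_near[n hn]; have [-> _ _ _ _] := fC _ _ hn.
    have E : x + mu + - y1 = x + - y0 by rewrite y1E; ring.
    have hn' : near_int e n (x + mu + - y1) by rewrite E.
    by have [-> _ _ _ _] := fE _ _ hn'; rewrite E subrK mul1r.
  have [/l0 z2|] := eqVneq (ga (x + y1)) 0.
    by rewrite /h z1 z2 addr0 mulr0.
  move=> /ga_near[n hn]; have [-> _ _ _ _] := fF _ _ hn.
  have E : x + mu + y0 = x + y1 by rewrite y1E; ring.
  have hn' : near_int e n (x + mu + y0) by rewrite E.
  by have [-> _ _ _ _] := fD _ _ hn'; rewrite E addrC subrK mul1r.
- move=> x.
  (* Near a block end the identity is a diagonal entry of the idempotency of one block. *)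
  have [[n hn]|[n1 [s1E g1E b1]]] := dich (x + t / 2).
    have [-> -> -> ->] := fA _ _ hn; have := on _ _ hn; rewrite /g.
    set w := s _; set v := ga _ => h1.
    have -> : (w - n%:~R + 1 / 2) ^+ 2 + 0 ^+ 2 + v ^+ 2 + 0 ^+ 2 + 0 ^+ 2 =
      ((w - n%:~R) ^+ 2 + v ^+ 2) + (w - n%:~R) + 1 / 4 by field.
    by rewrite h1; field.
  have [[n hn]|[n2 [s2E g2E b2]]] := dich (x + - (t / 2)).
    have [-> -> -> ->] := fB _ _ hn; have := on _ _ hn; rewrite gt.
    set w := s _; set v := ga _ => h1.
    have -> : (n%:~R + 1 / 2 - w) ^+ 2 + v ^+ 2 + 0 ^+ 2 + 0 ^+ 2 + 0 ^+ 2 =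
      ((w - n%:~R) ^+ 2 + v ^+ 2) - (w - n%:~R) + 1 / 4 by field.
    by rewrite h1; field.
  have [z1|/ga_near[n hn]] := eqVneq (ga (x + - y0)) 0; last first.
    by have [-> -> -> -> ->] := fC _ _ hn; rewrite -[RHS]kl; ring.
  have [z2|/ga_near[n hn]] := eqVneq (ga (x + y0)) 0; last first.
    by have [-> -> -> -> ->] := fD _ _ hn; rewrite -[RHS]kl; ring.
  have kl' z : (1 - k z) ^+ 2 + l z ^+ 2 = 1 - k z.
    have -> : (1 - k z) ^+ 2 + l z ^+ 2 = 1 - 2 * k z + (k z ^+ 2 + l z ^+ 2) by ring.
    by rewrite kl; ring.
  have [z3|/ga_near[n hn]] := eqVneq (ga (x + - y1)) 0; last first.
    by have [-> -> -> -> ->] := fE _ _ hn; rewrite -[RHS]kl'; ring.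
  have [z4|/ga_near[n hn]] := eqVneq (ga (x + y1)) 0; last first.
    by have [-> -> -> -> ->] := fF _ _ hn; rewrite -[RHS]kl'; ring.
  rewrite gt hmu /h /g /f !(l0 _ z1, l0 _ z2, l0 _ z3, l0 _ z4).
  rewrite !(k0 _ z1, k0 _ z2, k0 _ z3, k0 _ z4) g1E g2E s1E s2E.
  (* Away from all block ends [f] is the difference of two plateaus of the staircase, an integer
     strictly between -1 and 2, hence 0 or 1. *)
  have [lo hi] : (-1 < (n1 - n2)%:~R :> R) /\ ((n1 - n2)%:~R < 2 :> R).
    by rewrite intrD mulrNz; clear -b1 b2 t01 e0; split; lra.
  have n12 := int_between (n1 - n2) lo hi.
  have -> : n1%:~R = n2%:~R + (n1 - n2)%:~R :> R by rewrite -intrD addrC subrK.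
  by case: n12 => ->; rewrite ?mulr1z ?mulr0z; ring.
Qed.

(** The functions being periodic, [mu] matters only modulo 1, and its fractional part is nonzero. *)
Lemma band_functions (t mu : R) : 0 < t < 1 -> (forall n : int, mu != n%:~R) ->
  exists f g h : R -> R,
  [/\ [/\ smooth f, smooth g, smooth h & int01 f = t],
      [/\ forall x, f (x + 1) = f x, forall x, g (x + 1) = g x,
          forall x, h (x + 1) = h x & exists x, h x != 0],
      [/\ forall x, f (- x) = f x, forall x, g (- x) = g (x - t) &
          forall x, h (- x) = h (x - mu)],
      [/\ forall x, g (x + t) * g x = 0, forall x, h (x + mu) * h x = 0,
          forall x, g (x + mu) * h x = 0, forall x, h (x + t) * g x = 0 &
          (forall x, g x * h x = 0) /\ forall x, g (x + mu - t) * h x = 0] &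
      [/\ forall x, (f (x + t) + f x) * g x = g x,
          forall x, (f (x + mu) + f x) * h x = h x &
          forall x, f x ^+ 2 + g (x - t) ^+ 2 + g x ^+ 2 +
            h (x - mu) ^+ 2 + h x ^+ 2 = f x]].
Proof.
move=> t01 mu_int; pose N := Num.floor mu; pose nu := mu - N%:~R.
have nu01 : 0 < nu < 1.
  have := floor_itv mu; rewrite -/N intrD => /andP[h1 h2].
  have := mu_int N; rewrite neq_lt => /orP[|]; rewrite /nu; lra.
have [f [g [h [H1 [pf pg ph hn0] [e1 e2 e3] [m1 m2 m3 m4 [m5 m6]] [n1 n2 n3]]]]] :=
  band_functions_reduced t nu t01 nu01.
have addE u (pu : forall x, u (x + 1) = u x) x : u (x + mu) = u (x + nu) :> R.
  rewrite -(periodic_int u pu N (x + nu)); congr u; rewrite /nu; ring.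
have subE u (pu : forall x, u (x + 1) = u x) x : u (x - mu) = u (x - nu) :> R.
  rewrite -(periodic_int u pu N (x - mu)); congr u; rewrite /nu; ring.
exists f, g, h; split=> //.
- by split=> // x; rewrite subE.
- split=> //; [by move=> x; rewrite addE|by move=> x; rewrite addE|split=> // x].
  rewrite (_ : x + mu - t = x - t + mu); last by ring.
  by rewrite addE// (_ : x - t + nu = x + nu - t); [exact: m6|ring].
- split=> // x; first by rewrite addE.
  by rewrite subE.
Qed.

End BandFunctions.

(** * The alternating sum *)

Lemma altsum0 (R : realType) (M : nat) (k : nat -> nat) : altsum M k 0 = M%:R :> R.
Proof. by rewrite /altsum big_geq// addr0. Qed.

Lemma altsumS (R : realType) (M : nat) (k : nat -> nat) j :
  altsum M k j.+1 = altsum M k j + (-1) ^+ j.+1 * (k j.+1)%:R :> R.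
Proof. by rewrite /altsum big_nat_recr//= addrA. Qed.

(** The invariant alternates with parity. After a subtraction [T + k s <= M], so the smaller next
    term can be added without reaching [M]; after an addition [k s < T], so the smaller next term
    can be subtracted without reaching 0. *)
Lemma altsum_nat (R : realType) (M s : nat) (k : nat -> nat) :
  (1 <= s)%N -> (forall j, (1 <= j <= s)%N -> (1 <= k j <= M - 1)%N) ->
  (forall i j, (1 <= i)%N -> (i < j)%N -> (j <= s)%N -> (k j < k i)%N) ->
  exists T : nat, altsum M k s = T%:R :> R /\
    if odd s then (0 < T)%N /\ (T + k s <= M)%N else (k s < T)%N /\ (T < M)%N.
Proof.
elim: s => // -[_ _ hk _|s IH _ hk hdecr].
  have k1 := hk 1%N isT; exists (M - k 1)%N; split; last by split; lia.
  by rewrite altsumS altsum0 expr1 mulN1r natrB//; lia.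
have [||T [TE hT]] := IH isT.
- by move=> j hj; apply: hk; lia.
- by move=> i j i1 ij js; apply: hdecr => //; exact: leq_trans js _.
have k1 := hk s.+2 ltac:(lia); have k2 := hdecr s.+1 s.+2 isT (leqnn _) (leqnn _).
rewrite altsumS TE -signr_odd; move: hT => /=.
case: (odd s) => /= -[h1 h2]; rewrite ?expr0 ?mul1r ?expr1 ?mulN1r.
  exists (T - k s.+2)%N; split; last by split; lia.
  by rewrite natrB//; lia.
by exists (T + k s.+2)%N; split; [rewrite natrD|split; lia].
Qed.

(** * From the bounds on theta to the projection *)

Theorem proposition3 (R : realType) (theta : R)
    (htheta : 0 <= theta < 1) (htheta_irr : irrational theta)
    (A : cstarAlgType R) (U V : A) (hA : is_nctorus theta U V)
    (sigma : {lrmorphism A -> A}) (hsigma : is_flip U V sigma)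
    (tau : A -> R[i]) (htau : is_canonical_trace U V tau)
    (M s : nat) (hs : (1 <= s <= M - 1)%N)
    (k : nat -> nat)
    (hk : forall j, (1 <= j <= s)%N -> (1 <= k j <= M - 1)%N)
    (hk_decr : forall i j, (1 <= i)%N -> (i < j)%N -> (j <= s)%N ->
       (k j < k i)%N)
    (hodd : forall j, (1 <= j <= s)%N -> odd j ->
       cminus M k j < theta <= cplus M k j)
    (heven : forall j, (1 <= j <= s)%N -> ~~ odd j ->
       cminus M k j <= theta < cplus M k j) :
  exists p : A,
    [/\ projection p, smooth_elt U V p /\ of_order U V M p, sigma p = p,
        represents_K0 U V tau p (altsum M k s * theta)
      & tau p = (altsum M k s * theta)%:C].
Proof.
have s1 : (1 <= s)%N by move: hs => /andP[].
have [T [TE hT]] := altsum_nat R M s k s1 hk hk_decr.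
have ks := hk s ltac:(lia).
have TM : (0 < T < M)%N.
  by move: hT; case: ifP => _ [h1 h2]; lia.
have nrat (q : rat) : theta != ratr q.
  by apply/eqP => e; apply: htheta_irr; exists q.
have theta0 : 0 < theta.
  have := nrat 0; rewrite rmorph0 neq_lt => /orP[|//]; lra.
have T0 : 0 < T%:R :> R by rewrite ltr0n; lia.
have Tt0 : 0 < T%:R * theta by rewrite mulr_gt0.
have Tt1 : T%:R * theta < 1.
  have [so|se] := boolP (odd s).
    (* For odd [s] the upper bound at the last index reads [2 T theta <= 1]. *)
    have /andP[_] := hodd s ltac:(lia) so.
    rewrite /cplus so TE ler_pdivlMr ?mulr_gt0// => h.
    by clear -h Tt0; nra.
  (* For even [s] it reads [(2 T - k_s) theta < 1], and [T <= 2 T - k_s] because [k_s < T]. *)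
  have /andP[_] := heven s ltac:(lia) se.
  have sE : s = s.-1.+1 by lia.
  rewrite /cplus (negbTE se).
  have -> : altsum M k s.-1 = T%:R - (k s)%:R :> R.
    by rewrite -TE sE altsumS -sE -signr_odd (negbTE se) expr0 mul1r addrK.
  have kT : (k s)%:R + 1 <= T%:R :> R.
    by move: hT; rewrite (negbTE se) => -[h _]; rewrite natr1 ler_nat.
  rewrite ltr_pdivlMr; last by clear -kT; have := ler0n R (k s); lra.
  move=> h; apply: le_lt_trans h; rewrite [leRHS]mulrC ler_wpM2r ?(ltW theta0)//.
  by clear -kT; lra.
(* An integer value would make [theta] rational; the ends [x] and [x + M theta] of an additional
   block would then be the same point of the circle. *)
have mu_int (n : int) : M%:R * theta != n%:~R.
  apply/eqP => e; have /eqP := nrat (n%:~R / M%:R); apply.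
  rewrite fmorph_div rmorph_int rmorph_nat -e mulrAC divff ?mul1r//.
  by rewrite pnatr_eq0; lia.
have [f [g [h [[sf sg sh intf] [pf pg ph hn0] [e1 e2 e3] [m1 m2 m3 m4 [m5 m6]] [n1 n2 n3]]]]] :=
  band_functions (T%:R * theta) (M%:R * theta) ltac:(by rewrite Tt0 Tt1) mu_int.
rewrite TE; have [rel _ _] := hA.
exact: (projection_of_functions theta A U V rel sigma hsigma tau htau M T TM f g h).
Qed.
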